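(* Let $P,Q\in\mathbb{C}[z]$ be polynomials of degrees $d_1,d_2$ respectively, and let $F$ be an entire function of the form $F(z)=\int Q(z)e^{P(z)}\,dz$ (that is, $F'=Qe^{P}$). Then there exists a log-Riemann surface $(\mathcal{S},\pi)$ with $d_1$ infinite order ramification points and $d_2$ finite order ramification points (counted with multiplicity) such that $F$ lifts to a biholomorphism $\tilde F:\mathbb{C}\to\mathcal{S}^\times$, i.e. $\pi\circ\tilde F=F$.
   Context: A log-Riemann surface is a (connected) Riemann surface $\mathcal{S}$ equipped with a holomorphic local diffeomorphism $\pi:\mathcal{S}\to\mathbb{C}$ such that, letting $d$ be the path metric induced by the flat metric $|d\pi|$ and $\mathcal{S}^*=\mathcal{S}\sqcup\mathcal{R}$ the metric completion of $(\mathcal{S},d)$, the set $\mathcal{R}$ of added points is discrete. The map $\pi$ extends to $\mathcal{S}^*$, and near each $p\in\mathcal{R}$ it restricts to a covering of a punctured neighbourhood of $p$ onto a punctured disk in $\mathbb{C}$. The points of $\mathcal{R}$ are called ramification points; the order of $p$ (in $\{1,2,\dots\}\cup\{+\infty\}$) is the degree of this covering. The finite completion $\mathcal{S}^\times$ is the Riemann surface obtained by adding to $\mathcal{S}$ all ramification points of finite order; $\pi$ extends holomorphically to $\mathcal{S}^\times$. Counting with multiplicity means that a finite order ramification point of order $m$ is counted $m-1$ times (infinite order ramification points are counted once each). Polynomials having a degree are understood to be nonzero. *)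

(* Defs.v *)
From HB Require Import structures.
From mathcomp Require Import all_boot all_order all_algebra.
From mathcomp Require Import all_classical all_reals all_analysis.
From mathcomp Require Import complex.

Set Implicit Arguments.
Unset Strict Implicit.
Unset Printing Implicit Defensive.

Import Order.TTheory GRing.Theory Num.Theory.
Import numFieldNormedType.Exports.

Local Open Scope classical_set_scope.
Local Open Scope ring_scope.
Local Open Scope complex_scope.
Local Open Scope card_scope.

(* The regular algebra [R[i]^o] carries the norm topology of the complex      *)
(* numbers, and [derivable f z 1] for [f : Cplx R -> Cplx R] is complex       *)
(* differentiability at [z]: the increment ranges over the field [R[i]].      *)
Notation Cplx R := (R[i]^o).

(* [normc] is the modulus as an element of [R]; [`|z|] lives in [R[i]].       *)
Notation normc := Normc.normc.

Definition cexp (R : realType) (z : Cplx R) : Cplx R :=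
  (expR (complex.Re z))%:C * (cos (complex.Im z) +i* sin (complex.Im z)).

(* [f] restricts to a homeomorphism from [A] onto [B] with inverse [g];       *)
(* [f] and [g] are arbitrary off [A] and [B].                                 *)
Definition homeo_on (X Y : topologicalType) (A : set X) (B : set Y)
    (f : X -> Y) (g : Y -> X) : Prop :=
  [/\ f @` A = B, {within A, continuous f}, {within B, continuous g} &
      forall x, A x -> g (f x) = x].

Section RiemannSurfaces.
Variable R : realType.
Local Notation C := (Cplx R).

Record chart (S : topologicalType) := Chart {
  chart_dom : set S;
  chart_map : S -> C;
  chart_inv : C -> S;
  chart_open_dom : open chart_dom;
  chart_open_cod : open (chart_map @` chart_dom);
  chart_homeo : homeo_on chart_dom (chart_map @` chart_dom)
                         chart_map chart_inv
}.

(* Second countability is not required: it is automatic (Rado).               *)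
Record riemann_surface := RiemannSurface {
  rs_space :> topologicalType;
  rs_nonempty : [set: rs_space] !=set0;
  rs_connected : connected [set: rs_space];
  rs_hausdorff : hausdorff_space rs_space;
  rs_atlas : set (chart rs_space);
  rs_cover : forall x, exists2 c, rs_atlas c & chart_dom c x;
  rs_compat : forall c c', rs_atlas c -> rs_atlas c' ->
    forall x, chart_dom c x -> chart_dom c' x ->
      derivable (chart_map c' \o chart_inv c : C -> C) (chart_map c x) 1
}.

Definition holomorphic_at (S T : riemann_surface) (f : S -> T) (p : S) : Prop :=
  {for p, continuous f} /\
  forall c c', rs_atlas c -> rs_atlas c' ->
    chart_dom c p -> chart_dom c' (f p) ->
    derivable (chart_map c' \o f \o chart_inv c : C -> C) (chart_map c p) 1.

Definition holomorphic (S T : riemann_surface) (f : S -> T) : Prop :=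
  forall p, holomorphic_at f p.

Definition biholomorphism (S T : riemann_surface) (f : S -> T) : Prop :=
  holomorphic f /\
  exists g : T -> S, [/\ cancel f g, cancel g f & holomorphic g].

Definition holomorphic_local_diffeo (S T : riemann_surface) (f : S -> T) : Prop :=
  holomorphic f /\
  forall p, exists (U : set S) (g : T -> S),
    [/\ open_nbhs p U, open (f @` U), homeo_on U (f @` U) f g &
        forall q, (f @` U) q -> holomorphic_at g q].

Lemma homeo_on_id (X : topologicalType) (A : set X) : homeo_on A (id @` A) id id.
Proof.
by split => //; apply: continuous_subspaceT => x; exact: cvg_id.
Qed.

Lemma Cplx_connected : connected [set: C].
Proof.
pose l (z : C) (t : R) : C := t%:C * z.
have lc z : continuous (l z).
  move=> t; apply/cvgrPdist_lt => e e0.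
  have [->|z0] := eqVneq z 0.
    by near=> s; rewrite /l !mulr0 subrr normr0.
  have ez : 0 < e / `|z| by rewrite divr_gt0// normr_gt0.
  have eE : (complex.Re (e / `|z|))%:C = e / `|z|.
    by move: (e / `|z|) ez => [a b]; rewrite ltcE/= => /andP[/eqP -> _].
  have d0 : 0 < complex.Re (e / `|z|) by rewrite -ltcR eE.
  near=> s.
  rewrite /l -mulrBl normrM -rmorphB -ltr_pdivlMr ?normr_gt0// -eE.
  have -> : `|(t - s)%:C| = (`|t - s|)%:C.
    by rewrite normc_def/= expr0n/= addr0 sqrtr_sqr.
  rewrite ltcR.
  near: s; exact: (@cvgr_dist_lt R R^o _ _ _ id t).
have -> : [set: C] = \bigcup_(z in [set: C]) (l z @` `[0, 1]).
  apply/seteqP; split => // z _; exists z => //; exists 1 => /=.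
    by rewrite in_itv/= ler01 lexx.
  by rewrite /l mul1r.
apply: bigcup_connected.
  exists 0 => z _; exists 0; first by rewrite /= in_itv/= lexx ler01.
  by rewrite /l mul0r.
move=> z _; apply: connected_continuous_connected.
  exact: segment_connected.
by apply: continuous_subspaceT; exact: lc.
Unshelve. all: by end_near. Qed.

Definition Cplx_chart : chart C :=
  @Chart C setT id id openT
    (eq_ind_r (fun A => open A) openT (image_id setT)) (homeo_on_id setT).

Lemma Cplx_compat (c c' : chart C) : [set Cplx_chart] c -> [set Cplx_chart] c' ->
  forall x, chart_dom c x -> chart_dom c' x ->
    derivable (chart_map c' \o chart_inv c : C -> C) (chart_map c x) 1.
Proof. by move=> -> -> x _ _; exact: derivable_id. Qed.

Definition complex_plane : riemann_surface :=
  @RiemannSurface C (ex_intro _ 0 I) Cplx_connected (@norm_hausdorff _ C)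
    [set Cplx_chart] (fun x => ex_intro2 _ _ Cplx_chart erefl I) Cplx_compat.

End RiemannSurfaces.

Section LogRiemannSurfaces.
Variable R : realType.
Local Notation C := (Cplx R).

(* The length of [gamma : [0, 1] -> S] for [|dpi|], i.e. the integral of      *)
(* [|dpi|] along [gamma], as the total variation of [pi \o gamma].            *)
Definition path_length (S : Type) (pi : S -> C) (gamma : R -> S) : \bar R :=
  ereal_sup [set (\sum_(0 <= n < size s)
      normc (pi (gamma (nth 1 (0 :: s) n.+1)) -
             pi (gamma (nth 1 (0 :: s) n))))%:E
    | s in [set s : seq R | itv_partition 0 1 s]].

Definition path_dist (S : topologicalType) (pi : S -> C) (x y : S) : \bar R :=
  ereal_inf [set path_length pi gamma | gamma in
    [set gamma : R -> S |
      [/\ {within `[0, 1], continuous gamma}, gamma 0 = x & gamma 1 = y]]].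

(* Unique up to a unique isometry compatible with [mc_embed].                 *)
Record metric_completion (X : Type) (d : X -> X -> \bar R) := MetricCompletion {
  mc_space :> metricType R;
  mc_embed : X -> mc_space;
  mc_isometry : forall x y, (mdist (mc_embed x) (mc_embed y))%:E = d x y;
  mc_dense : dense (range mc_embed);
  mc_complete : forall G : set_system mc_space,
    ProperFilter G -> cauchy G -> exists p : mc_space, G --> p
}.

(* The completion and the extension of [pi] to it are recorded as fields, but *)
(* both are determined by [lrs_surface] and [lrs_pi]: the former up to unique *)
(* isometry, the latter by density.                                           *)
Record log_riemann_surface := LogRiemannSurface {
  lrs_surface :> riemann_surface R;
  lrs_pi : lrs_surface -> complex_plane R;
  lrs_local_diffeo : holomorphic_local_diffeo lrs_pi;
  lrs_star : metric_completion (path_dist lrs_pi);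
  lrs_discrete : ~` range (@mc_embed _ _ lrs_star) `<=`
                 isolated (~` range (@mc_embed _ _ lrs_star));
  lrs_pi_star : lrs_star -> C;
  lrs_pi_star_continuous : continuous lrs_pi_star;
  lrs_pi_starE : forall x : lrs_surface,
    lrs_pi_star (@mc_embed _ _ lrs_star x) = lrs_pi x
}.

Definition lrs_embed (L : log_riemann_surface) : L -> lrs_star L :=
  @mc_embed _ _ (lrs_star L).

Definition ramification_set (L : log_riemann_surface) : set (lrs_star L) :=
  ~` range (@lrs_embed L).

Definition evenly_covered (X Y : topologicalType) (V : set X) (f : X -> Y)
    (O : set Y) : Prop :=
  exists sheets : set (set X),
    [/\ trivIset sheets id,
        \bigcup_(A in sheets) A = V `&` f @^-1` O &
        forall A, sheets A -> open A /\ exists g, homeo_on A O f g].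

Definition covering (X Y : topologicalType) (V : set X) (W : set Y)
    (f : X -> Y) : Prop :=
  [/\ f @` V = W, {within V, continuous f} &
      forall w, W w -> exists O, [/\ open_nbhs w O, O `<=` W & evenly_covered V f O]].

(* A degree is [Some m] for [m : nat], or [None] for an infinite degree.      *)
Definition covering_degree (X Y : Type) (V : set X) (W : set Y) (f : X -> Y)
    (n : option nat) : Prop :=
  forall w, W w ->
    match n return Prop with
    | Some m => V `&` f @^-1` [set w] #= `I_m
    | None => infinite_set (V `&` f @^-1` [set w])
    end.

Definition punctured_disk (a : C) (r : R) : set C :=
  [set w | 0 < normc (w - a) < r].

(* The punctured neighbourhood is taken connected: otherwise [U] could        *)
(* contain further components, away from [p], over the same punctured disk.   *)
Definition ramification_order (L : log_riemann_surface) (p : lrs_star L)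
    (n : option nat) : Prop :=
  ramification_set p /\
  exists (U : set (lrs_star L)) (r : R),
    let V := @lrs_embed L @^-1` U in
    let W := punctured_disk (lrs_pi_star p) r in
    [/\ open_nbhs p U /\ U `&` @ramification_set L = [set p],
        0 < r,
        open V /\ connected V,
        covering V W (@lrs_pi L) &
        covering_degree V W (@lrs_pi L) n].

Definition infinite_ramification (L : log_riemann_surface) : set (lrs_star L) :=
  [set p | ramification_order p None].

Definition finite_ramification (L : log_riemann_surface) : set (lrs_star L) :=
  [set p | exists m, ramification_order p (Some m)].

(* One element for each unit of multiplicity: a ramification point of order   *)
(* [m] contributes the [m - 1] pairs [(p, k)] with [k < m - 1].               *)
Definition finite_ramification_mult (L : log_riemann_surface) :
    set (lrs_star L * nat) :=
  [set pk | exists2 m, ramification_order pk.1 (Some m) & (pk.2 < m.-1)%N].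

(* The finite completion is characterized up to unique isomorphism over       *)
(* [lrs_star L]: [fc_incl] determines its topology, and its complex structure *)
(* is the only one for which [fc_lift] is holomorphic, because the points     *)
(* outside the range of [fc_lift] are isolated, hence removable.              *)
Record finite_completion (L : log_riemann_surface) := FiniteCompletion {
  fc_surface :> riemann_surface R;
  fc_incl : fc_surface -> lrs_star L;
  fc_range : range fc_incl = range (@lrs_embed L) `|` @finite_ramification L;
  fc_embedding : exists g, homeo_on setT (range fc_incl) fc_incl g;
  fc_lift : L -> fc_surface;
  fc_liftE : forall x, fc_incl (fc_lift x) = lrs_embed x;
  fc_lift_holomorphic : holomorphic fc_lift;
  fc_pi : fc_surface -> complex_plane R;
  fc_piE : forall x, fc_pi x = lrs_pi_star (fc_incl x);
  fc_pi_holomorphic : holomorphic fc_pi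
}.

End LogRiemannSurfaces.

(* Main.v *)
(* Let [S] be the complement in the plane of the zeros of [Q], with the flat    *)
(* metric [|F'| |dz|] and [pi = F]. Near a zero of [Q] of multiplicity [mu],    *)
(* [F - F p] is the exponential of a coordinate on a half-plane, defined modulo *)
(* [2 pi i (mu + 1)]. In each of the [d1] directions in which [Re P] tends to   *)
(* minus infinity, [F] has an asymptotic value [a], with                        *)
(* [F - a ~ Q e^P / P'], and [F - a] is the exponential of an injective         *)
(* coordinate onto a half-plane. Each of these half-planes completes by one     *)
(* point. There are no other points in the completion: far out and away from    *)
(* the half-planes, [|F'(z)| |z| >= delta |z|^d1], and the inverse of [F] has   *)
(* branches on disks of a fixed radius around [F z], bounded by [2 |z|], so     *)
(* that a Cauchy sequence for the path metric cannot escape there.              *)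
(* The map [s |-> a + exp s] from the half-plane, modulo its period, to the     *)
(* punctured disk gives the order of each added point. The order does not       *)
(* depend on the neighbourhood used to compute it: scaling the punctured disk   *)
(* towards its centre lifts to any connected covering of it.                    *)

Require Import Defs.
From HB Require Import structures.
From mathcomp Require Import all_boot all_order all_algebra.
From mathcomp Require Import all_classical all_reals all_analysis.
From mathcomp Require Import complex.
From mathcomp Require Import ring lra.

Set Implicit Arguments.
Unset Strict Implicit.
Unset Printing Implicit Defensive.

Import Order.TTheory GRing.Theory Num.Theory.
Import numFieldNormedType.Exports.

Local Open Scope classical_set_scope.
Local Open Scope ring_scope.
Local Open Scope complex_scope.
Local Open Scope card_scope.

Arguments Normc.normc : simpl never.
Arguments cexp : simpl never.

(** If [F] is to lift to a biholomorphism onto the finite completion, the latter must be the plane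
    with projection [F], and the surface must be the plane without the zeros of [Q], with the metric
    |F'| |dz|. It remains to find the metric completion of this domain: it should add each zero of
    [Q] of multiplicity mu, with order mu + 1, and one point of infinite order for each of the d1
    directions in which e^P decays.

    Both kinds of points come from [logarithmic_end]. Suppose that in some coordinate w near
    infinity [F] becomes f with f' ~ -e^k, where k' tends to -1 and k + w is small. Then f has a
    limit a, f - a ~ e^k, and L = k + Log((f - a)/e^k) is a logarithm of f - a, so close to -w that
    it can be inverted over a left half-plane. In the original variable the inverse is a chart psi
    with F (psi s) = a + e^s. At a point p, w is a multiple of -log(z - p) up to a constant, and psi
    has periods ([finite_log_chart]). At infinity, w = -lP z^d1, and the d1 branches of the root
    give d1 injective charts ([end_log_chart], [poly_exp_ends]). A point far out is either deep in
    one of these d1 charts, or [F'] is so large there that [F] has an inverse branch on a disk of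
    fixed radius ([uniform_branch]).

    These facts are collected in an [end_system], from which the surface is built. Distances are
    measured between deep points of charts ([end_near]); small balls about a point are the images of
    half-planes ([end_ball], [end_ball_psi]), because membership in such an image is locally
    constant ([end_nbhd_local]). Completeness is [end_complete]: a Cauchy sequence with no limit
    would tend to infinity outside all the ends, where an inverse branch confines it to a bounded
    set.

    The order of an added point is read off the map s to a + e^s on a half-plane modulo the periods
    of psi ([chart_image_covering], [chart_image_degree]), and [covering_near_center] shows that any
    other neighbourhood gives the same order ([ramification_order_end]). In [end_system_surface] the
    finite completion is the plane and the lift of [F] is the identity; the multiplicities add up to
    the degree of [Q]. *)

Section ComplexNorm.
Variable R : realType.
Implicit Types z w : R[i].

Lemma normcE2 z : normc z = Num.sqrt (complex.Re z ^+ 2 + complex.Im z ^+ 2).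
Proof. by case: z. Qed.

Lemma normc_ge0 z : 0 <= normc z.
Proof. by rewrite normcE2 sqrtr_ge0. Qed.

Lemma normc_sqr z : normc z ^+ 2 = complex.Re z ^+ 2 + complex.Im z ^+ 2.
Proof. by rewrite normcE2 sqr_sqrtr // addr_ge0 // sqr_ge0. Qed.

Lemma ler_normcD z w : normc (z + w) <= normc z + normc w.
Proof. exact: le_normcD. Qed.

Lemma normcZ (a : R) : normc (a%:C) = `|a|.
Proof. by rewrite normcE2/= expr0n/= addr0 sqrtr_sqr. Qed.

Lemma normcB z w : normc (z - w) = normc (w - z).
Proof. by rewrite -normcN opprB. Qed.

Lemma normcX z n : normc (z ^+ n) = normc z ^+ n.
Proof. by elim: n => [|n IH]; rewrite ?expr0 ?Normc.normc1 // !exprS Normc.normcM IH. Qed.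

Lemma ler_normcBD z w : normc (z - w) <= normc z + normc w.
Proof. by rewrite -[normc w]normcN; exact: ler_normcD. Qed.

Lemma ler_normc_dist z w u : normc (z - u) <= normc (z - w) + normc (w - u).
Proof. by have := ler_normcD (z - w) (w - u); rewrite addrA subrK. Qed.

Lemma ler_dist_normc z w : normc z - normc w <= normc (z - w).
Proof. by have := ler_normcD (z - w) w; rewrite subrK; lra. Qed.

Lemma ler_Re_normc z : `|complex.Re z| <= normc z.
Proof. by rewrite normcE2 -sqrtr_sqr ler_wsqrtr // lerDl sqr_ge0. Qed.

Lemma ler_Im_normc z : `|complex.Im z| <= normc z.
Proof. by rewrite normcE2 -sqrtr_sqr ler_wsqrtr // lerDr sqr_ge0. Qed.

Lemma ler_normc_ReIm z : normc z <= `|complex.Re z| + `|complex.Im z|.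
Proof.
case: z => a b /=.
rewrite -(ler_pXn2r (ltn0Sn 1)) ?nnegrE ?addr_ge0 ?normr_ge0 ?sqrtr_ge0//.
rewrite sqr_sqrtr ?addr_ge0 ?sqr_ge0 // sqrrD !real_normK ?num_real//.
by rewrite addrAC lerDl mulrn_wge0 // mulr_ge0.
Qed.

Lemma normc_gt0 z : (0 < normc z) = (z != 0).
Proof.
rewrite lt_neqAle normc_ge0 andbT eq_sym; congr (~~ _).
by apply/eqP/eqP => [/Normc.eq0_normc|->] //; rewrite Normc.normc0.
Qed.

Lemma normc_eq0 z : (normc z == 0) = (z == 0).
Proof. by apply/eqP/eqP => [/Normc.eq0_normc|->] //; rewrite Normc.normc0. Qed.

Lemma normrE z : `|z| = (normc z)%:C.
Proof. by case: z. Qed.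

Lemma normc_le_mul (z w : R[i]) (a b : R) : normc z <= a -> normc w <= b ->
  normc (z * w) <= a * b.
Proof. by move=> ? ?; rewrite Normc.normcM ler_pM // normc_ge0. Qed.

End ComplexNorm.

(** * Complex calculus with real error bounds *)

Section RealInduction.
Variable R : realType.

Lemma exists_nat_gt (x : R) : exists N : nat, x < N%:R.
Proof.
exists (Num.bound `|x|); apply: (le_lt_trans (ler_norm x)).
exact: archi_boundP.
Qed.

(** At the supremum [c] of the s for which [P] holds on all of [a, s], closedness from the left
    gives [P c]; if c < b, openness to the right would carry [P] past [c]. *)
Lemma real_induction (a b : R) (P : R -> Prop) : P a ->
  (forall t, a <= t -> t < b -> P t ->
     exists2 d, 0 < d & forall u, t < u -> u < t + d -> u <= b -> P u) ->
  (forall t, a < t -> t <= b -> (forall u, a <= u -> u < t -> P u) -> P t) ->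
  forall t, a <= t -> t <= b -> P t.
Proof.
move=> Pa Popen Pclosed t at_ tb.
pose T := [set s : R | [/\ a <= s, s <= b & forall u, a <= u -> u <= s -> P u]].
have Ta : T a.
  split => //; first exact: le_trans tb.
  by move=> u au ua; have -> : u = a by apply/eqP; rewrite eq_le au ua.
have supT : has_sup T by split; [exists a | exists b => s []].
have Ts s u : T s -> a <= u -> u <= s -> P u by move=> [_ _ H]; exact: H.
set c := sup T.
have ac : a <= c by apply: sup_upper_bound.
have cb : c <= b by apply: ge_sup; [exists a | move=> s []].
have Pc' u : a <= u -> u < c -> P u.
  move=> au uc; have := sup_adherent _ supT => /(_ (c - u)).
  rewrite subr_gt0 => /(_ uc) [s Tss]; rewrite -/c => us.
  apply: (Ts _ _ Tss) => //; move: us; lra.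
have Pc : P c.
  have [-> //|ac'] := eqVneq c a.
  by apply: Pclosed => //; rewrite lt_neqAle eq_sym ac'.
have Tc : T c.
  split => // u au; rewrite le_eqVlt => /orP[/eqP ->//|]; exact: Pc'.
have [cb'|] := ltP c b; last by move=> bc; apply: (Ts _ _ Tc) => //; exact: le_trans bc.
have [d d0 Pd] := Popen _ ac cb' Pc.
pose e := Num.min (c + d / 2) b.
have : T e.
  split.
  - by rewrite /e le_min; apply/andP; split; [lra|exact: le_trans at_ tb].
  - by rewrite /e ge_min lexx orbT.
  - move=> u au ue; have [uc|cu] := leP u c; first exact: (Ts _ _ Tc).
    move: ue; rewrite /e le_min => /andP[ue1 ue2].
    apply: Pd => //; lra.
move=> /(sup_upper_bound supT); rewrite -/c /e ge_min => /orP[]; lra.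
Qed.

(** Connectedness of the interval, in the form used for continuation along paths: a locally constant
    predicate is constant. *)
Lemma interval_clopen (a b : R) (P : R -> Prop) : P a ->
  (forall t, a <= t -> t <= b -> exists2 d, 0 < d &
     forall u, a <= u -> u <= b -> `|u - t| < d -> (P u <-> P t)) ->
  forall t, a <= t -> t <= b -> P t.
Proof.
move=> Pa loc; apply: real_induction => // t.
- move=> at_ tb Pt; have [d d0 H] := loc _ at_ (ltW tb).
  exists d => // u tu utd ub; apply/H => //; first by apply: (le_trans at_); exact: ltW.
  by rewrite gtr0_norm; lra.
- move=> at_ tb PI; have [d d0 H] := loc _ (ltW at_) tb.
  pose u := Num.max a (t - d / 2).
  have au : a <= u by rewrite /u le_max lexx.
  have ut : u < t by rewrite /u gt_max at_/=; lra.
  have utd : t - d / 2 <= u by rewrite /u le_max lexx orbT.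
  apply/(H u) => //; last exact: PI.
  + by apply: le_trans tb; exact: ltW.
  + by rewrite ltr0_norm; lra.
Qed.

(** The bound is assumed only to first order, with an error e per unit of time; induction along the
    interval accumulates an error e (b - a), and e is arbitrary. Both one-sided estimates are
    assumed because the induction leaves t to the right and reaches t from the left. *)
Lemma mean_value_bound (a b : R) (h : R -> R[i]) (B : R -> R) : a <= b ->
  (forall t e, a <= t -> t <= b -> 0 < e -> exists2 d, 0 < d &
     forall u, a <= u -> u <= b -> `|u - t| < d ->
       (t <= u -> normc (h u - h t) <= B u - B t + e * (u - t)) /\
       (u <= t -> normc (h t - h u) <= B t - B u + e * (t - u))) ->
  normc (h b - h a) <= B b - B a.
Proof.
move=> ab loc; apply/ler_addgt0Pr => e e0.
pose e1 := e / (b - a + 1).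
have ba1 : 0 < b - a + 1 by lra.
have e10 : 0 < e1 by rewrite divr_gt0.
have : normc (h b - h a) <= B b - B a + e1 * (b - a).
  apply: (@real_induction a b
    (fun t => normc (h t - h a) <= B t - B a + e1 * (t - a))) => //.
  - by rewrite !subrr Normc.normc0 mulr0 addr0.
  - move=> t at_ tb Pt; have [d d0 H] := loc t e1 at_ (ltW tb) e10.
    exists d => // u tu utd ub.
    have au : a <= u by apply: (le_trans at_); exact: ltW.
    have utd' : `|u - t| < d by rewrite gtr0_norm; lra.
    have [H1 _] := H u au ub utd'.
    have := H1 (ltW tu); have := ler_normc_dist (h u) (h t) (h a).
    nra.
  - move=> t at_ tb PI; have [d d0 H] := loc t e1 (ltW at_) tb e10.
    pose u := Num.max a (t - d / 2).
    have au : a <= u by rewrite /u le_max lexx.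
    have ut : u < t by rewrite /u gt_max at_/=; lra.
    have utd : t - d / 2 <= u by rewrite /u le_max lexx orbT.
    have ub : u <= b by apply: le_trans tb; exact: ltW.
    have utd' : `|u - t| < d by rewrite ltr0_norm; lra.
    have [_ H1] := H u au ub utd'.
    have := H1 (ltW ut); have := PI _ au ut; have := ler_normc_dist (h t) (h u) (h a).
    nra.
have : e1 * (b - a) <= e.
  rewrite /e1 mulrAC ler_pdivrMr //; nra.
lra.
Qed.

End RealInduction.

(** * Derivatives as first-order error estimates *)

Section ComplexDerivative.
Variable R : realType.
Local Notation C := R[i].
Implicit Types (f g : C -> C) (z w c d : C).

(** No quotient, and real [e] and [r]; [is_derive_CplxP] identifies this with [is_derive] over
    [R[i]], where the error bounds are elements of [R[i]]. *)
Definition cder f z c := forall e : R, 0 < e -> exists2 r : R, 0 < r &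
  forall w, normc (w - z) < r -> normc (f w - f z - c * (w - z)) <= e * normc (w - z).

Definition ccont f z := forall e : R, 0 < e -> exists2 r : R, 0 < r &
  forall w, normc (w - z) < r -> normc (f w - f z) < e.

Lemma cder_bound f z c : cder f z c -> exists2 r : R, 0 < r &
  forall w, normc (w - z) < r -> normc (f w - f z) <= (normc c + 1) * normc (w - z).
Proof.
move=> /(_ 1 ltr01) [r r0 H]; exists r => // w /H; rewrite mul1r => Hw.
have := ler_normcD (f w - f z - c * (w - z)) (c * (w - z)).
rewrite subrK Normc.normcM; lra.
Qed.

Lemma cder_cont f z c : cder f z c -> ccont f z.
Proof.
move=> /cder_bound [r r0 H] e e0.
have c1 : 0 < normc c + 1 by rewrite ltr_wpDl // normc_ge0.
exists (Num.min r (e / (normc c + 1))); first by rewrite lt_min r0 divr_gt0.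
move=> w; rewrite lt_min => /andP[/H Hw]; rewrite ltr_pdivlMr // => we.
apply: (le_lt_trans Hw); by rewrite mulrC.
Qed.

Lemma cder_eq f g z c : (exists2 r : R, 0 < r & forall w, normc (w - z) < r -> f w = g w) ->
  cder f z c -> cder g z c.
Proof.
move=> [r r0 fg] fd e /fd [s s0 H]; exists (Num.min r s); first by rewrite lt_min r0.
move=> w; rewrite lt_min => /andP[wr ws].
by rewrite -!fg ?subrr ?Normc.normc0 //; exact: H.
Qed.

Lemma ccont_eq f g z : ccont f z -> (forall w, f w = g w) -> ccont g z.
Proof. by move=> fc fg e /fc [r r0 H]; exists r => // w; rewrite -!fg; exact: H. Qed.

Lemma cder_cst a z : cder (fun=> a) z 0.
Proof.
move=> e e0; exists 1 => // w _.
by rewrite mul0r subr0 subrr Normc.normc0 mulr_ge0 ?normc_ge0 ?ltW.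
Qed.

Lemma cder_id z : cder id z 1.
Proof.
move=> e e0; exists 1 => // w _.
by rewrite mul1r subrr Normc.normc0 mulr_ge0 ?normc_ge0 ?ltW.
Qed.

Lemma cderD f g z c d : cder f z c -> cder g z d -> cder (fun w => f w + g w) z (c + d).
Proof.
move=> fc gd e e0.
have [r r0 Hr] := fc (e / 2) (divr_gt0 e0 (ltr0Sn _ 1)).
have [s s0 Hs] := gd (e / 2) (divr_gt0 e0 (ltr0Sn _ 1)).
exists (Num.min r s); first by rewrite lt_min r0.
move=> w; rewrite lt_min => /andP[/Hr H1 /Hs H2].
have -> : f w + g w - (f z + g z) - (c + d) * (w - z) =
  (f w - f z - c * (w - z)) + (g w - g z - d * (w - z)) by ring.
by apply: (le_trans (ler_normcD _ _)); lra.
Qed.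

Lemma cderZ a f z c : cder f z c -> cder (fun w => a * f w) z (a * c).
Proof.
move=> fc e e0.
have a1 : 0 < normc a + 1 by rewrite ltr_wpDl // normc_ge0.
have [r r0 Hr] := fc (e / (normc a + 1)) (divr_gt0 e0 a1).
exists r => // w /Hr H1.
rewrite -mulrA -!mulrBr Normc.normcM.
have Nw := normc_ge0 (w - z); have Na := normc_ge0 a.
apply: (@le_trans _ _ (normc a * (e / (normc a + 1) * normc (w - z)))).
  by rewrite ler_wpM2l.
rewrite mulrA ler_wpM2r // mulrA ler_pdivrMr //; nra.
Qed.

Lemma cderM f g z c d : cder f z c -> cder g z d ->
  cder (fun w => f w * g w) z (c * g z + f z * d).
Proof.
move=> fc gd e e0.
have gz1 : 0 < normc (g z) + 1 by rewrite ltr_wpDl // normc_ge0.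
have fz1 : 0 < normc (f z) + 1 by rewrite ltr_wpDl // normc_ge0.
have c1 : 0 < normc c + 1 by rewrite ltr_wpDl // normc_ge0.
have d1 : 0 < normc d + 1 by rewrite ltr_wpDl // normc_ge0.
have [r r0 Hr] := fc (e / 3 / (normc (g z) + 1)) ltac:(by rewrite !divr_gt0).
have [s s0 Hs] := gd (e / 3 / (normc (f z) + 1)) ltac:(by rewrite !divr_gt0).
have [r' r'0 Hr'] := cder_bound fc.
have [s' s'0 Hs'] := cder_bound gd.
exists (Num.min (Num.min r s) (Num.min (Num.min r' s')
          (e / 3 / ((normc c + 1) * (normc d + 1))))).
  by rewrite !lt_min r0 s0 r'0 s'0 !divr_gt0 // mulr_gt0.
move=> w; rewrite !lt_min => /andP[/andP[/Hr H1 /Hs H2] /andP[/andP[/Hr' H3 /Hs' H4]]].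
rewrite ltr_pdivlMr ?mulr_gt0 // => H5.
have -> : f w * g w - f z * g z - (c * g z + f z * d) * (w - z) =
  (f w - f z - c * (w - z)) * g z + f z * (g w - g z - d * (w - z))
  + (f w - f z) * (g w - g z) by ring.
have Nw := normc_ge0 (w - z).
have K1 : normc ((f w - f z - c * (w - z)) * g z) <= e / 3 * normc (w - z).
  rewrite Normc.normcM.
  apply: (@le_trans _ _ (e / 3 / (normc (g z) + 1) * normc (w - z) * normc (g z))).
    by rewrite ler_wpM2r // normc_ge0.
  rewrite mulrAC ler_wpM2r // mulrAC ler_pdivrMr //.
  by have := normc_ge0 (g z); nra.
have K2 : normc (f z * (g w - g z - d * (w - z))) <= e / 3 * normc (w - z).
  rewrite Normc.normcM mulrC.
  apply: (@le_trans _ _ (e / 3 / (normc (f z) + 1) * normc (w - z) * normc (f z))).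
    by rewrite ler_wpM2r // normc_ge0.
  rewrite mulrAC ler_wpM2r // mulrAC ler_pdivrMr //.
  by have := normc_ge0 (f z); nra.
have K3 : normc ((f w - f z) * (g w - g z)) <= e / 3 * normc (w - z).
  apply: (le_trans (normc_le_mul H3 H4)).
  rewrite mulrACA mulrA ler_wpM2r // mulrC; exact: ltW.
apply: (le_trans (ler_normcD _ _)).
have := ler_normcD ((f w - f z - c * (w - z)) * g z) (f z * (g w - g z - d * (w - z))).
lra.
Qed.

Lemma cder_comp f g z c d : cder f z c -> cder g (f z) d ->
  cder (fun w => g (f w)) z (d * c).
Proof.
move=> fc gd e e0.
have c1 : 0 < normc c + 1 by rewrite ltr_wpDl // normc_ge0.
have d1 : 0 < normc d + 1 by rewrite ltr_wpDl // normc_ge0.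
have [s s0 Hs] := gd (e / 2 / (normc c + 1)) ltac:(by rewrite !divr_gt0).
have [r r0 Hr] := fc (e / 2 / (normc d + 1)) ltac:(by rewrite !divr_gt0).
have [r' r'0 Hr'] := cder_bound fc.
have [r2 r20 Hr2] := cder_cont fc s0.
exists (Num.min r (Num.min r' r2)); first by rewrite !lt_min r0 r'0.
move=> w; rewrite !lt_min => /andP[/Hr H1 /andP[/Hr' H2 /Hr2 /Hs H3]].
have -> : g (f w) - g (f z) - d * c * (w - z) =
  (g (f w) - g (f z) - d * (f w - f z)) + d * (f w - f z - c * (w - z)) by ring.
have Nw := normc_ge0 (w - z).
apply: (le_trans (ler_normcD _ _)); rewrite Normc.normcM.
have K1 : normc (g (f w) - g (f z) - d * (f w - f z)) <= e / 2 * normc (w - z).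
  apply: (le_trans H3).
  apply: (@le_trans _ _ (e / 2 / (normc c + 1) * ((normc c + 1) * normc (w - z)))).
    by rewrite ler_wpM2l // !divr_ge0 // ltW.
  by rewrite mulrA divfK // gt_eqF.
have K2 : normc d * normc (f w - f z - c * (w - z)) <= e / 2 * normc (w - z).
  apply: (@le_trans _ _ (normc d * (e / 2 / (normc d + 1) * normc (w - z)))).
    by rewrite ler_wpM2l // normc_ge0.
  rewrite mulrA ler_wpM2r // mulrA ler_pdivrMr //; have := normc_ge0 d; nra.
lra.
Qed.

Lemma cder_poly (p : {poly C}) z : cder (fun w => p.[w]) z (p^`()).[z].
Proof.
elim/poly_ind: p => [|p a IH].
  rewrite deriv0 horner0; apply: cder_eq (cder_cst 0 z).
  by exists 1 => // w _; rewrite horner0.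
rewrite derivMXaddC !hornerE.
apply: (@cder_eq (fun w => p.[w] * w + a)).
  by exists 1 => // w _; rewrite !hornerE.
have := cderD (cderM IH (cder_id z)) (cder_cst a z).
by rewrite addr0 mulr1 addrC.
Qed.

(** The mean value inequality for [f w - c * w] along the segment. With [c = 0] it gives Lipschitz
    bounds; with [c] a nearby value of the derivative it says that [f] is close to linear. *)
Lemma mean_value_segment f (df : C -> C) w0 w1 c (M : R) :
  (forall t : R, 0 <= t <= 1 -> let w := w0 + t%:C * (w1 - w0) in
     cder f w (df w) /\ normc (df w - c) <= M) ->
  normc (f w1 - f w0 - c * (w1 - w0)) <= M * normc (w1 - w0).
Proof.
move=> H.
pose p (t : R) : C := w0 + t%:C * (w1 - w0).
pose h t := f (p t) - c * (p t).
pose D := normc (w1 - w0).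
have := @mean_value_bound R 0 1 h (fun t => M * D * t) ler01 _.
rewrite /h /p /= mul0r addr0 mul1r addrCA subrr addr0.
have -> : f w1 - c * w1 - (f w0 - c * w0) = f w1 - f w0 - c * (w1 - w0) by ring.
rewrite mulr1 mulr0 subr0; apply=> t e t0 t1 e0.
have [|fd Md] := H t; first by rewrite t0.
rewrite -/(p t) in fd Md.
have D0 : 0 <= D by exact: normc_ge0.
have D1 : 0 < D + 1 by rewrite ltr_wpDl.
have [r r0 Hr] := fd (e / (D + 1)) (divr_gt0 e0 D1).
exists (r / (D + 1)); first by rewrite divr_gt0.
have pB u : p u - p t = (u - t)%:C * (w1 - w0).
  by rewrite /p rmorphB /=; ring.
have NpB u : normc (p u - p t) = `|u - t| * D by rewrite pB Normc.normcM normcZ.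
have key u : `|u - t| < r / (D + 1) ->
  normc ((f (p u) - c * p u) - (f (p t) - c * p t)) <= M * D * `|u - t| + e * `|u - t|.
  move=> ut; have Nu := normr_ge0 (u - t).
  have : normc (p u - p t) < r.
    rewrite NpB; apply: (@le_lt_trans _ _ (`|u - t| * (D + 1))).
      by rewrite ler_wpM2l // lerDl.
    by rewrite -ltr_pdivlMr.
  move=> /Hr; rewrite NpB => H1.
  have -> : f (p u) - c * p u - (f (p t) - c * p t) =
    (f (p u) - f (p t) - df (p t) * (p u - p t)) + (df (p t) - c) * (p u - p t) by ring.
  apply: (le_trans (ler_normcD _ _)); rewrite (Normc.normcM (df _ - c)) NpB.
  have K1 : normc (df (p t) - c) * (`|u - t| * D) <= M * D * `|u - t|.
    by rewrite mulrAC -mulrA ler_wpM2r // mulr_ge0.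
  have K2 : e / (D + 1) * (`|u - t| * D) <= e * `|u - t|.
    rewrite mulrCA mulrC ler_wpM2r // mulrAC ler_pdivrMr //; nra.
  lra.
move=> u u0 u1 /[dup] ut /key Hu; split=> tu.
  by move: Hu; rewrite ger0_norm ?subr_ge0 // /p; lra.
rewrite normcB.
by move: Hu; rewrite ler0_norm ?subr_le0 // /p; lra.
Qed.

Lemma mean_value_ball f (df : C -> C) z0 (r : R) c (M : R) :
  (forall w, normc (w - z0) < r -> cder f w (df w) /\ normc (df w - c) <= M) ->
  forall w0 w1, normc (w0 - z0) < r -> normc (w1 - z0) < r ->
  normc (f w1 - f w0 - c * (w1 - w0)) <= M * normc (w1 - w0).
Proof.
move=> H w0 w1 h0 h1; apply: (@mean_value_segment f df) => t /andP[t0 t1] /=.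
apply: H.
have -> : w0 + t%:C * (w1 - w0) - z0 = (1 - t)%:C * (w0 - z0) + t%:C * (w1 - z0).
  by rewrite rmorphB rmorph1; ring.
apply: (le_lt_trans (ler_normcD _ _)); rewrite !Normc.normcM !normcZ.
rewrite !ger0_norm ?subr_ge0 //.
have [t10|t10] := eqVneq t 0; first by rewrite t10; lra.
have tp : 0 < t by rewrite lt_neqAle eq_sym t10.
have := normc_ge0 (w0 - z0); nra.
Qed.

Lemma cauchy_complex_cvg (u : nat -> C) :
  (forall e : R, 0 < e -> exists N, forall n m, (N <= n)%N -> (N <= m)%N ->
     normc (u n - u m) < e) ->
  exists l, forall e : R, 0 < e -> exists N, forall n, (N <= n)%N -> normc (u n - l) < e.
Proof.
move=> Cu.
have real_cvg (v : nat -> R) : (forall n m, `|v n - v m| <= normc (u n - u m)) ->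
    exists l, forall e : R, 0 < e -> exists N, forall n, (N <= n)%N -> `|v n - l| < e.
  move=> vu.
  have /cauchy_cvgP vc : cauchy (v @ \oo).
    apply/cauchy_ballP => e e0; have [N HN] := Cu _ e0.
    exists ([set v n | n in [set n | (N <= n)%N]], [set v n | n in [set n | (N <= n)%N]]).
      by split; exists N => // n Nn; exists n.
    move=> [_ _] [/= [n Nn <-] [m Nm <-]].
    rewrite /ball /=.
    by apply: (le_lt_trans (vu _ _)); exact: HN.
  exists (lim (v @ \oo)) => e e0.
  have /cvgrPdist_lt /(_ e e0) [N _ HN] := vc.
  by exists N => n Nn; rewrite distrC; exact: HN.
have [x Hx] := real_cvg (fun n => complex.Re (u n)) ltac:(move=> n m;
  by rewrite -raddfB; exact: ler_Re_normc).
have [y Hy] := real_cvg (fun n => complex.Im (u n)) ltac:(move=> n m;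
  by rewrite -raddfB; exact: ler_Im_normc).
exists (x +i* y) => e e0.
have [N1 HN1] := Hx (e / 2) (divr_gt0 e0 (ltr0Sn _ 1)).
have [N2 HN2] := Hy (e / 2) (divr_gt0 e0 (ltr0Sn _ 1)).
exists (maxn N1 N2) => n; rewrite geq_max => /andP[/HN1 h1 /HN2 h2].
apply: (le_lt_trans (ler_normc_ReIm _)).
by rewrite !raddfB /=; lra.
Qed.

End ComplexDerivative.

(** * Inverse functions with explicit radii *)

Section LocalInverse.
Variable R : realType.
Local Notation C := R[i].
Implicit Types (f g : C -> C) (z w c d : C).

Lemma cder_inverse f g b c : c != 0 -> ccont g b -> cder f (g b) c ->
  (exists2 r : R, 0 < r & forall y, normc (y - b) < r -> f (g y) = y) ->
  cder g b c^-1.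
Proof.
move=> c0 gb fc [r r0 fg] e e0.
have Nc : 0 < normc c by rewrite normc_gt0.
(* With k the increment of [g] and h that of its argument, the first bound yields |k| <= 2 |h| /
   |c|, and the second then turns the error into e |h|. *)
pose eta := Num.min (normc c / 2) (e * normc c ^+ 2 / 2).
have eta0 : 0 < eta by rewrite lt_min !divr_gt0 // mulr_gt0 // exprn_gt0.
have [s s0 Hs] := fc _ eta0.
have [t t0 Ht] := gb _ s0.
exists (Num.min r t); first by rewrite lt_min r0.
move=> y; rewrite lt_min => /andP[yr /Ht /Hs].
have fgb : f (g b) = b by apply: fg; rewrite subrr Normc.normc0.
rewrite fg // fgb.
set k := g y - g b; set h := y - b => H.
have H1 : normc (h - c * k) <= normc c / 2 * normc k.
  apply: (le_trans H); rewrite ler_wpM2r ?normc_ge0 //.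
  by rewrite /eta ge_min lexx.
have H2 : normc (h - c * k) <= e * normc c ^+ 2 / 2 * normc k.
  apply: (le_trans H); rewrite ler_wpM2r ?normc_ge0 //.
  by rewrite /eta ge_min lexx orbT.
have K : normc c * normc k <= 2 * normc h.
  have := ler_dist_normc (c * k) h; rewrite (normcB (c * k)) Normc.normcM; lra.
have -> : k - c^-1 * h = - c^-1 * (h - c * k).
  by field.
rewrite Normc.normcM normcN Normc.normcV mulrC ler_pdivrMr //.
apply: (le_trans H2).
have Nh := normc_ge0 h; have Nk := normc_ge0 k.
have -> : e * normc c ^+ 2 / 2 * normc k = (e * normc c / 2) * (normc c * normc k) by field.
have -> : e * normc h * normc c = (e * normc c / 2) * (2 * normc h) by field.
by rewrite ler_wpM2l // !mulr_ge0 // ltW.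
Qed.

Section QuantitativeInverse.
Variables (f df : C -> C) (z0 c : C) (r : R).
Hypothesis c0 : c != 0.
Hypothesis f_near_linear : forall w, normc (w - z0) < r ->
  cder f w (df w) /\ normc (df w - c) <= normc c / 2.

Lemma near_linear_expand w0 w1 : normc (w0 - z0) < r -> normc (w1 - z0) < r ->
  normc c / 2 * normc (w1 - w0) <= normc (f w1 - f w0).
Proof.
move=> h0 h1; have := mean_value_ball f_near_linear h0 h1.
have := ler_dist_normc (c * (w1 - w0)) (f w1 - f w0).
rewrite (normcB (c * _)) Normc.normcM; lra.
Qed.

Lemma near_linear_inj w0 w1 : normc (w0 - z0) < r -> normc (w1 - z0) < r ->
  f w1 = f w0 -> w1 = w0.
Proof.
move=> h0 h1 e; have := near_linear_expand h0 h1.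
rewrite e subrr Normc.normc0 pmulr_rle0 ?divr_gt0 ?normc_gt0 // => H.
by apply/eqP; rewrite -subr_eq0 -normc_eq0 eq_le H normc_ge0.
Qed.

(** Newton's iteration with the derivative frozen at [c] contracts by 1/2. Started at [z0], its n-th
    step has length at most rho / 2^n, so it stays within 2 rho < r of [z0]. *)
Lemma near_linear_surj b : normc (b - f z0) < normc c / 2 * r ->
  exists2 w, normc (w - z0) < r & f w = b.
Proof.
move=> bf; have Nc : 0 < normc c by rewrite normc_gt0.
pose T w := w - (f w - b) / c.
pose u n := iter n T z0.
have uS n : u n.+1 = T (u n) by [].
pose rho := normc (b - f z0) / normc c.
have rho0 : 0 <= rho by rewrite divr_ge0 ?normc_ge0.
have rhor : rho < r / 2 by rewrite /rho ltr_pdivrMr //; move: bf; lra.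
have TB w0 w1 : normc (w0 - z0) < r -> normc (w1 - z0) < r ->
    normc (T w1 - T w0) <= normc (w1 - w0) / 2.
  move=> h0 h1; have := mean_value_ball f_near_linear h0 h1.
  have -> : T w1 - T w0 = - c^-1 * (f w1 - f w0 - c * (w1 - w0)).
    by rewrite /T; field.
  rewrite Normc.normcM normcN Normc.normcV => H.
  rewrite mulrC ler_pdivrMr //; lra.
pose q n : R := (2 ^+ n)^-1.
have q0 n : 0 < q n by rewrite invr_gt0 exprn_gt0.
have qS n : q n.+1 = q n / 2 by rewrite /q exprS invfM mulrC.
have un n : normc (u n.+1 - u n) <= rho * q n /\ normc (u n - z0) <= 2 * rho * (1 - q n).
  elim: n => [|n [IH1 IH2]].
    split; last by rewrite /u /= subrr Normc.normc0 /q expr0 invr1 subrr mulr0.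
    rewrite /q expr0 invr1 mulr1 /u /= /T addrAC subrr add0r normcN Normc.normcM.
    by rewrite Normc.normcV normcB.
  have IH3 : normc (u n.+1 - z0) <= 2 * rho * (1 - q n.+1).
    apply: (le_trans (ler_normc_dist _ (u n) _)); rewrite qS; have := q0 n; nra.
  have qn := q0 n; have qn1 := q0 n.+1.
  split => //; rewrite (uS n.+1) {2}(uS n).
  apply: (le_trans (TB _ _ _ _)).
  - by apply: (le_lt_trans IH2); nra.
  - by apply: (le_lt_trans IH3); nra.
  - by rewrite qS; lra.
have Cu n m : (n <= m)%N -> normc (u m - u n) <= 2 * rho * q n.
  move=> nm; rewrite -(subnK nm); move: (m - n)%N => k {nm m}.
  suff : normc (u (k + n)%N - u n) <= 2 * rho * (q n - q (k + n)%N).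
    by move/le_trans; apply; have := q0 (k + n)%N; nra.
  elim: k => [|k IH]; first by rewrite add0n !subrr Normc.normc0 mulr0.
  apply: (le_trans (ler_normc_dist _ (u (k + n)%N) _)).
  have [H _] := un (k + n)%N.
  rewrite addSn qS; have := q0 (k + n)%N; lra.
have qlim (e : R) : 0 < e -> exists N, forall n, (N <= n)%N -> 2 * rho * q n < e.
  move=> e0; pose N := Num.bound (2 * rho / e).
  exists N => n Nn.
  have h : 2 * rho / e < N%:R.
    by apply: archi_boundP; apply: divr_ge0; [rewrite mulr_ge0|exact: ltW].
  rewrite /q ltr_pdivrMr ?exprn_gt0 // -ltr_pdivrMl // mulrC.
  apply: (lt_trans h); rewrite -natrX ltr_nat.
  by apply: (leq_ltn_trans Nn); exact: ltn_expl.
have [l Hl] : exists l, forall e : R, 0 < e -> exists N, forall n, (N <= n)%N -> normc (u n - l) < e.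
  apply: cauchy_complex_cvg => e e0; have [N HN] := qlim _ e0.
  exists N => n m Nn Nm; have [nm|/ltnW mn] := leqP n m.
    by rewrite normcB; apply: le_lt_trans (HN n Nn); exact: Cu.
  by apply: le_lt_trans (HN m Nm); exact: Cu.
have lz : normc (l - z0) < r.
  have e0 : 0 < r - 2 * rho by lra.
  have [N /(_ N (leqnn _)) HN] := Hl _ e0.
  have [_ HN2] := un N.
  rewrite normcB in HN.
  apply: (le_lt_trans (ler_normc_dist _ (u N) _)).
  have := q0 N; nra.
exists l => //; apply/eqP; rewrite -subr_eq0 -normc_eq0 eq_le normc_ge0 andbT.
apply/ler_addgt0Pr => e e0; rewrite add0r.
have [fl _] := f_near_linear lz.
have e2 : 0 < e / 2 by rewrite divr_gt0.
have [s s0 Hs] := cder_cont fl e2.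
have [N1 HN1] := Hl _ s0.
have [N2 HN2] : exists N, forall n, (N <= n)%N -> 2 * rho * q n < e / normc c.
  by apply: qlim; rewrite divr_gt0.
pose n := maxn N1 N2.
have := Hs _ (HN1 n (leq_maxl _ _)).
have := HN2 n (leq_maxr _ _); rewrite ltr_pdivlMr // => H1 H2.
have [H3 _] := un n.
(* The defect at an iterate is [c] times the next Newton step, hence tends to 0. *)
have fE : f (u n) - b = - (c * (u n.+1 - u n)).
  by rewrite uS /T; field.
have : normc (f (u n) - b) <= e / 2.
  by rewrite fE normcN Normc.normcM; nra.
have := ler_normc_dist (f l) (f (u n)) b; rewrite (normcB (f l) (f (u n))); lra.
Qed.

(** The explicit radius |c| r / 2 of the image disk is what later yields branches of the inverse of
    [F] on disks of a size independent of the point. *)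
Lemma near_linear_inverse : 0 < r -> exists g : C -> C,
  [/\ forall b, normc (b - f z0) < normc c / 2 * r ->
        normc (g b - z0) < r /\ f (g b) = b,
      forall w, normc (w - z0) < r -> normc (f w - f z0) < normc c / 2 * r -> g (f w) = w &
      forall b, normc (b - f z0) < normc c / 2 * r -> cder g b (df (g b))^-1].
Proof.
move=> r0; have Nc : 0 < normc c by rewrite normc_gt0.
have [g Hg] : {g : C -> C & forall b, normc (b - f z0) < normc c / 2 * r ->
    normc (g b - z0) < r /\ f (g b) = b}.
  apply: (@choice _ _ (fun b w => normc (b - f z0) < normc c / 2 * r ->
    normc (w - z0) < r /\ f w = b)) => b.
  have [/near_linear_surj[w h1 h2]|h] := pselect (normc (b - f z0) < normc c / 2 * r).
    by exists w.
  by exists 0.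
exists g; split => // [w wr fw|b bf].
  by have [h1 h2] := Hg _ fw; exact: near_linear_inj.
pose s := normc c / 2 * r - normc (b - f z0).
have s0 : 0 < s by rewrite subr_gt0.
have bs y : normc (y - b) < s -> normc (y - f z0) < normc c / 2 * r.
  rewrite /s => h; apply: (le_lt_trans (ler_normc_dist _ b _)); lra.
have [h1 h2] := Hg _ bf.
have [h3 h4] := f_near_linear h1.
apply: (@cder_inverse f) => //; last by exists s => // y /bs /Hg [].
- apply/eqP => d0; move: h4; rewrite d0 sub0r normcN; lra.
- move=> e e0; exists (Num.min s (normc c / 2 * e)).
    by rewrite lt_min s0 mulr_gt0 // divr_gt0.
  move=> y; rewrite lt_min => /andP[/bs/Hg[k1 k2] k3].
  have := near_linear_expand h1 k1; rewrite k2 h2 => k4.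
  have := le_lt_trans k4 k3; rewrite ltr_pM2l // divr_gt0 //.
Qed.

End QuantitativeInverse.

Lemma locally_near_linear f (df : C -> C) z : (forall w, cder f w (df w)) -> ccont df z ->
  df z != 0 -> exists2 r : R, 0 < r & forall w, normc (w - z) < r ->
    cder f w (df w) /\ normc (df w - df z) <= normc (df z) / 2.
Proof.
move=> fd dc dz; have Nz : 0 < normc (df z) / 2 by rewrite divr_gt0 // normc_gt0.
have [s s0 Hs] := dc _ Nz; exists s => // w /Hs h; split => //; exact: ltW.
Qed.

Lemma locally_injective f (df : C -> C) z : (forall w, cder f w (df w)) -> ccont df z ->
  df z != 0 -> exists2 r : R, 0 < r & forall w w', normc (w - z) < r ->
    normc (w' - z) < r -> f w = f w' -> w = w'.
Proof.
move=> fd dc dz; have [r r0 H] := locally_near_linear fd dc dz.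
by exists r => // w w' h h' e; exact: near_linear_inj dz H _ _ h' h e.
Qed.

End LocalInverse.

(** Stated over any numeric field, so as to serve both for the real exp, cos and sin and for
    functions on [R[i]]. *)
Lemma is_deriveP (K : numFieldType) (f : K^o -> K^o) (x d : K^o) :
  is_derive x 1 f d <->
  forall e : K, 0 < e -> exists2 r : K, 0 < r &
    forall h : K, `|h| < r -> `|f (h + x) - f x - d * h| <= e * `|h|.
Proof.
have quotE (h : K) : h != 0 ->
    `|d - h^-1 *: ((f \o shift x) (h *: 1) - f x)| = `|f (h + x) - f x - d * h| / `|h|.
  move=> h0; rewrite distrC -normf_div; congr `| _ |.
  rewrite /= /GRing.scale /= mulr1 mulrBl mulfK // [_^-1 * _]mulrC.
  by rewrite -/(_ / _).
split=> [[fd fD] e e0|H].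
  have : h^-1 *: ((f \o shift x) (h *: 1) - f x) @[h --> 0^'] --> d.
    by rewrite -fD; exact: fd.
  move=> /cvgrPdist_le /(_ e e0); rewrite near_withinE => /nbhs_ballP[r /= r0 Hr].
  exists r => // h hr; have [->|h0] := eqVneq h 0.
    by rewrite add0r subrr mulr0 subr0 normr0 mulr0.
  have := Hr h; rewrite /ball /= sub0r normrN => /(_ hr h0).
  by rewrite quotE // ler_pdivrMr // normr_gt0.
have fd : h^-1 *: ((f \o shift x) (h *: 1) - f x) @[h --> 0^'] --> d.
  apply/cvgrPdist_le => e e0; rewrite near_withinE.
  have [r r0 Hr] := H e e0; apply/nbhs_ballP; exists r => //= h.
  rewrite /ball /= sub0r normrN => hr h0.
  by rewrite quotE // ler_pdivrMr ?normr_gt0 //; exact: Hr.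
split; first by apply/cvg_ex; exists d.
exact: cvg_lim fd.
Qed.

(* [cexp] on [R[i]] rather than on [R[i]^o], locked because unification would *)
(* otherwise unfold it to a product.                                          *)
HB.lock Definition cexpi (R : realType) (z : R[i]) : R[i] := cexp z.

(** * The complex exponential and the principal logarithm *)

Section Cexp.
Variable R : realType.
Local Notation C := R[i].
Implicit Types (z w : C).
Local Notation cexp := (@cexpi R).

Lemma cexpE z : cexp z = (expR (complex.Re z) * cos (complex.Im z)) +i*
  (expR (complex.Re z) * sin (complex.Im z)).
Proof. by rewrite cexpi.unlock /Defs.cexp; simpc. Qed.

Lemma cexp0 : cexp 0 = 1.
Proof. by rewrite cexpE /= expR0 cos0 sin0 !mul1r. Qed.

Lemma cexpD z w : cexp (z + w) = cexp z * cexp w.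
Proof.
case: z w => [a b] [c d]; rewrite !cexpE /= expRD cosD sinD; simpc.
by congr (_ +i* _); ring.
Qed.

Lemma normc_cexp z : normc (cexp z) = expR (complex.Re z).
Proof.
rewrite cexpi.unlock /Defs.cexp Normc.normcM normcZ gtr0_norm ?expR_gt0 // normcE2 /=.
by rewrite cos2Dsin2 sqrtr1 mulr1.
Qed.

Lemma cexp_neq0 z : cexp z != 0.
Proof. by rewrite -normc_gt0 normc_cexp expR_gt0. Qed.

Lemma cexpN z : cexp (- z) = (cexp z)^-1.
Proof.
have := cexpD (- z) z; rewrite addNr cexp0 => /esym H.
by apply: (mulIf (cexp_neq0 z)); rewrite H mulVf // cexp_neq0.
Qed.

Lemma cexpB z w : cexp (z - w) = cexp z / cexp w.
Proof. by rewrite cexpD cexpN. Qed.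

Lemma cexpMn z n : cexp (n%:R * z) = cexp z ^+ n.
Proof.
elim: n => [|n IH]; first by rewrite mul0r cexp0.
by rewrite -natr1 mulrDl mul1r cexpD IH exprSr.
Qed.

Lemma is_deriveR (f : R -> R) (x d : R) : is_derive x 1 f d ->
  forall e : R, 0 < e -> exists2 r : R, 0 < r &
    forall h : R, `|h| < r -> `|f (h + x) - f x - d * h| <= e * `|h|.
Proof. by move=> /is_deriveP. Qed.

Lemma cder_cexp0 : cder cexp 0 1.
Proof.
move=> e e0; have [e1 [e10 e18 e11]] : exists e1 : R, [/\ 0 < e1, e1 <= e / 16 & e1 <= 1].
  exists (Num.min (e / 16) 1); rewrite lt_min ltr01 divr_gt0 //.
  by rewrite !ge_min !lexx orbT.
have [r1 r10 H1] := is_deriveR (is_derive_expR (0 : R)) e10.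
have [r2 r20 H2] := is_deriveR (is_derive_cos (0 : R)) e10.
have [r3 r30 H3] := is_deriveR (is_derive_sin (0 : R)) e10.
exists (Num.min (Num.min r1 (Num.min r2 r3)) e1).
  by rewrite !lt_min r10 r20 r30 e10.
move=> [a b]; rewrite subr0 cexp0 mul1r => hw.
set w := a +i* b in hw *.
have wa : `|a| <= normc w := ler_Re_normc w.
have wb : `|b| <= normc w := ler_Im_normc w.
have wab := ler_normc_ReIm w.
move: hw; rewrite !lt_min => /andP[/andP[h1 /andP[h2 h3]] h4].
have {}H1 := H1 a (le_lt_trans wa h1).
have {}H2 := H2 b (le_lt_trans wb h2).
have {}H3 := H3 b (le_lt_trans wb h3).
move: H1 H2 H3; rewrite !(addr0, expR0, cos0, sin0, oppr0, mul0r, subr0, mul1r).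
have -> : cexp w - 1 - w = (expR a * cos b - 1 - a) +i* (expR a * sin b - b).
  by rewrite cexpE /w /=; simpc.
move=> H1 H2 H3; apply: (le_trans (ler_normc_ReIm _)).
rewrite -[X in `|X| + _]/(expR a * cos b - 1 - a) -[X in _ + `|X|]/(expR a * sin b - b).
have Na := normr_ge0 a; have Nb := normr_ge0 b.
have Nw := normc_ge0 w.
have ea : e1 * `|a| <= e1 * normc w by rewrite ler_pM2l.
have eb : e1 * `|b| <= e1 * normc w by rewrite ler_pM2l.
have ew : e1 * normc w <= normc w by rewrite ler_piMl.
have Ea : `|expR a - 1| <= 2 * normc w.
  have -> : expR a - 1 = (expR a - 1 - a) + a by ring.
  by apply: (le_trans (ler_normD _ _)); lra.
have C1 := cos_max b; have S1 := sin_max b.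
have K1 : `|expR a * cos b - 1 - a| <= 4 * e1 * normc w.
  have -> : expR a * cos b - 1 - a = (expR a - 1 - a) + ((cos b - 1) + (expR a - 1) * (cos b - 1)) by ring.
  apply: (le_trans (ler_normD _ _)).
  have := ler_normD (cos b - 1) ((expR a - 1) * (cos b - 1)); rewrite normrM.
  have : `|expR a - 1| * `|cos b - 1| <= (2 * normc w) * (e1 * `|b|).
    by rewrite ler_pM.
  have : (2 * normc w) * (e1 * `|b|) <= 2 * (e1 * normc w).
    rewrite -mulrA ler_pM2l // mulrCA ler_pM2l // ler_piMr ?normc_ge0 //; lra.
  nra.
have K2 : `|expR a * sin b - b| <= 5 * e1 * normc w.
  have -> : expR a * sin b - b = (sin b - b) + (expR a - 1) * sin b by ring.
  apply: (le_trans (ler_normD _ _)); rewrite normrM.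
  have Sb : `|sin b| <= 2 * normc w.
    have -> : sin b = (sin b - b) + b by ring.
    by apply: (le_trans (ler_normD _ _)); lra.
  have Hs : `|expR a - 1| * `|sin b| <= (2 * normc w) * (2 * normc w) by rewrite ler_pM.
  have : (2 * normc w) * (2 * normc w) <= 4 * (e1 * normc w).
    rewrite mulrACA -natrM ler_pM2l ?ltr0n // ler_wpM2r //; exact: ltW.
  lra.
apply: (le_trans (lerD K1 K2)).
have : e1 * normc w <= e / 16 * normc w by rewrite ler_wpM2r.
have : 0 <= e * normc w by rewrite mulr_ge0 // ltW.
lra.
Qed.

Lemma cder_cexp z : cder cexp z (cexp z).
Proof.
move=> e e0; have Nz : 0 < normc (cexp z) by rewrite normc_gt0 cexp_neq0.
have [r r0 H] := cder_cexp0 (divr_gt0 e0 Nz).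
exists r => // w; have := H (w - z); rewrite subr0 cexp0 mul1r => {}H /H {}H.
have -> : cexp w - cexp z - cexp z * (w - z) = cexp z * (cexp (w - z) - 1 - (w - z)).
  by rewrite cexpB; field; exact: cexp_neq0.
rewrite Normc.normcM mulrC.
by move: H; rewrite mulrAC ler_pdivlMr.
Qed.

Lemma polar_form z : z != 0 -> exists t : R, [/\ - pi < t, t <= pi &
  z = cexp (ln (normc z) +i* t)].
Proof.
move=> z0; have Nz : 0 < normc z by rewrite normc_gt0.
pose x := complex.Re z / normc z.
have x1 : -1 <= x <= 1.
  by rewrite -ler_norml normrM normfV (gtr0_norm Nz) ler_pdivrMr // mul1r ler_Re_normc.
have sx : Num.sqrt (1 - x ^+ 2) = `|complex.Im z| / normc z.
  have -> : 1 - x ^+ 2 = (`|complex.Im z| / normc z) ^+ 2.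
    have := normc_sqr z; rewrite /x !expr_div_n real_normK ?num_real // => H.
    have N2 : normc z ^+ 2 != 0 by rewrite expf_neq0 // gt_eqF.
    apply: (mulIf N2); rewrite mulrBl !divfK // mul1r H; ring.
  by rewrite sqrtr_sqr ger0_norm // divr_ge0 // ltW.
have zE t : cos t = x -> sin t = complex.Im z / normc z -> z = cexp (ln (normc z) +i* t).
  move=> ct st; rewrite cexpE /= lnK ?posrE // ct st /x.
  rewrite ![normc z * _]mulrC !divfK ?gt_eqF //; by case: (z).
have ac0 := acos_ge0 x1; have acp := acos_lepi x1.
have ca : cos (acos x) = x by apply: acosK; rewrite in_itv.
(* The arc cosine gives the angle in the closed upper half-plane and its opposite below; the angle
   -pi is excluded there because its sine vanishes. *)
have [y0|y0] := leP 0 (complex.Im z).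
  exists (acos x); split => //; first by have := pi_gt0 R; lra.
  by apply: zE => //; rewrite sin_acos // sx ger0_norm.
exists (- acos x); split; first last.
- by apply: zE; rewrite ?cosN // sinN sin_acos // sx ltr0_norm // mulNr opprK.
- by have := pi_gt0 R; lra.
- rewrite ltrN2 lt_neqAle acp andbT; apply/eqP => ap.
  have := sx; rewrite -sin_acos // ap sinpi => /esym/eqP.
  by rewrite mulf_eq0 invr_eq0 normr_eq0 (lt_eqF y0) (gt_eqF Nz).
Qed.

Lemma cexp_surj z : z != 0 -> exists w, cexp w = z.
Proof. by move=> /polar_form [t [_ _ e]]; exists (ln (normc z) +i* t). Qed.

Definition ctwopi_i : C := 0 +i* (pi *+ 2).

Lemma cexp_2pi : cexp ctwopi_i = 1.
Proof. by rewrite cexpE /= expR0 !mul1r cos2pi sin2pi. Qed.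

Lemma cexp_2piz (n : int) : cexp (n%:~R * ctwopi_i) = 1.
Proof.
case: n => n; first by rewrite cexpMn cexp_2pi expr1n.
by rewrite NegzE mulrNz mulNr cexpN cexpMn cexp_2pi expr1n invr1.
Qed.

(** The modulus gives Re w = 0; then cos is 1 at |Im w|, and cos is injective on [0, pi], which
    contains |Im w| or 2 pi - |Im w|. *)
Lemma cexp_strip_eq1 w : `|complex.Im w| < pi *+ 2 -> cexp w = 1 -> w = 0.
Proof.
case: w => a b /= bpi E.
have a0 : a = 0.
  have := congr1 (@normc R) E; rewrite normc_cexp Normc.normc1 /=.
  by rewrite -[in RHS](expR0 R) => /expR_inj.
move: E; rewrite cexpE a0 /= expR0 !mul1r => -[cb sb].
have cb' : cos `|b| = 1 by have [b0|b0] := ler0P b; rewrite ?cosN.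
have p0 := pi_gt0 R.
have acos1 (t : R) : 0 <= t -> t <= pi -> cos t = 1 -> t = 0 :> R.
  move=> t0 tp ct; have := @cosK R t; rewrite in_itv /= t0 tp ct => /(_ isT) <-.
  exact: trigo.acos1.
have [bp|bp] := leP `|b| pi.
  by have /eqP := acos1 _ (normr_ge0 b) bp cb'; rewrite normr_eq0 => /eqP ->.
have : (pi : R) *+ 2 - `|b| = 0.
  apply: acos1; rewrite ?subr_ge0 ?(ltW bpi) //.
    by move: bp bpi; rewrite mulr2n; lra.
  by rewrite cosB cb' cos2pi sin2pi; rewrite mul1r mul0r addr0.
by move=> H; exfalso; move: bpi H; lra.
Qed.

Lemma int_reduce (y p : R) : 0 < p -> exists n : int, 0 <= y - n%:~R * p < p.
Proof.
move=> p0; exists (Num.floor (y / p)).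
have /andP[h1 h2] := floor_itv (y / p).
move: h1 h2; rewrite ler_pdivlMr // ltr_pdivrMr // intrD mulrDl mul1r; lra.
Qed.

Lemma cexp_eq1 w : cexp w = 1 -> exists n : int, w = n%:~R * ctwopi_i.
Proof.
move=> E.
have p0 : 0 < (pi : R) *+ 2 by rewrite pmulrn_lgt0 // pi_gt0.
have [n /andP[n1 n2]] := int_reduce (complex.Im w) p0.
exists n; apply/eqP; rewrite -subr_eq0; apply/eqP; apply: cexp_strip_eq1.
  have -> : complex.Im (w - n%:~R * ctwopi_i) = complex.Im w - n%:~R * (pi *+ 2).
    rewrite raddfB /=; congr (_ - _).
    have -> : (n%:~R : C) = (n%:~R : R)%:C by rewrite rmorph_int.
    by rewrite /ctwopi_i; simpc.
  by rewrite ger0_norm.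
by rewrite cexpB cexp_2piz divr1.
Qed.

Lemma cexp_eq w z : cexp w = cexp z -> exists n : int, w = z + n%:~R * ctwopi_i.
Proof.
move=> E; have [n H] : exists n : int, w - z = n%:~R * ctwopi_i.
  by apply: cexp_eq1; rewrite cexpB E divff // cexp_neq0.
by exists n; rewrite -H addrCA subrr addr0.
Qed.

Lemma cexp_periodic z (n : int) : cexp (z + n%:~R * ctwopi_i) = cexp z.
Proof. by rewrite cexpD cexp_2piz mulr1. Qed.

Lemma cexp_inj_strip w z : `|complex.Im w| < pi -> `|complex.Im z| < pi ->
  cexp w = cexp z -> w = z.
Proof.
move=> hw hz E; apply/eqP; rewrite -subr_eq0; apply/eqP; apply: cexp_strip_eq1.
  rewrite raddfB /=; apply: (le_lt_trans (ler_normB _ _)); rewrite mulr2n; lra.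
by rewrite cexpB E divff // cexp_neq0.
Qed.

(* The principal branch; junk on the negative real axis. *)
Definition Log z : C := xget 0 [set w | `|complex.Im w| < pi /\ cexp w = z].

Definition slit z : Prop := 0 < complex.Re z \/ complex.Im z != 0.

Lemma LogP z : slit z -> `|complex.Im (Log z)| < pi /\ cexp (Log z) = z.
Proof.
move=> sz; rewrite /Log; case: xgetP => [w -> []//|].
have z0 : z != 0.
  by apply/eqP => z0; move: sz; rewrite z0 => -[/=|/=/eqP//]; rewrite ltxx.
have [t [t1 t2 e]] := polar_form z0.
move=> /(_ (ln (normc z) +i* t)); case; split => //=.
rewrite ltr_norml t1 lt_neqAle t2 andbT; apply/eqP => tp.
have Nz : 0 < normc z by rewrite normc_gt0.
move: sz; rewrite e tp cexpE /= lnK ?posrE // cospi sinpi mulr0 mulrN1.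
by case => [/=|/=/eqP//]; lra.
Qed.

Lemma LogK w : `|complex.Im w| < pi -> Log (cexp w) = w.
Proof.
move=> hw; rewrite /Log; case: xgetP => [u -> [h1 h2]|/(_ w) []//].
exact: cexp_inj_strip.
Qed.

Lemma Log1 : Log 1 = 0.
Proof. by rewrite -cexp0 LogK //= normr0 pi_gt0. Qed.

Lemma Re_Log z : slit z -> complex.Re (Log z) = ln (normc z).
Proof. by move=> /LogP [_ {2}<-]; rewrite normc_cexp expRK. Qed.

Lemma cder_Log z : slit z -> cder Log z z^-1.
Proof.
move=> sz; have [s1 s2] := LogP sz.
set u := Log z in s1 s2 *.
pose c := cexp u.
have c0 : c != 0 := cexp_neq0 u.
have Nc : 0 < normc c / 2 by rewrite divr_gt0 // normc_gt0.
have [r1 r10 H1] := cder_cont (cder_cexp u) Nc.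
(* The disk about [u] stays in the strip |Im| < pi, where [LogK] identifies the local inverse of the
   exponential with [Log]. *)
pose r := Num.min r1 (pi - `|complex.Im u|).
have r0 : 0 < r by rewrite lt_min r10 subr_gt0.
have nl w : normc (w - u) < r -> cder cexp w (cexp w) /\ normc (cexp w - c) <= normc c / 2.
  rewrite lt_min => /andP[wr _]; split; first exact: cder_cexp.
  by apply: ltW; exact: H1.
have [g [G1 G2 G3]] := near_linear_inverse c0 nl r0.
have zu : normc (z - cexp u) < normc c / 2 * r by rewrite s2 subrr Normc.normc0 mulr_gt0.
have gz : g z = u.
  rewrite -{1}s2; apply: G2; rewrite subrr Normc.normc0 //; exact: mulr_gt0.
have := G3 _ zu; rewrite gz s2; apply: cder_eq.
exists (normc c / 2 * r); first by rewrite mulr_gt0.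
move=> w; rewrite -s2 => /G1 [g1 gw]; rewrite -[in RHS]gw LogK //.
move: g1; rewrite lt_min => /andP[_ g1].
have := ler_Im_normc (g w - u); rewrite raddfB /= => g2.
have := ler_normD (complex.Im (g w) - complex.Im u) (complex.Im u); rewrite subrK.
lra.
Qed.

Lemma slit_near1 z : normc (z - 1) < 1 -> slit z.
Proof.
move=> h; left; have := ler_Re_normc (z - 1); rewrite raddfB /= => h2.
have : - normc (z - 1) <= complex.Re z - 1 by move: h2; rewrite ler_norml => /andP[].
lra.
Qed.

Lemma Log_near1 z : normc (z - 1) <= 1 / 2 -> normc (Log z) <= 2 * normc (z - 1).
Proof.
move=> h.
have := @mean_value_segment R Log (fun w => w^-1) 1 z 0 2 _.
rewrite Log1 subr0 mul0r subr0; apply=> t /andP[t0 t1] /=.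
set w := 1 + _.
have hw : normc (w - 1) <= 1 / 2.
  rewrite /w addrAC subrr add0r Normc.normcM normcZ ger0_norm //.
  have := normc_ge0 (z - 1); nra.
have sw : slit w by apply: slit_near1; lra.
split; first exact: cder_Log.
have hw2 : 1 / 2 <= normc w.
  by have := ler_dist_normc 1 (1 - w); rewrite Normc.normc1 opprB addrCA subrr addr0 normcB; lra.
rewrite subr0 Normc.normcV -[X in _ <= X]invrK lef_pV2 ?posrE ?invr_gt0 //; lra.
Qed.

Lemma normc_cexp_sub1 z : normc z <= 1 / 2 -> normc (cexp z - 1) <= 2 * normc z.
Proof.
move=> h; have := @mean_value_segment R cexp cexp 0 z 0 2 _.
rewrite cexp0 subr0 mul0r subr0; apply=> t /andP[t0 t1] /=.
rewrite add0r !subr0; split; first exact: cder_cexp.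
rewrite normc_cexp.
have hw : normc (t%:C * z) <= 1 / 2.
  rewrite Normc.normcM normcZ ger0_norm //; have := normc_ge0 z; nra.
have := ler_Re_normc (t%:C * z); set x := complex.Re _ => hx.
have hx2 : x <= 1 / 2 by apply: le_trans hw; apply: le_trans hx; exact: ler_norm.
apply: (@le_trans _ _ (expR (1 / 2))); first by rewrite ler_expR.
have := expR_ge1Dx (- (1 / 2) : R); rewrite expRN.
have := expR_gt0 (1 / 2 : R); set E := expR _ => E0 hE.
have : (1 + - (1 / 2)) * E <= E^-1 * E by rewrite ler_wpM2r // ltW.
rewrite mulVf ?gt_eqF //; lra.
Qed.

End Cexp.

(** * Logarithmic charts *)

Section LogarithmicEnd.
Variable R : realType.
Local Notation C := R[i].
Local Notation cexp := (@cexpi R).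
Variables (D : R -> C -> Prop) (rho : C -> R) (f df k dk : C -> C) (K0 : R).

(** The sets [D K] shrink to infinity as K grows: half-planes for a point of the plane, sectors
    outside disks for an end. [f] is [F] in the coordinate w, and [rho w] is the scale on which k +
    w is negligible. *)
Definition eventually_in (P : C -> Prop) := exists K, forall w, D K w -> P w.

Hypothesis D_anti : forall K K' w, K <= K' -> D K' w -> D K w.
Hypothesis D_shift : forall K, exists K', forall w (t : R), D K' w -> 0 <= t -> D K (w + t%:C).
Hypothesis D_ball : forall K, exists M, forall s w,
  complex.Re s < - M -> normc (w + s) <= rho (- s) -> D K w.
Hypothesis rho_ge1 : forall w, 1 <= rho w.
Hypothesis rho_slow : forall w w', normc (w - w') <= rho w / 2 -> rho w <= 2 * rho w'.
Hypothesis f_der : forall w, D K0 w -> cder f w (df w).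
Hypothesis k_der : forall w, D K0 w -> cder k w (dk w).
Hypothesis asym_dk : forall e, 0 < e -> eventually_in (fun w => normc (dk w + 1) <= e).
Hypothesis asym_df : forall e, 0 < e ->
  eventually_in (fun w => normc (df w + cexp (k w)) <= e * normc (cexp (k w))).
Hypothesis asym_k : forall e, 0 < e -> eventually_in (fun w => normc (k w + w) <= e * rho w).

Lemma ev_and (P Q : C -> Prop) : eventually_in P -> eventually_in Q ->
  eventually_in (fun w => P w /\ Q w).
Proof.
move=> [K HK] [K' HK']; exists (Num.max K K') => w Dw.
by split; [apply: HK|apply: HK']; apply: D_anti Dw; rewrite le_max lexx ?orbT.
Qed.

Lemma ev_mono (P Q : C -> Prop) : (forall w, P w -> Q w) -> eventually_in P -> eventually_in Q.
Proof. by move=> PQ [K HK]; exists K => w /HK /PQ. Qed.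

Lemma ev_shift (P : C -> Prop) : eventually_in P ->
  eventually_in (fun w => forall t : R, 0 <= t -> P (w + t%:C)).
Proof.
move=> [K HK]; have [K' HK'] := D_shift K.
by exists K' => w Dw t t0; apply: HK; exact: HK'.
Qed.

Lemma ev_right (P : C -> Prop) : eventually_in P ->
  exists M, forall w, M < complex.Re w -> P w.
Proof.
move=> [K HK]; have [M HM] := D_ball K; exists M => w Mw; apply: HK.
apply: (HM (- w)); first by rewrite raddfN ltrN2.
by rewrite subrr Normc.normc0; apply: le_trans (rho_ge1 _).
Qed.

Lemma ev_f_der : eventually_in (fun w => cder f w (df w)).
Proof. by exists K0. Qed.

Lemma ev_k_der : eventually_in (fun w => cder k w (dk w)).
Proof. by exists K0. Qed.

Local Notation absexp w := (expR (complex.Re (k w))).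

(** Since k' is within 1/2 of -1, a move to the right by t lowers Re k by at least t / 2. *)
Lemma ev_decay : eventually_in (fun w => forall t : R, 0 <= t ->
  complex.Re (k (w + t%:C)) <= complex.Re (k w) - t / 2).
Proof.
have h2 : 0 < 1 / 2 :> R by rewrite divr_gt0.
have := ev_shift (ev_and ev_k_der (asym_dk h2)).
apply: ev_mono => w H t t0.
have := @mean_value_segment R k dk w (w + t%:C) (-1) (1 / 2) _.
rewrite (_ : w + t%:C - w = t%:C); last by ring.
rewrite normcZ ger0_norm // mulN1r => M.
have {}M : normc (k (w + t%:C) - k w - - t%:C) <= 1 / 2 * t.
  apply: M => u /andP[u0 u1] /=; rewrite -rmorphM /= opprK; apply: H.
  exact: mulr_ge0.
rewrite opprK in M; have := le_trans (ler_Re_normc _) M; rewrite ler_norml => /andP[_].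
by rewrite !raddfD /= raddfN /=; lra.
Qed.

Let H w := f w - cexp (k w).
Let dH w := df w - cexp (k w) * dk w.

(** In df - e^k dk the leading terms -e^k and e^k cancel. *)
Lemma ev_H_small e : 0 < e -> eventually_in (fun w =>
  cder H w (dH w) /\ normc (dH w) <= e * absexp w).
Proof.
move=> e0; have e2 : 0 < e / 2 by rewrite divr_gt0.
have := ev_and (ev_and ev_f_der ev_k_der) (ev_and (asym_dk e2) (asym_df e2)).
apply: ev_mono => w [[fd kd] [hk hf]]; split.
  have := cderD fd (cderZ (-1) (cder_comp kd (cder_cexp (k w)))).
  rewrite mulN1r; apply: cder_eq; exists 1 => // y _.
  by rewrite mulN1r.
have -> : dH w = (df w + cexp (k w)) - cexp (k w) * (dk w + 1) by rewrite /dH; ring.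
apply: (le_trans (ler_normcBD _ _)); rewrite normc_cexp in hf; rewrite Normc.normcM normc_cexp.
have := expR_gt0 (complex.Re (k w)); nra.
Qed.

Let q : R := expR (- (1 / 2)).

Lemma decay_ratio_gt0 : 0 < q. Proof. exact: expR_gt0. Qed.

Lemma decay_ratio_le : q <= 2 / 3.
Proof.
have := expR_ge1Dx (1 / 2 : R); rewrite /q expRN => h.
rewrite -[2 / 3]invrK lef_pV2 ?posrE ?expR_gt0 ?invr_gt0 //; lra.
Qed.

Lemma decay_ratio_exp n : expR (- (n%:R / 2)) = q ^+ n.
Proof. by rewrite /q -expRM_natl; congr expR; field. Qed.

Lemma absexp_decay w : (forall t : R, 0 <= t ->
    complex.Re (k (w + t%:C)) <= complex.Re (k w) - t / 2) ->
  forall n, absexp (w + n%:R) <= absexp w * q ^+ n.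
Proof.
move=> h n; rewrite -decay_ratio_exp -expRD ler_expR.
by have := h n%:R (ler0n _ _); rewrite rmorph_nat.
Qed.

(** The n-th unit step to the right changes [H] by at most e |e^k| q^n, and the geometric series
    sums to at most 3 because q <= 2/3. *)
Lemma ev_H_cauchy e : 0 < e -> eventually_in (fun w =>
  forall n, normc (H (w + n%:R) - H w) <= 3 * e * absexp w).
Proof.
move=> e0.
have := ev_and ev_decay (ev_shift (ev_and ev_decay (ev_H_small e0))).
apply: ev_mono => w [dec Hs] n.
have E0 := expR_gt0 (complex.Re (k w)).
suff : normc (H (w + n%:R) - H w) <= 3 * e * absexp w * (1 - q ^+ n).
  move/le_trans; apply; have := exprn_ge0 n (ltW decay_ratio_gt0).
  have : 0 <= 3 * e * absexp w by rewrite !mulr_ge0 // ltW.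
  nra.
elim: n => [|n IH]; first by rewrite expr0 subrr mulr0 addr0 subrr Normc.normc0.
apply: (le_trans (ler_normc_dist _ (H (w + n%:R)) _)).
have step : normc (H (w + n.+1%:R) - H (w + n%:R)) <= e * (absexp w * q ^+ n).
  have := @mean_value_segment R H dH (w + n%:R) (w + n.+1%:R) 0 (e * (absexp w * q ^+ n)) _.
  have -> : w + n.+1%:R - (w + n%:R) = 1 by rewrite -natr1; ring.
  rewrite mul0r subr0 Normc.normc1 mulr1; apply => t /andP[t0 t1] /=.
  rewrite mulr1 subr0.
  have wE : w + n%:R + t%:C = w + (n%:R + t)%:C by rewrite rmorphD rmorph_nat addrA.
  have nt0 : 0 <= n%:R + t by rewrite addr_ge0.
  rewrite wE; have [_ [h1 h2]] := Hs _ nt0; split => //.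
  apply: (le_trans h2); rewrite ler_pM2l // -decay_ratio_exp -expRD ler_expR.
  apply: (le_trans (dec _ nt0)); lra.
have qn : 0 < q ^+ n by rewrite exprn_gt0 // decay_ratio_gt0.
rewrite exprS.
have q3 := decay_ratio_le.
have X0 : 0 < e * absexp w * q ^+ n by rewrite !mulr_gt0.
have : e * (absexp w * q ^+ n) <= 3 * e * absexp w * (q ^+ n - q * q ^+ n).
  have -> : 3 * e * absexp w * (q ^+ n - q * q ^+ n) = (e * absexp w * q ^+ n) * (3 - 3 * q) by ring.
  by rewrite mulrA ler_pMr //; lra.
lra.
Qed.

Lemma geometric_small (r e : R) : 0 <= r -> 0 < e -> exists N, forall n, (N <= n)%N -> r * q ^+ n < e.
Proof.
move=> r0 e0.
have q0 := decay_ratio_gt0; have q3 := decay_ratio_le.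
have : (fun n => r * q ^+ n) @ \oo --> (0 : R).
  by apply: cvg_geometric; rewrite ger0_norm; [lra|exact: ltW].
move=> /cvgrPdist_lt /(_ e e0) [N _ HN]; exists N => n Nn.
have := HN n Nn; rewrite sub0r normrN ger0_norm // mulr_ge0 // exprn_ge0 // ltW //.
Qed.

(** Along w + n the limit exists because [H] is nearly constant and e^k tends to 0. It is the same
    for all w, since [f] changes by a geometrically small amount between w + n and w0 + n. *)
Lemma ev_f_cvg : exists a, eventually_in (fun w => forall e, 0 < e ->
  exists N, forall n, (N <= n)%N -> normc (f (w + n%:R) - a) < e).
Proof.
have absN w : normc (cexp (k w)) = absexp w by rewrite normc_cexp.
have cau : eventually_in (fun w => exists l, forall e, 0 < e ->
    exists N, forall n, (N <= n)%N -> normc (f (w + n%:R) - l) < e).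
  have := ev_and ev_decay (ev_shift (ev_H_cauchy (ltr01 : 0 < 1 :> R))).
  apply: ev_mono => w [dec hc]; apply: cauchy_complex_cvg => e e0.
  have Ew := absexp_decay dec.
  have E0 := expR_gt0 (complex.Re (k w)).
  have E10 : 0 <= 10 * absexp w by rewrite mulr_ge0 // ltW.
  have [N HN] := geometric_small E10 e0.
  have q0 := decay_ratio_gt0; have q1 : q <= 1 by have := decay_ratio_le; lra.
  have key n : (N <= n)%N -> normc (f (w + n%:R) - f (w + N%:R)) <= 5 * (absexp w * q ^+ N).
    move=> Nn; have h := hc N%:R (ler0n _ _) (n - N)%N.
    have wE : w + N%:R + (n - N)%:R = w + n%:R by rewrite -addrA -natrD subnKC.
    rewrite rmorph_nat wE in h.
    have -> : f (w + n%:R) - f (w + N%:R) = (H (w + n%:R) - H (w + N%:R)) +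
        (cexp (k (w + n%:R)) - cexp (k (w + N%:R))) by rewrite /H; ring.
    apply: (le_trans (ler_normcD _ _)).
    have := ler_normcBD (cexp (k (w + n%:R))) (cexp (k (w + N%:R))).
    rewrite !absN.
    have : absexp w * q ^+ n <= absexp w * q ^+ N.
      rewrite ler_pM2l //; apply: ler_wiXn2l => //; exact: ltW.
    have := Ew N; have := Ew n; lra.
  exists N => n m Nn Nm.
  apply: (le_lt_trans (ler_normc_dist _ (f (w + N%:R)) _)).
  have := key n Nn; have := key m Nm; rewrite (normcB (f (w + N%:R))).
  have := HN N (leqnn _); lra.
have [M0 HM0] := ev_right cau.
have [a Ha] := HM0 (M0 + 1)%:C ltac:(by rewrite /=; lra).
exists a.
have h1 : 0 < 1 :> R by [].
have [M HM] := ev_right (ev_and (ev_and ev_f_der ev_k_der) (ev_and (asym_dk h1) (asym_df h1))).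
have [M' HM'] := ev_right ev_decay.
have := ev_and cau ev_decay; apply: ev_mono => w [[l Hl] dec].
suff -> : a = l by [].
apply/eqP; rewrite -subr_eq0 -normc_eq0 eq_le normc_ge0 andbT.
apply/ler_addgt0Pr => e e0; rewrite add0r.
have e3 : 0 < e / 3 by rewrite divr_gt0.
have [N1 HN1] := Ha _ e3; have [N2 HN2] := Hl _ e3.
set w0 := (M0 + 1)%:C in Ha HN1.
pose delta := normc (w0 - w).
have B0 : 0 <= 2 * expR (2 * delta) * absexp w * delta.
  by rewrite !mulr_ge0 ?normc_ge0 ?ltW ?expR_gt0.
have [N3 HN3] := geometric_small B0 e3.
(* Beyond this index the whole segment from w + n to w0 + n lies where the asymptotics hold. *)
have [N4 HN4] : exists N : nat, M + delta + `|complex.Re w| < N%:R.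
  exact: exists_nat_gt.
pose n := maxn (maxn N1 N2) (maxn N3 N4).
have n1 : (N1 <= n)%N by rewrite !leq_max leqnn.
have n2 : (N2 <= n)%N by rewrite !leq_max leqnn !orbT.
have n3 : (N3 <= n)%N by rewrite !leq_max leqnn !orbT.
have n4 : (N4 <= n)%N by rewrite !leq_max leqnn !orbT.
have {}HN1 := HN1 _ n1; have {}HN2 := HN2 _ n2; have {}HN3 := HN3 _ n3.
have nR : (N4%:R : R) <= n%:R by rewrite ler_nat.
have seg (t : R) : 0 <= t -> t <= 1 -> M < complex.Re (w + n%:R + t%:C * (w0 - w)).
  move=> t0 t1.
  have : normc (t%:C * (w0 - w)) <= delta.
    rewrite Normc.normcM normcZ ger0_norm // -/delta; have := normc_ge0 (w0 - w).
    rewrite -/delta; nra.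
  move=> /(le_trans (ler_Re_normc _)); rewrite ler_norml => /andP[h _].
  have hw := ler_norm (- complex.Re w); rewrite normrN in hw.
  have hn : complex.Re (n%:R : C) = n%:R by rewrite -(rmorph_nat (real_complex R)).
  rewrite !raddfD /= hn; lra.
(* |k'| <= 2 along the segment, so |e^k| varies there by a factor at most e^(2 delta). *)
have step (t : R) : 0 <= t -> t <= 1 ->
    absexp (w + n%:R + t%:C * (w0 - w)) <= expR (2 * delta) * absexp (w + n%:R).
  move=> t0 t1.
  have := @mean_value_segment R k dk (w + n%:R) (w + n%:R + t%:C * (w0 - w)) 0 2 _.
  rewrite (_ : _ + _ * _ - (w + n%:R) = t%:C * (w0 - w)); last by ring.
  rewrite mul0r subr0 => MV.
  have {}MV : normc (k (w + n%:R + t%:C * (w0 - w)) - k (w + n%:R)) <= 2 * normc (t%:C * (w0 - w)).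
    apply: MV => u /andP[u0 u1] /=.
    rewrite mulrA -rmorphM subr0.
    have ut0 : 0 <= u * t by rewrite mulr_ge0.
    have ut1 : u * t <= 1 by rewrite mulr_ile1.
    have [[_ kd] [hk _]] := HM _ (seg _ ut0 ut1).
    split => //.
    have := ler_normcBD (dk (w + n%:R + (u * t)%:C * (w0 - w)) + 1) 1.
    rewrite addrK Normc.normc1; lra.
  rewrite -expRD ler_expR.
  have := le_trans (ler_Re_normc _) MV; rewrite raddfB /= ler_norml => /andP[_ h].
  have : normc (t%:C * (w0 - w)) <= delta.
    rewrite Normc.normcM normcZ ger0_norm // -/delta; have := normc_ge0 (w0 - w).
    rewrite -/delta; nra.
  lra.
have : normc (f (w0 + n%:R) - f (w + n%:R)) <= 2 * expR (2 * delta) * absexp (w + n%:R) * delta.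
  have := @mean_value_segment R f df (w + n%:R) (w0 + n%:R) 0 (2 * expR (2 * delta) * absexp (w + n%:R)) _.
  rewrite (_ : w0 + n%:R - (w + n%:R) = w0 - w); last by ring.
  rewrite mul0r subr0; apply => t /andP[t0 t1] /=.
  rewrite subr0.
  have [[fd _] [_ hf]] := HM _ (seg _ t0 t1).
  split => //.
  have := ler_normcBD (df (w + n%:R + t%:C * (w0 - w)) + cexp (k (w + n%:R + t%:C * (w0 - w))))
    (cexp (k (w + n%:R + t%:C * (w0 - w)))).
  rewrite absN in hf; rewrite addrK absN.
  have := step t t0 t1; lra.
have := absexp_decay dec n.
have d0 : 0 <= delta by exact: normc_ge0.
have : 0 <= 2 * expR (2 * delta) * delta by rewrite !mulr_ge0 // expR_ge0.
move=> X0 /(ler_wpM2l X0) h1' h2'.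
have := ler_normc_dist a (f (w0 + n%:R)) l.
have := ler_normc_dist (f (w0 + n%:R)) (f (w + n%:R)) l.
rewrite (normcB a (f (w0 + n%:R))); lra.
Qed.

(** Let n tend to infinity in [ev_H_cauchy]: [H (w + n)] tends to a because e^k dies out. *)
Lemma asymptotic_value : exists a, forall e, 0 < e -> eventually_in (fun w =>
  normc (f w - a - cexp (k w)) <= e * normc (cexp (k w))).
Proof.
have [a Ha] := ev_f_cvg; exists a => e e0.
have e3 : 0 < e / 3 by rewrite divr_gt0.
have := ev_and Ha (ev_and ev_decay (ev_H_cauchy e3)).
apply: ev_mono => w [{}Ha [dec hc]].
rewrite (_ : f w - a - cexp (k w) = H w - a); last by rewrite /H; ring.
rewrite normc_cexp; apply/ler_addgt0Pr => d d0.
have d2 : 0 < d / 2 by rewrite divr_gt0.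
have [N1 HN1] := Ha _ d2.
have [N2 HN2] := geometric_small (expR_ge0 (complex.Re (k w))) d2.
pose n := maxn N1 N2.
have h1 := HN1 n (leq_maxl _ _); have h2 := HN2 n (leq_maxr _ _).
have h3 := absexp_decay dec n; have h4 := hc n.
have -> : H w - a = - (H (w + n%:R) - H w) + ((f (w + n%:R) - a) - cexp (k (w + n%:R))).
  by rewrite /H; ring.
apply: (le_trans (ler_normcD _ _)); rewrite normcN.
have := ler_normcBD (f (w + n%:R) - a) (cexp (k (w + n%:R))).
rewrite normc_cexp; lra.
Qed.

Section LogarithmicCoordinate.
Variable a : C.
Hypothesis Ha : forall e, 0 < e -> eventually_in (fun w =>
  normc (f w - a - cexp (k w)) <= e * normc (cexp (k w))).

Let E w := (f w - a) / cexp (k w).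
(** An exact logarithm of f - a: [E] tends to 1, so its principal logarithm is a small correction of
    k. *)
Definition end_log w := k w + Log (E w).
Let dL w := dk w + (E w)^-1 * ((df w) / cexp (k w) - E w * dk w).

(** Carries periods of the coordinate over to the logarithm: a translation that preserves f and e^k
    shifts [end_log] exactly as it shifts k. *)
Lemma end_log_shift w w' : f w = f w' -> cexp (k w) = cexp (k w') ->
  end_log w - k w = end_log w' - k w'.
Proof. by move=> h1 h2; rewrite /end_log /E h1 h2; ring. Qed.

Lemma ev_E_near1 e : 0 < e -> eventually_in (fun w => normc (E w - 1) <= e).
Proof.
move=> e0; apply: ev_mono (Ha e0) => w.
have ck := cexp_neq0 (k w); have Nk : 0 < normc (cexp (k w)) by rewrite normc_gt0.
have -> : E w - 1 = (f w - a - cexp (k w)) / cexp (k w) by rewrite /E; field.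
by rewrite Normc.normcM Normc.normcV ler_pdivrMr.
Qed.

Lemma ev_end_log e : 0 < e -> eventually_in (fun w =>
  [/\ cexp (end_log w) = f w - a, cder end_log w (dL w),
      normc (dL w + 1) <= e & normc (end_log w + w) <= e * rho w]).
Proof.
move=> e0.
pose d := Num.min (e / 4) (1 / 4).
have [d0 d1 d2] : [/\ 0 < d, d <= e / 4 & d <= 1 / 4].
  by rewrite /d lt_min !ge_min !lexx orbT !divr_gt0.
move: d d0 d1 d2 => d d0 d1 d2.
have := ev_and (ev_and (ev_and ev_f_der ev_k_der) (ev_and (asym_dk d0) (asym_df d0)))
  (ev_and (asym_k d0) (ev_E_near1 d0)).
apply: ev_mono => w [[[fd kd] [hdk hdf]] [hk hE]].
have ck := cexp_neq0 (k w); have Nk : 0 < normc (cexp (k w)) by rewrite normc_gt0.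
have sE : slit (E w) by apply: slit_near1; lra.
have [_ LE] := LogP sE.
have E0 : E w != 0 by rewrite -LE cexp_neq0.
have hEk : E w * cexp (k w) = f w - a by rewrite /E divfK.
have NE : 1 / 2 <= normc (E w).
  have := ler_dist_normc 1 (1 - E w).
  by rewrite Normc.normc1 (_ : 1 - (1 - E w) = E w) ?(normcB 1); [lra|ring].
split.
- by rewrite cexpD LE mulrC.
- have Ed : cder E w (df w / cexp (k w) - E w * dk w).
    have nk := cder_comp (cderZ (-1) kd) (cder_cexp (-1 * k w)).
    have := cderM (cderD fd (cder_cst (- a) w)) nk.
    rewrite addr0 !mulN1r cexpN => Ed.
    have -> : df w / cexp (k w) - E w * dk w =
      df w / cexp (k w) + (f w - a) * ((cexp (k w))^-1 * - dk w).
      by rewrite /E; field.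
    by apply: cder_eq Ed; exists 1 => // y _; rewrite mulN1r cexpN.
  exact: cderD kd (cder_comp Ed (cder_Log sE)).
- have -> : dL w + 1 = (E w)^-1 * ((df w + cexp (k w)) / cexp (k w) + (E w - 1)).
    by rewrite /dL; field; rewrite ck.
  rewrite Normc.normcM Normc.normcV mulrC ler_pdivrMr; last lra.
  apply: (le_trans (ler_normcD _ _)); rewrite Normc.normcM Normc.normcV.
  have : normc (df w + cexp (k w)) / normc (cexp (k w)) <= d by rewrite ler_pdivrMr.
  have : e / 2 <= e * normc (E w) by rewrite ler_pM2l //; lra.
  lra.
- have -> : end_log w + w = (k w + w) + Log (E w) by rewrite /end_log; ring.
  apply: (le_trans (ler_normcD _ _)).
  have := @Log_near1 R (E w) ltac:(lra).
  have := rho_ge1 w; nra.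
Qed.

End LogarithmicCoordinate.

(** L' is within 1/8 of -1 and L w + w is bounded by rho w / 8. Hence L takes the value s in the
    disk of radius rho(-s) about -s, and every solution of L w = s lies within rho(-s) / 4 of -s,
    where L is injective; psi s is this solution. *)
Theorem logarithmic_end : exists (a : C) (L psi : C -> C) (K1 s0 : R),
  [/\ forall s, complex.Re s < s0 -> [/\ D K1 (psi s), L (psi s) = s & ccont psi s],
      forall w, D K1 w -> cexp (L w) = f w - a,
      forall w, D K1 w -> complex.Re (L w) < s0 -> psi (L w) = w,
      forall K, exists M, forall s, complex.Re s < s0 -> complex.Re s < M -> D K (psi s) &
      (forall w w', f w = f w' -> cexp (k w) = cexp (k w') -> L w - k w = L w' - k w') /\
      eventually_in (fun w => normc (f w - a - cexp (k w)) <= 1 / 2 * normc (cexp (k w)))].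
Proof.
have [a Ha] := asymptotic_value.
have h8 : 0 < 1 / 8 :> R by rewrite divr_gt0.
pose L := end_log a.
have [K1 HK1] := ev_end_log Ha h8; rewrite -/L in HK1.
have [M1 HM1] := D_ball K1.
pose s0 := - M1.
have inball s w : complex.Re s < s0 -> normc (w - (- s)) < rho (- s) -> D K1 w.
  by move=> hs; rewrite opprK => hw; apply: (HM1 s) => //; exact: ltW.
have c0 : (-1 : C) != 0 by rewrite oppr_eq0 oner_eq0.
have lin s : complex.Re s < s0 -> exists dL : C -> C, forall w, normc (w - (- s)) < rho (- s) ->
    cder L w (dL w) /\ normc (dL w - (-1)) <= normc (-1 : C) / 2.
  move=> hs; exists (fun w => dk w + ((f w - a) / cexp (k w))^-1 * ((df w) / cexp (k w) - (f w - a) / cexp (k w) * dk w)) => w hw.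
  have [_ h1 h2 _] := HK1 _ (inball _ _ hs hw).
  by split => //; rewrite opprK normcN Normc.normc1; lra.
have start s : complex.Re s < s0 -> normc (s - L (- s)) < normc (-1 : C) / 2 * rho (- s).
  move=> hs; have r1 := rho_ge1 (- s).
  have D1 : D K1 (- s) by apply: (inball s) => //; rewrite subrr Normc.normc0; lra.
  have [_ _ _ h] := HK1 _ D1.
  rewrite normcB normcN Normc.normc1; lra.
have psiP s : exists w, complex.Re s < s0 -> normc (w - (- s)) < rho (- s) /\ L w = s.
  have [hs|hs] := pselect (complex.Re s < s0); last by exists 0.
  have [dL HdL] := lin s hs.
  have [w h1 h2] := near_linear_surj c0 HdL (start s hs).
  by exists w.
have [psi Hpsi] := choice psiP.
have Lw w : D K1 w -> normc (w - (- L w)) <= 1 / 8 * rho w.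
  by move=> /HK1 [_ _ _]; rewrite opprK addrC.
have Luniq w : D K1 w -> complex.Re (L w) < s0 -> psi (L w) = w.
  move=> Dw hw; have [h1 h2] := Hpsi _ hw.
  have h3 := Lw _ Dw.
  have r1 := rho_ge1 w.
  have h4 : rho w <= 2 * rho (- L w) by apply: rho_slow; lra.
  have [dL HdL] := lin _ hw.
  by apply: (near_linear_inj c0 HdL) => //; lra.
exists a, L, psi, K1, s0; split => //.
- move=> s hs; have [h1 h2] := Hpsi _ hs; split => //; first exact: inball h1.
  have [dL HdL] := lin _ hs.
  have r0 : 0 < rho (- s) by have := rho_ge1 (- s); lra.
  have [g [G1 G2 G3]] := near_linear_inverse c0 HdL r0.
  have ss := start s hs.
  (* [psi] comes from a choice; its continuity follows from uniqueness, which makes it agree with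
     the local inverse [g]. *)
  have gpsi b : normc (b - L (- s)) < normc (-1 : C) / 2 * rho (- s) ->
      complex.Re b < s0 -> g b = psi b.
    by move=> /G1 [g1 g2] hb; rewrite -{2}g2 Luniq ?g2 //; exact: inball g1.
  move=> e e0; have [r r0' Hr] := cder_cont (G3 s ss) e0.
  pose r1 := normc (-1 : C) / 2 * rho (- s) - normc (s - L (- s)).
  exists (Num.min r (Num.min r1 (s0 - complex.Re s))).
    by rewrite !lt_min r0' !subr_gt0 ss hs.
  move=> b; rewrite !lt_min => /andP[/Hr h3 /andP[h4 h5]].
  have hb : complex.Re b < s0.
    have := le_lt_trans (ler_Re_normc _) h5; rewrite raddfB /= ltr_norml => /andP[_]; lra.
  rewrite -!gpsi //.
  rewrite /r1 in h4; have := ler_normc_dist b s (L (- s)); lra.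
- by move=> w /HK1 [].
- move=> K; have [M HM] := D_ball K; exists (- M) => s hs hM.
  have [h1 h2] := Hpsi _ hs; apply: (HM s) => //.
  have h3 := Lw _ (inball _ _ hs h1); rewrite h2 in h3.
  have r1 := rho_ge1 (psi s).
  have h4 : rho (psi s) <= 2 * rho (- s) by apply: rho_slow; lra.
  rewrite opprK in h3; have := rho_ge1 (- s); lra.
- split; first exact: end_log_shift.
  by apply: Ha; rewrite divr_gt0.
Qed.

End LogarithmicEnd.

(** * Logarithmic charts at points of the plane *)

Section Charts.
Variable R : realType.
Local Notation C := R[i].
Local Notation cexp := (@cexpi R).
Local Notation tpi := (@ctwopi_i R).

(* The periods of [psi] are the multiples of [2 pi i m]: none when [m = 0]. *)
Definition log_chart (F : C -> C) (S : C -> Prop) (a : C) (m : nat) (s0 : R) (psi : C -> C) :=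
  (forall s, complex.Re s < s0 -> [/\ S (psi s), F (psi s) = a + cexp s & ccont psi s]) /\
  (forall s s', complex.Re s < s0 -> complex.Re s' < s0 ->
     psi s = psi s' <-> exists n : int, s' = s + (n *+ m)%:~R * tpi).

Section FinitePoint.
Variables (F G : C -> C) (S : C -> Prop) (p : C) (m : nat).
Hypothesis m0 : (0 < m)%N.
Hypothesis F_der : forall z, cder F z ((z - p) ^+ m.-1 * G z).
Hypothesis G_cont : ccont G p.
Hypothesis Gp0 : G p != 0.
Hypothesis S_near : exists2 r : R, 0 < r & forall z, z != p -> normc (z - p) < r -> S z.

Lemma Re_mul_real (x : R) z : complex.Re (x%:C * z) = x * complex.Re z.
Proof. by case: z => a b; simpc. Qed.

Lemma Re_tpi (n : int) : complex.Re (n%:~R * tpi) = 0.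
Proof.
have -> : (n%:~R : C) = (n%:~R : R)%:C by rewrite rmorph_int.
by rewrite Re_mul_real mulr0.
Qed.

Let mC : C := m%:R.

Lemma mC_neq0 : mC != 0.
Proof. by rewrite /mC pnatr_eq0 -lt0n. Qed.

(** In the coordinate z = p + exp(-(v + c0)/m) one has (z - p)^m = e^(-v - c0), so F' dz/dv = -(z -
    p)^m G z / m. With e^c0 = G p / m this is -e^(-v) G z / G p, and [logarithmic_end] applies with
    k = -v on half-planes, at scale 1. *)
Lemma finite_log_chart : exists (s0 : R) (psi : C -> C),
  [/\ log_chart F S (F p) m s0 psi,
      forall e, 0 < e -> exists M, forall s, complex.Re s < s0 -> complex.Re s < M ->
        normc (psi s - p) < e &
      forall M, exists2 e, 0 < e & forall z, z != p -> normc (z - p) < e ->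
        exists s, [/\ complex.Re s < s0, complex.Re s < M & psi s = z]].
Proof.
have mC0 := mC_neq0.
have mR0 : 0 < m%:R :> R by rewrite ltr0n.
have [c0 Ec0] : exists c0, cexp c0 = G p / mC.
  by apply: cexp_surj; rewrite mulf_neq0 // invr_eq0.
pose phi v := p + cexp (- (v + c0) / mC).
pose f v := F (phi v).
pose df v := ((phi v - p) ^+ m.-1 * G (phi v)) * (cexp (- (v + c0) / mC) * (- mC^-1)).
pose k (v : C) := - v.
pose dk (v : C) : C := -1.
pose D (K : R) (w : C) := K < complex.Re w.
pose rho (w : C) : R := 1.
have phiB v : phi v - p = cexp (- (v + c0) / mC) by rewrite /phi addrAC subrr add0r.
have RemC z : complex.Re (z / mC) = complex.Re z / m%:R.
  have -> : z / mC = (m%:R^-1)%:C * z by rewrite mulrC fmorphV rmorph_nat.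
  by rewrite Re_mul_real mulrC.
have Nphi v : normc (phi v - p) = expR (- (complex.Re v + complex.Re c0) / m%:R).
  by rewrite phiB normc_cexp RemC !raddfN raddfD.
have phi_small e : 0 < e -> exists K, forall v, D K v -> normc (phi v - p) < e.
  move=> e0; exists (- (m%:R * ln e) - complex.Re c0) => v; rewrite /D => hv.
  rewrite Nphi -[ltRHS]lnK ?posrE // ltr_expR ltr_pdivrMr //; lra.
have phim v : (phi v - p) ^+ m = cexp (- (v + c0)).
  by rewrite phiB -cexpMn; congr cexp; rewrite mulrC divfK.
have fder v : cder f v (df v).
  have h : cder phi v (cexp (- (v + c0) / mC) * (- mC^-1)).
    rewrite -[X in cder _ _ X]add0r; apply: cderD; first exact: cder_cst.
    apply: cder_comp; last exact: cder_cexp.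
    have := cderZ (- mC^-1) (cderD (cder_id v) (cder_cst c0 v)).
    rewrite addr0 mulr1; apply: cder_eq; exists 1 => // w _; ring.
  exact: cder_comp h (F_der (phi v)).
have kder v : cder k v (dk v).
  have := cderZ (-1) (cder_id v); rewrite mulr1.
  by apply: cder_eq; exists 1 => // w _; rewrite mulN1r.
have asym v : df v + cexp (k v) = - cexp (k v) * (G (phi v) / G p - 1).
  have h : cexp (- (v + c0)) = cexp (k v) / (G p / mC) by rewrite -Ec0 -cexpB /k; congr cexp; ring.
  have -> : df v = - (((phi v - p) ^+ m.-1 * (phi v - p)) * G (phi v) / mC).
    by rewrite /df -phiB; field.
  rewrite -exprSr prednK // phim h; field; by rewrite mC0 Gp0.
have [] := @logarithmic_end R D rho f df k dk 0.
- by move=> K K' w KK'; rewrite /D; exact: le_lt_trans.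
- move=> K; exists K => w t; rewrite /D raddfD /= => *; lra.
- move=> K; exists (K + 1) => s w h1 h2; rewrite /D.
  have := le_trans (ler_Re_normc _) h2; rewrite raddfD /rho /= ler_norml => /andP[]; lra.
- by move=> w; rewrite /rho.
- by move=> w w' _; rewrite /rho; lra.
- by move=> w _.
- by move=> w _.
- by move=> e e0; exists 0 => w _; rewrite /dk addNr Normc.normc0 ltW.
- move=> e e0.
  have NG : 0 < normc (G p) by rewrite normc_gt0.
  have [r r0 Hr] := G_cont (mulr_gt0 e0 NG).
  have [K HK] := phi_small _ r0; exists K => w /HK /Hr h.
  rewrite asym Normc.normcM normcN mulrC ler_wpM2r ?normc_ge0 //.
  have -> : G (phi w) / G p - 1 = (G (phi w) - G p) / G p by field.
  by rewrite Normc.normcM Normc.normcV ler_pdivrMr // ltW.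
- move=> e e0; exists 0 => w _; rewrite /k addNr Normc.normc0 mulr_ge0 //; exact: ltW.
move=> a [L [psi0 [K1 [s0 [E1 E2 E3 E4 [E5 E6]]]]]].
have Fc : ccont F p by apply: cder_cont (F_der p).
(* z tends to p as Re v grows, so the limit is [F p] by continuity; [x] below is a real point far
   enough out for all the estimates. *)
have aE : a = F p.
  apply/eqP; rewrite -subr_eq0 -normc_eq0 eq_le normc_ge0 andbT.
  apply/ler_addgt0Pr => e e0; rewrite add0r.
  have e2 : 0 < e / 2 by rewrite divr_gt0.
  have [K HK] := E6; have [r r0 Hr] := Fc _ e2; have [K' HK'] := phi_small _ r0.
  set b := Num.max K (Num.max K' (- ln (e / 4))); pose x := b + 1.
  have : [/\ D K x%:C, D K' x%:C & - ln (e / 4) < x].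
    have bx : b < x by rewrite ltrDl.
    by rewrite /D /=; split; apply: le_lt_trans bx; rewrite !le_max lexx ?orbT.
  move=> [/HK h1 /HK' /Hr h2 h3].
  have h4 : normc (cexp (k x%:C)) < e / 4.
    rewrite normc_cexp /k raddfN /= -[ltRHS]lnK ?posrE ?divr_gt0 // ltr_expR; lra.
  have -> : a - F p = (f x%:C - F p) - cexp (k x%:C) - (f x%:C - a - cexp (k x%:C)) by ring.
  apply: (le_trans (ler_normcBD _ _)).
  have := ler_normcBD (f x%:C - F p) (cexp (k x%:C)); lra.
subst a.
have [r r0 Hr] := S_near.
have [K2 HK2] := phi_small _ r0.
have [M2 HM2] := E4 K2.
pose s1 := Num.min s0 M2.
have s10 s : complex.Re s < s1 -> complex.Re s < s0 /\ complex.Re s < M2.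
  by rewrite lt_min => /andP.
have phi_eq v v' : phi v = phi v' <-> exists n : int, v' = v - (n *+ m)%:~R * tpi.
  have nmE n : ((n *+ m)%:~R : C) = n%:~R * mC by rewrite -mulr_natr rmorphM /= rmorph_nat.
  split=> [/addrI /esym /cexp_eq [n hn]|[n ->]].
    exists n; rewrite nmE.
    have -> : n%:~R * mC * tpi = mC * (n%:~R * tpi) by ring.
    have -> : n%:~R * tpi = - (v' + c0) / mC - (- (v + c0) / mC) by rewrite hn; ring.
    by field.
  have -> : phi v = p + cexp (- (v + c0) / mC) by [].
  rewrite /phi -(cexp_periodic (- (v + c0) / mC) n); congr (p + cexp _).
  by rewrite nmE; field.
(* The coordinate has period 2 pi i m, and k = -v changes by a multiple of 2 pi i, so L + v is
   preserved. *)
have Lshift v n : L (v - (n *+ m)%:~R * tpi) = L v + (n *+ m)%:~R * tpi.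
  have e1 : f (v - (n *+ m)%:~R * tpi) = f v by congr F; apply/esym/phi_eq; exists n.
  have e2 : cexp (k (v - (n *+ m)%:~R * tpi)) = cexp (k v).
    by rewrite /k opprB addrC cexp_periodic.
  by have := E5 _ _ e1 e2; rewrite /k => h; rewrite -[LHS](subrK (- (v - (n *+ m)%:~R * tpi))) h; ring.
exists s1, (fun s => phi (psi0 s)); split.
- split.
  + move=> s /s10 [h1 h2]; have [D1 Ls cs] := E1 _ h1.
    split.
    * apply: Hr; first by rewrite -subr_eq0 phiB cexp_neq0.
      exact/HK2/HM2.
    * by have := E2 _ D1; rewrite Ls => ->; rewrite addrC subrK.
    * move=> e e0.
      have [r1 r10 H1] := cder_cont (cder_cexp (- (psi0 s + c0) / mC)) e0.
      have Nm : 0 < normc mC by rewrite normc_gt0.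
      have [r2 r20 H2] := cs _ (mulr_gt0 r10 Nm).
      exists r2 => // b /H2 h.
      have -> : phi (psi0 b) - phi (psi0 s) = cexp (- (psi0 b + c0) / mC) - cexp (- (psi0 s + c0) / mC).
        by rewrite /phi; ring.
      apply: H1.
      have -> : - (psi0 b + c0) / mC - - (psi0 s + c0) / mC = - (psi0 b - psi0 s) / mC by field.
      by rewrite Normc.normcM normcN Normc.normcV ltr_pdivrMr.
  + move=> s s' /s10 [h1 _] /s10 [h1' _].
    have [D1 Ls _] := E1 _ h1; have [D1' Ls' _] := E1 _ h1'.
    split=> [/phi_eq [n hn]|[n hn]].
      by exists n; rewrite -Ls' hn Lshift Ls.
    apply/phi_eq; exists n; rewrite hn -Ls -Lshift E3 ?Lshift ?Ls -?hn //.
    rewrite /D raddfB /= Re_tpi subr0; exact: D1.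
- move=> e e0; have [K HK] := phi_small _ e0; have [M HM] := E4 K.
  by exists M => s /s10 [h1 _] h2; apply/HK/HM.
- move=> M; pose M' := Num.min s1 M.
  have [r1 r10 H1] := Fc _ (expR_gt0 M').
  (* Closer than this to [p], the coordinate v has real part above K1 + 1, in the domain of L. *)
  pose e := expR (- (K1 + 1 + complex.Re c0) / m%:R).
  exists (Num.min r1 e); first by rewrite lt_min r10 expR_gt0.
  move=> z zp; rewrite lt_min => /andP[/H1 h1 h2].
  have [u hu] : exists u, cexp u = z - p by apply: cexp_surj; rewrite subr_eq0.
  pose v := - (mC * u) - c0.
  have zv : phi v = z.
    rewrite /phi (_ : - (v + c0) / mC = u) ?hu; first by rewrite addrC subrK.
    by rewrite /v; field.
  have Dv : D K1 v.
    rewrite /D; move: h2; rewrite -zv Nphi /e ltr_expR ltr_pM2r ?invr_gt0 //; lra.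
  have hL : complex.Re (L v) < M'.
    by rewrite -ltr_expR -normc_cexp E2 // /f zv.
  have [hL1 hL2] : complex.Re (L v) < s1 /\ complex.Re (L v) < M.
    by move: hL; rewrite lt_min => /andP.
  by exists (L v); split => //; rewrite E3 //; have [] := s10 _ hL1.
Qed.

End FinitePoint.
End Charts.

(** * Growth and oscillation of polynomials near infinity *)

Section PolynomialGrowth.
Variable R : realType.
Local Notation C := R[i].
Implicit Types (p : {poly C}) (z w : C).

Lemma ler_normc_sum n (u : nat -> C) :
  normc (\sum_(i < n) u i) <= \sum_(i < n) normc (u i).
Proof.
elim: n => [|n IH]; first by rewrite !big_ord0 Normc.normc0.
by rewrite !big_ord_recr /=; apply: (le_trans (ler_normcD _ _)); rewrite lerD2r.
Qed.

Lemma normcX_le (x : R) i n : 1 <= x -> (i <= n)%N -> x ^+ i <= x ^+ n.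
Proof. by move=> x1 h; rewrite ler_weXn2l. Qed.

Lemma poly_lead_asymptotic p n : (size p <= n.+1)%N -> forall e : R, 0 < e ->
  exists2 K : R, 1 <= K & forall z, K <= normc z ->
    normc (p.[z] - p`_n * z ^+ n) <= e * normc z ^+ n.
Proof.
move=> sp e e0.
pose A := \sum_(i < n) normc p`_i.
have A0 : 0 <= A by apply: sumr_ge0 => i _; exact: normc_ge0.
exists (Num.max 1 (A / e)); first by rewrite le_max lexx.
move=> z; rewrite ge_max => /andP[z1]; rewrite ler_pdivrMr // mulrC => zA.
rewrite (horner_coef_wide _ sp) big_ord_recr /= addrK.
apply: (le_trans (ler_normc_sum _ (fun i => p`_i * z ^+ i))).
apply: (@le_trans _ _ (A * normc z ^+ n.-1)).
  rewrite /A mulr_suml; apply: ler_sum => i _.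
  rewrite Normc.normcM normcX ler_wpM2l ?normc_ge0 // normcX_le //.
  by rewrite -ltnS; apply: leq_trans (leqSpred n).
case: n @A A0 {sp} zA => [A _ _|n A A0 zA].
  by rewrite /A big_ord0 mul0r mulr_ge0 // ltW.
by rewrite exprS mulrA ler_wpM2r // exprn_ge0 // normc_ge0.
Qed.

(** The factor |z| on the left stands for the exponent i - 1 on the right, so that i = 0 is no
    exception. *)
Lemma monomial_difference i : exists2 A : R, 0 <= A & forall z w,
  normc (w - z) <= normc z ->
  normc (w ^+ i - z ^+ i) * normc z <= A * normc (w - z) * normc z ^+ i.
Proof.
elim: i => [|i [A A0 HA]].
  by exists 0 => // z w _; rewrite !expr0 subrr Normc.normc0 !mul0r.
exists (2 * A + 1) => [|z w h]; first lra.
have -> : w ^+ i.+1 - z ^+ i.+1 = w * (w ^+ i - z ^+ i) + (w - z) * z ^+ i.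
  by rewrite !exprS; ring.
have Nz := normc_ge0 z.
have Nw : normc w <= 2 * normc z by have := ler_normcD (w - z) z; rewrite subrK; lra.
have D0 := normc_ge0 (w - z).
apply: (@le_trans _ _ ((normc w * normc (w ^+ i - z ^+ i) + normc (w - z) * normc z ^+ i) * normc z)).
  by rewrite ler_wpM2r // (le_trans (ler_normcD _ _)) // !Normc.normcM normcX.
have h1 := HA z w h.
have zi : 0 <= normc z ^+ i by rewrite exprn_ge0.
have h2 : normc w * (normc (w ^+ i - z ^+ i) * normc z) <=
    2 * normc z * (A * normc (w - z) * normc z ^+ i).
  by apply: ler_pM => //; rewrite ?normc_ge0 // mulr_ge0 // normc_ge0.
rewrite exprS; lra.
Qed.

Lemma poly_difference p n : (size p <= n.+1)%N -> exists2 A : R, 0 <= A & forall z w,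
  1 <= normc z -> normc (w - z) <= normc z ->
  normc (p.[w] - p.[z]) * normc z <= A * normc (w - z) * normc z ^+ n.
Proof.
move=> sp.
have ex i : exists A : R, 0 <= A /\ forall z w, normc (w - z) <= normc z ->
    normc (w ^+ i - z ^+ i) * normc z <= A * normc (w - z) * normc z ^+ i.
  by have [A A0 HA] := monomial_difference i; exists A.
have [A HA] := choice ex.
exists (\sum_(i < n.+1) normc p`_i * A i).
  by apply: sumr_ge0 => i _; rewrite mulr_ge0 ?normc_ge0 //; have [] := HA i.
move=> z w z1 h.
rewrite !(horner_coef_wide _ sp) -sumrB.
have Nz : 0 <= normc z by lra.
apply: (@le_trans _ _ ((\sum_(i < n.+1) normc (p`_i * w ^+ i - p`_i * z ^+ i)) * normc z)).
  by rewrite ler_wpM2r // (ler_normc_sum _ (fun i => p`_i * w ^+ i - p`_i * z ^+ i)).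
rewrite !mulr_suml; apply: ler_sum => i _.
have [A0 HAi] := HA i.
rewrite -mulrBr Normc.normcM -!mulrA ler_wpM2l ?normc_ge0 //.
apply: (le_trans (HAi _ _ h)); rewrite mulrA ler_wpM2l ?mulr_ge0 ?normc_ge0 //.
by rewrite normcX_le // -ltnS.
Qed.

End PolynomialGrowth.

(** * Inverse branches of F on disks of a uniform radius *)

Section Schlicht.
Variable R : realType.
Local Notation C := R[i].
Local Notation cexp := (@cexpi R).
Variables (P Q : {poly C}) (d1 d2 : nat).
Hypothesis degP : size P = d1.+1.
Hypothesis degQ : size Q = d2.+1.
Variable F : C -> C.
Hypothesis F_der : forall z, cder F z (Q.[z] * cexp P.[z]).

Local Notation dF z := (Q.[z] * cexp P.[z]).

Lemma lead_neq0 (p : {poly C}) n : size p = n.+1 -> p`_n != 0.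
Proof.
move=> sp; have : lead_coef p != 0 by rewrite lead_coef_eq0 -size_poly_eq0 sp.
by rewrite lead_coefE sp.
Qed.

Lemma poly_large : exists2 K : R, 1 <= K & forall z, K <= normc z ->
  normc Q`_d2 / 2 * normc z ^+ d2 <= normc Q.[z].
Proof.
have Nl : 0 < normc Q`_d2 by rewrite normc_gt0 lead_neq0.
have sQ : (size Q <= d2.+1)%N by rewrite degQ.
have [K K1 HK] := poly_lead_asymptotic sQ (divr_gt0 Nl (ltr0Sn _ 1)).
exists K => // z /HK h.
have := ler_dist_normc (Q`_d2 * z ^+ d2) Q.[z].
rewrite (normcB (_ * _)) Normc.normcM normcX; lra.
Qed.

(* On the scale [|z|^(1-d1)] around [z], [F'] varies by a bounded factor. *)
Lemma uniform_branch (delta : R) : 0 < delta -> exists K d : R, [/\ 1 <= K, 0 < d &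
  forall z, K <= normc z -> delta * normc z ^+ d1 <= normc (dF z) * normc z ->
  exists g : C -> C, g (F z) = z /\ forall b, normc (b - F z) < d ->
    [/\ F (g b) = b, dF (g b) != 0, cder g b (dF (g b))^-1 & normc (g b) <= 2 * normc z]].
Proof.
move=> delta0.
have Nl : 0 < normc Q`_d2 by rewrite normc_gt0 lead_neq0.
have sQ : (size Q <= d2.+1)%N by rewrite degQ.
have sP : (size P <= d1.+1)%N by rewrite degP.
have [AP AP0 HAP] := poly_difference sP.
have [AQ AQ0 HAQ] := poly_difference sQ.
have [K K1 HK] := poly_large.
pose B := AP + AQ / normc Q`_d2.
have B0 : 0 <= B by rewrite addr_ge0 // divr_ge0 // ltW.
(* On the disk of radius c |z|^(1-d1) about z, [P] then moves by at most 1/16 and [Q] by at most |Q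
   z| / 8, which keeps F' within half of its value at z. *)
pose c := (16 * (B + 1))^-1.
have B16 : 0 < 16 * (B + 1) by rewrite mulr_gt0 //; lra.
have c0 : 0 < c by rewrite invr_gt0.
have cB : c * (B + 1) = 1 / 16 by rewrite /c; field; rewrite gt_eqF //; lra.
have BP : AP <= B + 1 by have := divr_ge0 AQ0 (ltW Nl); rewrite /B; lra.
have BQ : AQ <= (B + 1) * normc Q`_d2.
  by rewrite -ler_pdivrMr // /B; lra.
have c1 : c <= 1 / 16 by rewrite -cB ler_peMr ?(ltW c0) //; lra.
exists K, (c * delta / 2); split => //; first by rewrite divr_gt0 // mulr_gt0.
move=> z Kz hz.
have z1 : 1 <= normc z by lra.
have z0 : 0 < normc z by lra.
have zd : 1 <= normc z ^+ d1 by rewrite exprn_ege1.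
pose r := c * normc z / normc z ^+ d1.
have r0 : 0 < r by rewrite divr_gt0 ?mulr_gt0 ?exprn_gt0.
have rz : r <= normc z / 16.
  rewrite /r ler_pdivrMr ?exprn_gt0 //.
  have h1 : c * normc z <= 1 / 16 * normc z by rewrite ler_pM2r.
  have h2 : 1 / 16 * normc z <= 1 / 16 * normc z * normc z ^+ d1.
    by rewrite ler_peMr // mulr_ge0 // ltW.
  lra.
have rzd : r * normc z ^+ d1 = c * normc z by rewrite /r divfK // gt_eqF // exprn_gt0.
have NdF : 0 < normc (dF z).
  have : 0 < normc (dF z) * normc z by apply: lt_le_trans hz; rewrite mulr_gt0 // exprn_gt0.
  by rewrite pmulr_lgt0.
have dF0 : dF z != 0 by rewrite -normc_gt0.
have Qz0 : Q.[z] != 0 by apply: contraNneq dF0 => ->; rewrite mul0r.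
have NQ : 0 < normc Q.[z] by rewrite normc_gt0.
have nl w : normc (w - z) < r -> cder F w (dF w) /\ normc (dF w - dF z) <= normc (dF z) / 2.
  move=> hw; split => //.
  have hwz : normc (w - z) <= normc z by lra.
  have D0 := normc_ge0 (w - z).
  have hP : normc (P.[w] - P.[z]) <= 1 / 16.
    rewrite -(ler_pM2r z0); apply: (le_trans (HAP _ _ z1 hwz)).
    apply: (@le_trans _ _ ((B + 1) * r * normc z ^+ d1)).
      rewrite ler_pM2r ?exprn_gt0 // ler_pM //; exact: ltW.
    by rewrite -mulrA rzd mulrA [_ * c]mulrC cB.
  have hQ : normc (Q.[w] - Q.[z]) <= 1 / 8 * normc Q.[z].
    have h1 : normc (Q.[w] - Q.[z]) * normc z <= (B + 1) * normc Q`_d2 * r * normc z ^+ d2.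
      apply: (le_trans (HAQ _ _ z1 hwz)); rewrite ler_pM2r ?exprn_gt0 // ler_pM //; exact: ltW.
    have h2 := HK _ Kz.
    have h3 : (B + 1) * r <= 1 / 16 * normc z.
      rewrite -cB [X in _ <= X]mulrAC mulrC ler_pM2r; last lra.
      by rewrite -rzd ler_peMr //; exact: ltW.
    rewrite -(ler_pM2r z0); apply: (le_trans h1).
    have X0 : 0 <= normc Q`_d2 * normc z ^+ d2 by rewrite mulr_ge0 // ?exprn_ge0 // ltW.
    have := ler_wpM2l X0 h3; have := ler_wpM2r (ltW z0) h2; lra.
  have he : normc (cexp (P.[w] - P.[z]) - 1) <= 1 / 8.
    have h : normc (P.[w] - P.[z]) <= 1 / 2 by lra.
    by apply: (le_trans (normc_cexp_sub1 h)); lra.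
  have -> : dF w - dF z = cexp P.[z] *
      ((Q.[w] - Q.[z]) * (cexp (P.[w] - P.[z]) - 1) + (Q.[w] - Q.[z]) + Q.[z] * (cexp (P.[w] - P.[z]) - 1)).
    by rewrite cexpB; field; exact: cexp_neq0.
  rewrite Normc.normcM [in X in _ <= X]Normc.normcM [normc Q.[z] * _]mulrC -mulrA.
  rewrite ler_wpM2l ?normc_ge0 //.
  apply: (le_trans (ler_normcD _ _)).
  have := ler_normcD ((Q.[w] - Q.[z]) * (cexp (P.[w] - P.[z]) - 1)) (Q.[w] - Q.[z]).
  rewrite !Normc.normcM.
  have : normc (Q.[w] - Q.[z]) * normc (cexp (P.[w] - P.[z]) - 1) <= 1 / 8 * normc Q.[z] * (1 / 8).
    by apply: ler_pM => //; exact: normc_ge0.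
  have : normc Q.[z] * normc (cexp (P.[w] - P.[z]) - 1) <= normc Q.[z] * (1 / 8).
    by rewrite ler_pM2l.
  lra.
have [g [G1 G2 G3]] := near_linear_inverse dF0 nl r0.
(* The hypothesis on [delta] bounds |F' z| |z|^(1-d1) below, so the radius of the branch does not
   depend on z. *)
have rad : c * delta / 2 <= normc (dF z) / 2 * r.
  rewrite -(ler_pM2r (_ : 0 < normc z ^+ d1)) ?exprn_gt0 // -[_ * r * _]mulrA rzd.
  have := ler_wpM2l (ltW c0) hz; lra.
exists g; split.
  by apply: G2; rewrite subrr Normc.normc0 // mulr_gt0 // divr_gt0.
move=> b hb; have {}hb : normc (b - F z) < normc (dF z) / 2 * r by lra.
have [g1 g2] := G1 _ hb; split => //.
- have [_ h] := nl _ g1; apply/eqP => d0; move: h; rewrite d0 sub0r normcN; lra.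
- exact: G3.
- have := ler_normcD (g b - z) z; rewrite subrK; lra.
Qed.

End Schlicht.

(** * Logarithmic charts at infinity *)

Section EndChart.
Variable R : realType.
Local Notation C := R[i].
Local Notation cexp := (@cexpi R).
Variables (P Q : {poly C}) (d1 d2 : nat).
Hypothesis degP : size P = d1.+1.
Hypothesis degQ : size Q = d2.+1.
Variable F : C -> C.
Hypothesis F_der : forall z, cder F z (Q.[z] * cexp P.[z]).
Hypothesis d1_gt0 : (0 < d1)%N.
Local Notation dF z := (Q.[z] * cexp P.[z]).
Local Notation lP := (P`_d1).
Local Notation lQ := (Q`_d2).
Local Notation dC := (d1%:R : C).

Definition croot (w : C) : C := cexp (Log w / dC).

(* The sector [|arg w| < 3 pi / 4], outside a disk. *)
Definition sector (K : R) (w : C) :=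
  0 < complex.Re w + `|complex.Im w| /\ K < normc w.

Lemma dC_neq0 : dC != 0.
Proof. by rewrite pnatr_eq0 -lt0n. Qed.

Lemma sector_slit K w : sector K w -> slit w.
Proof.
move=> [h _]; have [i0|i0] := eqVneq (complex.Im w) 0; last by right.
by left; move: h; rewrite i0 normr0 addr0.
Qed.

Lemma crootK w : slit w -> croot w ^+ d1 = w.
Proof.
move=> sw; rewrite /croot -cexpMn mulrC divfK ?dC_neq0 //.
by have [] := LogP sw.
Qed.

Lemma croot_neq0 w : croot w != 0.
Proof. exact: cexp_neq0. Qed.

Lemma slit_neq0 (w : C) : slit w -> w != 0.
Proof. by move=> sw; have [_ <-] := LogP sw; exact: cexp_neq0. Qed.

Lemma cder_croot w : slit w -> cder croot w (croot w / (dC * w)).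
Proof.
move=> sw; have w0 := slit_neq0 sw; have d0 := dC_neq0.
have := cder_comp (cderZ dC^-1 (cder_Log sw)) (cder_cexp (dC^-1 * Log w)).
rewrite (_ : croot w / (dC * w) = cexp (dC^-1 * Log w) * (dC^-1 / w)).
  by apply: cder_eq; exists 1 => // y _; rewrite /croot mulrC.
by rewrite /croot [_^-1 * Log w]mulrC; field; rewrite w0 d0.
Qed.

(** If Re w < 0 in the sector, then |Im w| exceeds |Re w| and is preserved by the shift. *)
Lemma normc_sector_shift K w (t : R) : sector K w -> 0 <= t -> normc w <= 2 * normc (w + t%:C).
Proof.
move=> [h _] t0.
have h1 := ler_normc_ReIm w.
have := ler_Re_normc (w + t%:C); have := ler_Im_normc (w + t%:C).
rewrite !raddfD /= addr0.
have [r0|r0] := leP 0 (complex.Re w).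
  rewrite ger0_norm // in h1; have := ler_norm (complex.Re w + t); lra.
rewrite ltr0_norm // in h1; lra.
Qed.

Lemma Log_growth (e : R) : 0 < e -> exists2 B : R, 0 <= B &
  forall w, slit w -> 1 <= normc w -> normc (Log w) <= e * normc w + B.
Proof.
move=> e0; exists (`|ln e| + pi); first by rewrite addr_ge0 // pi_ge0.
move=> w sw w1; have w0 : 0 < normc w by lra.
have [h1 h2] := LogP sw.
apply: (le_trans (ler_normc_ReIm _)); rewrite (Re_Log sw) ger0_norm ?ln_ge0 //.
have : ln (e * normc w) <= e * normc w.
  have := expR_ge1Dx (ln (e * normc w)); rewrite lnK ?posrE ?mulr_gt0 //; lra.
rewrite lnM ?posrE //; have := ler_norm (- ln e); rewrite normrN; lra.
Qed.

Section OneEnd.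
Variable lam : C.
Hypothesis lamE : lam ^+ d1 * lP = -1.

Let phi w := lam * croot w.

Lemma lP_neq0 : lP != 0.
Proof. exact: lead_neq0 degP. Qed.

Lemma lam_neq0 : lam != 0.
Proof.
apply/eqP => l0; move: lamE; rewrite l0 expr0n eqn0Ngt d1_gt0 mul0r => /eqP.
by rewrite eq_sym oppr_eq0 oner_eq0.
Qed.

Lemma phiX w : slit w -> lP * phi w ^+ d1 = - w.
Proof. by move=> sw; rewrite /phi exprMn crootK // mulrA [lP * _]mulrC lamE mulN1r. Qed.

Lemma normc_phiX w : slit w -> normc lP * normc (phi w) ^+ d1 = normc w.
Proof. by move=> sw; rewrite -normcX -Normc.normcM phiX // normcN. Qed.

Lemma phi_large (K : R) : exists K', forall w, slit w -> K' < normc w -> K < normc (phi w).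
Proof.
exists (normc lP * `|K| ^+ d1) => w sw; rewrite -(normc_phiX sw) ltr_pM2l ?normc_gt0 ?lP_neq0 //.
rewrite ltr_pXn2r ?nnegrE ?normc_ge0 // => h.
exact: le_lt_trans (ler_norm K) h.
Qed.

Lemma cder_phi w : slit w -> cder phi w (phi w / (dC * w)).
Proof. by move=> sw; rewrite /phi -mulrA; apply: cderZ; exact: cder_croot. Qed.

Lemma phi_inj w w' : slit w -> slit w' -> phi w = phi w' -> w = w'.
Proof. by move=> sw sw' e; apply: oppr_inj; rewrite -!phiX // e. Qed.

(** In the coordinate w = -lP z^d1 the polynomial [P] is -w + o(w), so F' dz/dw has the form
    required by [logarithmic_end]. The last clause says that a point of the sector where |F'|
    |z|^(1-d1) is small is deep in the chart, because |f - a| is comparable with |df|. *)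
Lemma end_log_chart (S : C -> Prop) :
  (exists K, forall z, K < normc z -> S z) ->
  exists (a : C) (s0 : R) (psi0 : C -> C),
  let psi s := phi (psi0 s) in
  [/\ log_chart F S a 0 s0 psi,
      forall s, complex.Re s < s0 -> slit (psi0 s),
      forall K : R, exists M, forall s, complex.Re s < s0 -> complex.Re s < M -> K < normc (psi s) &
      forall M : R, exists delta K : R, 0 < delta /\ forall w, sector K w ->
        normc (dF (phi w)) * normc (phi w) < delta * normc (phi w) ^+ d1 ->
        exists s, [/\ complex.Re s < s0, complex.Re s < M & psi s = phi w]].
Proof.
move=> [KS HKS].
have dC0 := dC_neq0; have lP0 := lP_neq0; have lQ0 : lQ != 0 := lead_neq0 degQ.
have l0 := lam_neq0.
have NlP : 0 < normc lP by rewrite normc_gt0.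
have NlQ : 0 < normc lQ by rewrite normc_gt0.
have NdC : 0 < normc dC by rewrite normc_gt0.
have [c0 Ec0] : exists c0, cexp c0 = - (lQ * lam ^+ d2.+1 / dC).
  by apply: cexp_surj; rewrite oppr_eq0 !mulf_neq0 ?expf_neq0 // invr_eq0.
(* With this exponent w^kap is proportional to z^(d2+1) / w, which is the growth of Q dz/dw. *)
pose kap : C := (d2.+1%:R - d1%:R) / dC.
pose f w := F (phi w).
pose df w := dF (phi w) * (phi w / (dC * w)).
pose k w := P.[phi w] + kap * Log w + c0.
pose dk w := (P^`()).[phi w] * (phi w / (dC * w)) + kap * w^-1.
(* k + w is o(|w|) but in general unbounded, so the scale must grow linearly. *)
pose rho (w : C) : R := 1 + normc w / 8.
have kexp w : slit w -> cexp (k w) = - (cexp P.[phi w] * lQ * phi w ^+ d2.+1 / (dC * w)).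
  move=> sw; have w0 := slit_neq0 sw.
  have h : cexp (kap * Log w) = croot w ^+ d2.+1 / w.
    rewrite -[X in _ / X]crootK // /croot -!cexpMn -cexpB; congr cexp.
    by rewrite /kap; field.
  by rewrite /k !cexpD h Ec0 /phi exprMn; field; rewrite w0 dC0.
have asymk w : slit w -> df w + cexp (k w) =
    cexp P.[phi w] * phi w / (dC * w) * (Q.[phi w] - lQ * phi w ^+ d2).
  move=> sw; have w0 := slit_neq0 sw; rewrite kexp // /df exprS; field.
  by rewrite w0 dC0.
have asymdf (e : R) : 0 < e -> eventually_in sector (fun w =>
    normc (df w + cexp (k w)) <= e * normc (cexp (k w))).
  move=> e0.
  have sQ : (size Q <= d2.+1)%N by rewrite degQ.
  have [K1 _ HK1] := poly_lead_asymptotic sQ (mulr_gt0 e0 NlQ).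
  have [K2 HK2] := phi_large K1; exists K2 => w Dw.
  have sw := sector_slit Dw; have w0 := slit_neq0 sw.
  have h := HK1 _ (ltW (HK2 _ sw (proj2 Dw))).
  rewrite asymk // kexp // normcN exprS.
  have -> : cexp P.[phi w] * lQ * (phi w * phi w ^+ d2) / (dC * w) =
    cexp P.[phi w] * phi w / (dC * w) * (lQ * phi w ^+ d2) by field; rewrite w0 dC0.
  set A := _ / (dC * w); rewrite !(Normc.normcM A) mulrCA ler_wpM2l ?normc_ge0 //.
  by apply: (le_trans h); rewrite (Normc.normcM lQ) normcX; lra.
have [] := @logarithmic_end R sector rho f df k dk 0.
- by move=> K K' w KK' [h1 h2]; split => //; exact: le_lt_trans h2.
- move=> K; exists (2 * `|K|) => w t Dw t0.
  have := normc_sector_shift Dw t0; case: Dw => h1 h2 h3; split.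
    by rewrite !raddfD /= addr0; lra.
  have := ler_norm K; lra.
(* As |u| >= 8, the disk of radius rho u lies within |u| / 4 of u. Since Re u + |Im u| >= |u|, the
   sum Re w + |Im w| stays above |u| / 2 there, although the disk may leave the right half-plane;
   hence the wide sector. *)
- move=> K; exists (8 + 2 * `|K|) => s w h1 h2.
  have r0 := normr_ge0 K.
  move: h2; rewrite /rho; set u := - s.
  have -> : w + s = w - u by rewrite /u opprK.
  have {}h1 : 8 + 2 * `|K| < complex.Re u by rewrite /u raddfN /=; lra.
  have Ru := ler_Re_normc u; have hu := ler_normc_ReIm u.
  have Ru' : complex.Re u <= normc u by apply: le_trans Ru; exact: ler_norm.
  rewrite ger0_norm in hu; last lra.
  move=> h2; have {}h2 : normc (w - u) <= normc u / 4 by lra.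
  have hR := le_trans (ler_Re_normc _) h2; have hI := le_trans (ler_Im_normc _) h2.
  rewrite raddfB /= ler_norml in hR; rewrite raddfB /= in hI.
  have hI2 := ler_normD (complex.Im u - complex.Im w) (complex.Im w).
  rewrite subrK distrC in hI2.
  move: hR => /andP[hR _].
  split; first lra.
  have := ler_dist_normc u (u - w); rewrite (_ : u - (u - w) = w); last by ring.
  rewrite (normcB u); have := ler_norm K; lra.
- by move=> w; rewrite /rho lerDl divr_ge0 // normc_ge0.
- move=> w w'; rewrite /rho => h; have := ler_normcD (w - w') w'; have := normc_ge0 w'; rewrite subrK; lra.
- by move=> w /sector_slit sw; exact: cder_comp (cder_phi sw) (F_der _).
- move=> w /sector_slit sw; rewrite -[dk w]addr0; apply: cderD; last exact: cder_cst.
  by apply: cderD; [exact: cder_comp (cder_phi sw) (cder_poly _ _)|apply: cderZ; exact: cder_Log].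
- move=> e e0.
  have sXP : (size (P^`() * 'X)%R <= d1.+1)%N.
    by apply/leq_sizeP => -[|j] // hj; rewrite coefMX coef_deriv /= nth_default ?mul0rn // degP.
  have cXP : (P^`() * 'X)`_d1 = lP * dC.
    by rewrite coefMX eqn0Ngt d1_gt0 coef_deriv prednK // mulr_natr.
  have e1 : 0 < e / 2 * (normc dC * normc lP) by rewrite !mulr_gt0 // invr_gt0.
  have [K1 _ HK1] := poly_lead_asymptotic sXP e1.
  have [K2 HK2] := phi_large K1.
  exists (Num.max K2 (Num.max 1 (normc kap / (e / 2)))) => w Dw.
  have sw := sector_slit Dw; have w0 := slit_neq0 sw.
  have Nw : 0 < normc w by rewrite normc_gt0.
  case: Dw => _; rewrite !gt_max => /andP[w2 /andP[w1 w3]].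
  have := HK1 _ (ltW (HK2 _ sw w2)); rewrite cXP hornerM hornerX => h.
  have -> : dk w + 1 = ((P^`()).[phi w] * phi w - lP * dC * phi w ^+ d1) / (dC * w) + kap / w.
    have -> : lP * dC * phi w ^+ d1 = - (dC * w) by rewrite mulrAC phiX // mulNr mulrC.
    by rewrite /dk; field; rewrite w0 dC0.
  apply: (le_trans (ler_normcD _ _)).
  have h1 : normc (((P^`()).[phi w] * phi w - lP * dC * phi w ^+ d1) / (dC * w)) <= e / 2.
    rewrite Normc.normcM Normc.normcV Normc.normcM ler_pdivrMr ?mulr_gt0 //.
    by apply: (le_trans h); rewrite -(normc_phiX sw); lra.
  have h2 : normc (kap / w) <= e / 2.
    rewrite Normc.normcM Normc.normcV ler_pdivrMr // mulrC.
    by rewrite -ler_pdivrMr ?divr_gt0 // ltW.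
  lra.
- exact: asymdf.
- move=> e e0.
  have sP : (size P <= d1.+1)%N by rewrite degP.
  have e1 : 0 < normc lP * (e / 32) by rewrite mulr_gt0 // divr_gt0.
  have [K1 _ HK1] := poly_lead_asymptotic sP e1.
  have [K2 HK2] := phi_large K1.
  have Nk : 0 < normc kap + 1 by rewrite ltr_wpDl // normc_ge0.
  have [B B0 HB] := Log_growth (divr_gt0 (divr_gt0 e0 (ltr0Sn _ 31)) Nk).
  have [K3 HK3] : exists K3 : R, ((normc kap + 1) * B + normc c0) / (e / 32) = K3 by eexists.
  exists (Num.max K2 (Num.max 1 K3)) => w Dw.
  have sw := sector_slit Dw; case: Dw => _; rewrite !gt_max => /andP[w2 /andP[w1 w3]].
  have h := HK1 _ (ltW (HK2 _ sw w2)).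
  rewrite phiX // in h.
  have -> : k w + w = (P.[phi w] - - w) + (kap * Log w + c0) by rewrite /k; ring.
  apply: (le_trans (ler_normcD _ _)).
  have hP : normc (P.[phi w] - - w) <= e / 32 * normc w.
    by apply: (le_trans h); rewrite -(normc_phiX sw); lra.
  have hL : normc (kap * Log w) <= e / 32 * normc w + (normc kap + 1) * B.
    rewrite Normc.normcM; apply: (@le_trans _ _ ((normc kap + 1) * normc (Log w))).
      by rewrite ler_wpM2r ?normc_ge0 // lerDl.
    have := ler_wpM2l (ltW Nk) (HB w sw (ltW w1)).
    rewrite mulrDr mulrA mulrCA divff ?gt_eqF // mulr1; apply.
  have hc : (normc kap + 1) * B + normc c0 <= e / 32 * normc w.
    by rewrite [X in _ <= X]mulrC -ler_pdivrMr ?divr_gt0 // HK3 ltW.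
  have hr : e * rho w = e + 4 * (e / 32 * normc w) by rewrite /rho; field.
  have e32 : 0 <= e / 32 * normc w by rewrite mulr_ge0 ?normc_ge0 // divr_ge0 // ltW.
  rewrite hr; have := ler_normcD (kap * Log w) c0; lra.
move=> a [L [psi0 [K1 [s0 [E1 E2 E3 E4 [_ E6]]]]]].
have [K3 HK3] := E6.
have half0 : 0 < 1 / 2 :> R by rewrite divr_gt0.
have [Kq HKq] := asymdf _ half0.
have [K4 HK4] := phi_large KS.
have [M4 HM4] := E4 K4.
pose s1 := Num.min s0 M4.
have s10 s : complex.Re s < s1 -> complex.Re s < s0 /\ complex.Re s < M4.
  by rewrite lt_min => /andP.
exists a, s1, psi0; split.
- split.
  + move=> s /s10 [h1 h2]; have [D1 Ls cs] := E1 _ h1.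
    have sw := sector_slit D1.
    split.
    * by apply/HKS/HK4 => //; have [] := HM4 _ h1 h2.
    * by have := E2 _ D1; rewrite Ls => ->; rewrite addrC subrK.
    * move=> e e0; have [r1 r10 H1] := cder_cont (cder_phi sw) e0.
      by have [r2 r20 H2] := cs _ r10; exists r2 => // b /H2 /H1.
  + move=> s s' /s10 [h1 _] /s10 [h1' _].
    have [D1 Ls _] := E1 _ h1; have [D1' Ls' _] := E1 _ h1'.
    split=> [h|[n ->]]; last by rewrite mulr0n mul0r addr0.
    exists 0; rewrite mul0rn mul0r addr0 -Ls -Ls'.
    by rewrite (phi_inj (sector_slit D1) (sector_slit D1') h).
- by move=> s /s10 [h1 _]; have [/sector_slit] := E1 _ h1.
- move=> K; have [K' HK'] := phi_large K; have [M HM] := E4 K'.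
  exists M => s /s10 [h1 _] h2; have [h3 h4] := HM _ h1 h2.
  by apply: HK' => //; apply: sector_slit (conj h3 h4).
- move=> M; pose M' := Num.min s1 M.
  have Nd : 0 < normc dC * normc lP by rewrite mulr_gt0.
  (* |e^k| <= 2 |df| and |f - a| <= 3/2 |e^k| give |f - a| <= 3 |df|. The other factor converts |F'|
     |z|^(1-d1) into |df|. *)
  exists (expR M' / 3 * (normc dC * normc lP)), (Num.max K1 (Num.max K3 Kq)); split.
    by rewrite mulr_gt0 // divr_gt0 // expR_gt0.
  move=> w [w1]; rewrite !gt_max => /andP[w2 /andP[w3 w4]] hd.
  have Dw := conj w1 w2 : sector K1 w; have sw := sector_slit Dw.
  have Nw : 0 < normc w by rewrite normc_gt0 slit_neq0.
  have h1 := HK3 _ (conj w1 w3); have h2 := HKq _ (conj w1 w4).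
  have h3 : normc (df w) < expR M' / 3.
    have -> : df w = dF (phi w) * phi w / (dC * w) by rewrite /df mulrA.
    rewrite (Normc.normcM (dF (phi w) * phi w)) Normc.normcV (Normc.normcM dC).
    rewrite (Normc.normcM (dF (phi w))) ltr_pdivrMr ?mulr_gt0 //; apply: (lt_le_trans hd).
    by rewrite -(normc_phiX sw); lra.
  have h4 : normc (f w - a) < expR M'.
    have := ler_normcBD (df w + cexp (k w)) (df w).
    rewrite (_ : df w + cexp (k w) - df w = cexp (k w)); last by ring.
    have := ler_normcD (f w - a - cexp (k w)) (cexp (k w)); rewrite subrK; lra.
  have hL : complex.Re (L w) < M' by rewrite -ltr_expR -normc_cexp E2.
  have [hL1 hL2] : complex.Re (L w) < s1 /\ complex.Re (L w) < M.
    by move: hL; rewrite lt_min => /andP.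
  by exists (L w); split => //; rewrite E3 //; have [] := s10 _ hL1.
Qed.

End OneEnd.

(* Outside the sector the real part of [P] is bounded below by [|z| ^ d1] up to *)
(* a constant, so [F'] cannot be small there.                                   *)
Lemma derivative_large_off_sector (delta : R) : 0 < delta -> exists K : R, forall z,
  K < normc z -> complex.Re (- (lP * z ^+ d1)) + `|complex.Im (lP * z ^+ d1)| <= 0 ->
  delta * normc z ^+ d1 <= normc (dF z) * normc z.
Proof.
move=> delta0; have lP0 : lP != 0 := lead_neq0 degP; have lQ0 : lQ != 0 := lead_neq0 degQ.
have NlP : 0 < normc lP by rewrite normc_gt0.
have NlQ : 0 < normc lQ by rewrite normc_gt0.
have sP : (size P <= d1.+1)%N by rewrite degP.
have [K1 K11 HK1] := poly_lead_asymptotic sP (divr_gt0 NlP (ltr0Sn _ 3)).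
have [K2 K21 HK2] := poly_large degQ.
pose c := normc lQ / 2 * (normc lP / 4).
have c0 : 0 < c by rewrite mulr_gt0 // divr_gt0.
exists (Num.max K1 (Num.max K2 (delta / c))) => z.
rewrite !gt_max => /andP[/ltW z1 /andP[/ltW z2 z3]] hs.
have h1 := HK1 _ z1; have h2 := HK2 _ z2.
have Nz : 1 <= normc z by lra.
set u := lP * z ^+ d1 in hs h1.
have Nu : normc u = normc lP * normc z ^+ d1 by rewrite /u Normc.normcM normcX.
have hu := ler_normc_ReIm u.
rewrite raddfN /= in hs.
have Ru : normc u / 2 <= complex.Re u.
  have i0 := normr_ge0 (complex.Im u); rewrite ger0_norm in hu; lra.
have h3 : normc u / 4 <= complex.Re P.[z].
  have := le_trans (ler_Re_normc _) h1; rewrite raddfB /= ler_norml => /andP[h _]; lra.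
have h4 : normc u / 4 <= expR (complex.Re P.[z]).
  apply: (le_trans h3); have := expR_ge1Dx (complex.Re P.[z]); lra.
rewrite Normc.normcM normc_cexp.
have zd : 1 <= normc z ^+ d2 by rewrite exprn_ege1.
have zd1 : 0 < normc z ^+ d1 by rewrite exprn_gt0 //; lra.
have h5 : normc lQ / 2 * normc z ^+ d2 * (normc u / 4) <= normc Q.[z] * expR (complex.Re P.[z]).
  apply: ler_pM => //; first by rewrite mulr_ge0 ?divr_ge0 ?exprn_ge0 ?normc_ge0.
  by rewrite divr_ge0 // normc_ge0.
have h6 : delta <= c * normc z by rewrite mulrC -ler_pdivrMr // ltW.
apply: (le_trans (ler_wpM2r (ltW zd1) h6)).
have Nz0 : 0 <= normc z by lra.
apply: le_trans (ler_wpM2r Nz0 h5).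
rewrite Nu /c.
have X0 : 0 <= normc lQ / 2 * (normc lP / 4) * (normc z * normc z ^+ d1).
  by rewrite !mulr_ge0 // ltW.
have := ler_peMr X0 zd; lra.
Qed.

End EndChart.

(** * The d1 ends together *)

Section AllEnds.
Variable R : realType.
Local Notation C := R[i].
Local Notation cexp := (@cexpi R).
Local Notation tpi := (@ctwopi_i R).

Lemma finite_upper_bound n (u : 'I_n -> R) : exists B, forall j, u j <= B.
Proof.
exists (\sum_j `|u j|) => j; rewrite (bigD1 j) //=.
apply: (le_trans (ler_norm _)); rewrite lerDl; exact: sumr_ge0.
Qed.

Lemma tpi_neq0 : tpi != 0.
Proof. by rewrite eq_complex /= eqxx /= gt_eqF // pmulrn_lgt0 // pi_gt0. Qed.

Lemma root_family (c : C) (d : nat) : c != 0 -> (0 < d)%N ->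
  exists lam : 'I_d -> C, [/\ forall j, lam j ^+ d = c, injective lam &
    forall x, x ^+ d = c -> exists j, x = lam j].
Proof.
move=> c0 d0; have dC0 : (d%:R : C) != 0 by rewrite pnatr_eq0 -lt0n.
have [cl hcl] := cexp_surj c0.
have t0 := tpi_neq0.
pose lam (j : 'I_d) := cexp ((cl + j%:R * tpi) / d%:R).
exists lam; split.
- move=> j; rewrite /lam -cexpMn mulrC divfK //.
  by have := cexp_periodic cl j; rewrite hcl.
- move=> j j' /cexp_eq [n hn]; apply/val_inj => /=.
  have h : (j%:R : C) = j'%:R + n%:~R * d%:R.
    apply: (mulIf t0); apply: (addrI cl).
    rewrite -[LHS](divfK dC0) hn; field; exact: dC0.
  have {}h : (j : int) = (j' : int) + n * (d : int).
    by apply: (@intr_inj C); rewrite rmorphD rmorphM.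
  have := ltn_ord j; have := ltn_ord j'; move: (nat_of_ord j) (nat_of_ord j') h.
  move=> a b h ha hb.
  have : ((a%:Z %% d)%Z = (b%:Z %% d)%Z) by rewrite h addrC modzMDl.
  by rewrite !modz_small ?ltz_nat ?lez_nat // => -[].
- move=> x hx.
  have x0 : x != 0 by apply: contraNneq c0 => x0; rewrite -hx x0 expr0n eqn0Ngt d0.
  have [u hu] := cexp_surj x0.
  have [n hn] : exists n : int, d%:R * u = cl + n%:~R * tpi.
    by apply: cexp_eq; rewrite cexpMn hu hx hcl.
  have dz : (d : int) != 0 by move: d0; case: (d).
  have jlt : (`|(n %% d)%Z| < d)%N.
    by rewrite -ltz_nat gez0_abs ?modz_ge0 // ltz_pmod.
  exists (Ordinal jlt); rewrite /lam -(cexp_periodic (_ / _) (n %/ d)%Z) -hu; congr cexp.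
  have -> : (Ordinal jlt)%:R = ((n %% d)%Z)%:~R :> C.
    by rewrite -[in RHS](gez0_abs (modz_ge0 n dz)).
  apply: (mulfI dC0); rewrite hn.
  rewrite {1}(divz_eq n d) rmorphD rmorphM /=; field; exact: dC0.
Qed.

Variables (P Q : {poly C}) (d1 d2 : nat).
Hypothesis degP : size P = d1.+1.
Hypothesis degQ : size Q = d2.+1.
Variable F : C -> C.
Hypothesis F_der : forall z, cder F z (Q.[z] * cexp P.[z]).
Local Notation dF z := (Q.[z] * cexp P.[z]).

(** The ends correspond to the roots lam of lam^d1 = -1/lP. If F' is small at a point z far out,
    then w = -lP z^d1 lies in the sector and z divided by the principal root of w is one of the lam.
    Since z determines w, it determines lam, so distinct ends are disjoint. *)
Theorem poly_exp_ends : exists (a : 'I_d1 -> C) (s0 : 'I_d1 -> R) (psi : 'I_d1 -> C -> C),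
  [/\ forall j, log_chart F (fun z => Q.[z] != 0) (a j) 0 (s0 j) (psi j),
      forall j K, exists M, forall s, complex.Re s < s0 j -> complex.Re s < M -> K < normc (psi j s),
      forall j j' s s', complex.Re s < s0 j -> complex.Re s' < s0 j' ->
        psi j s = psi j' s' -> j = j' &
      forall M : R, exists delta K : R, 0 < delta /\ forall z, K < normc z ->
        normc (dF z) * normc z < delta * normc z ^+ d1 ->
        exists j s, [/\ complex.Re s < s0 j, complex.Re s < M & psi j s = z]].
Proof.
have lQ0 : Q`_d2 != 0 := lead_neq0 degQ; have lP0 : P`_d1 != 0 := lead_neq0 degP.
have NlQ : 0 < normc Q`_d2 by rewrite normc_gt0.
have [KQ KQ1 HKQ] := poly_large degQ.
have SQ : exists K : R, forall z, K < normc z -> Q.[z] != 0.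
  exists KQ => z /ltW h; have h2 := HKQ z h.
  rewrite -normc_gt0; apply: lt_le_trans h2.
  by rewrite mulr_gt0 ?divr_gt0 // exprn_gt0 //; lra.
(* For d1 = 0 there are no ends: F' is a nonzero multiple of [Q], and |F' z| |z| is bounded below
   far out, so the last clause is vacuous. *)
case: (posnP d1) => [d10|d10].
  exists (fun=> 0), (fun=> 0), (fun=> id); split; try by move=> [j hj]; exfalso; rewrite d10 in hj.
  move=> M; pose c := normc Q`_d2 / 2 * expR (complex.Re P`_0).
  have c0 : 0 < c by rewrite mulr_gt0 ?divr_gt0 ?expR_gt0.
  exists c, KQ; split => // z /ltW Kz; rewrite d10 expr0 mulr1 => h; exfalso.
  have := HKQ z Kz; rewrite Normc.normcM normc_cexp in h.
  have PE : P.[z] = P`_0.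
    have sP : (size P <= 1)%N by rewrite degP d10.
    by rewrite (size1_polyC sP) hornerC coefC.
  rewrite PE in h.
  have z1 : 1 <= normc z by lra.
  have z2 : 1 <= normc z ^+ d2 by rewrite exprn_ege1.
  move=> h2; move: h; rewrite ltNge => /negP; apply.
  have h3 : c <= normc Q.[z] * expR (complex.Re P`_0).
    rewrite /c ler_pM2r ?expR_gt0 //; apply: le_trans h2.
    by rewrite ler_peMr // divr_ge0 // normc_ge0.
  by apply: (le_trans h3); rewrite ler_peMr // mulr_ge0 ?normc_ge0 ?expR_ge0.
have [lam [L1 L2 L3]] : exists lam : 'I_d1 -> C, [/\ forall j, lam j ^+ d1 = - (P`_d1)^-1,
    injective lam & forall x, x ^+ d1 = - (P`_d1)^-1 -> exists j, x = lam j].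
  by apply: root_family; rewrite ?oppr_eq0 ?invr_eq0.
have lamE j : lam j ^+ d1 * P`_d1 = -1 by rewrite L1 mulNr mulVf.
have chart j : exists t : C * R * (C -> C), let psi s := lam j * croot d1 (t.2 s) in
  [/\ log_chart F (fun z => Q.[z] != 0) t.1.1 0 t.1.2 psi,
      forall s, complex.Re s < t.1.2 -> slit (t.2 s),
      forall K : R, exists M, forall s, complex.Re s < t.1.2 -> complex.Re s < M -> K < normc (psi s) &
      forall M : R, exists delta K : R, 0 < delta /\ forall w, sector K w ->
        normc (dF (lam j * croot d1 w)) * normc (lam j * croot d1 w) <
          delta * normc (lam j * croot d1 w) ^+ d1 ->
        exists s, [/\ complex.Re s < t.1.2, complex.Re s < M & psi s = lam j * croot d1 w]].
  have [a [s0 [psi0 H]]] := end_log_chart degP degQ F_der d10 (lamE j) SQ.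
  by exists (a, s0, psi0).
have [t Ht] := choice chart.
exists (fun j => (t j).1.1), (fun j => (t j).1.2), (fun j s => lam j * croot d1 ((t j).2 s)).
split.
- by move=> j; have [] := Ht j.
- by move=> j; have [] := Ht j.
- move=> j j' s s' hs hs' e.
  have [_ /(_ _ hs) sw _ _] := Ht j; have [_ /(_ _ hs') sw' _ _] := Ht j'.
  have ew : (t j).2 s = (t j').2 s'.
    apply: oppr_inj.
    by rewrite -(phiX d10 (lamE j) sw) -(phiX d10 (lamE j') sw') e.
  by move: e; rewrite ew => /(mulIf (croot_neq0 d1 _)) /L2.
- move=> M.
  have dk j : exists x : R * R, 0 < x.1 /\ forall w, sector x.2 w ->
        normc (dF (lam j * croot d1 w)) * normc (lam j * croot d1 w) <
          x.1 * normc (lam j * croot d1 w) ^+ d1 ->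
        exists s, [/\ complex.Re s < (t j).1.2, complex.Re s < M &
          lam j * croot d1 ((t j).2 s) = lam j * croot d1 w].
    by have [_ _ _ /(_ M) [de [K H]]] := Ht j; exists (de, K).
  have [x Hx] := choice dk.
  have [B HB] := finite_upper_bound (fun j => (x j).1^-1).
  have [K HK] := finite_upper_bound (fun j => (x j).2).
  (* A positive lower bound for the finitely many thresholds [(x j).1]. *)
  pose delta := (`|B| + 1)^-1.
  have B1 : 0 < `|B| + 1 by rewrite ltr_wpDl.
  have dl j : delta <= (x j).1.
    have [x0 _] := Hx j.
    rewrite /delta -[X in _ <= X]invrK lef_pV2 ?posrE ?invr_gt0 //.
    by apply: (le_trans (HB j)); have := ler_norm B; lra.
  have delta0 : 0 < delta by rewrite invr_gt0.
  have [K' HK'] := derivative_large_off_sector degP degQ delta0.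
  exists delta, (Num.max K' (Num.max 1 (`|K| / normc P`_d1))); split => // z.
  rewrite !gt_max => /andP[zK' /andP[z1 zK]] hz.
  pose w := - (P`_d1 * z ^+ d1).
  have NlP : 0 < normc P`_d1 by rewrite normc_gt0.
  have sec j : sector (x j).2 w.
    split.
      rewrite ltNge; apply/negP; rewrite /w (raddfN (@complex.Im R)) normrN => /(HK' z zK').
      by rewrite leNgt hz.
    rewrite /w normcN Normc.normcM normcX.
    apply: (le_lt_trans (HK j)); apply: (le_lt_trans (ler_norm K)).
    rewrite mulrC -ltr_pdivrMr //; apply: (lt_le_trans zK).
    by rewrite -[X in X <= _]expr1 normcX_le // ltW.
  have sw : slit w := sector_slit (sec (Ordinal d10)).
  have [j hj] : exists j, z / croot d1 w = lam j.
    apply: L3; rewrite expr_div_n (crootK d10 sw) /w invrN mulrN invfM.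
    have z0 : z ^+ d1 != 0 by rewrite expf_neq0 // -normc_gt0; lra.
    by rewrite mulrCA divff // mulr1.
  have zE : lam j * croot d1 w = z by rewrite -hj divfK // croot_neq0.
  have [x0 /(_ w (sec j))] := Hx j.
  rewrite zE => H; have [|s hs] := H; last by exists j, s.
  apply: (lt_le_trans hz); rewrite ler_wpM2r ?exprn_ge0 ?normc_ge0 //.
Qed.

End AllEnds.

(** * The metric completion *)

Section Paths.
Variable R : realType.
Local Notation C := R[i].
Implicit Types (x z : C) (c e : R).
Variables (F : C -> C) (S : C -> Prop).

Definition cpath (g : R -> C) := forall t : R, 0 <= t -> t <= 1 -> S (g t) /\
  forall e, 0 < e -> exists2 r : R, 0 < r &
    forall u, 0 <= u -> u <= 1 -> `|u - t| < r -> normc (g u - g t) < e.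

(* [v] bounds the length of [F \o g]: the infimum of [v 1 - v 0] is its total variation. *)
Definition controls (v : R -> R) (g : R -> C) := forall t u : R,
  0 <= t -> t <= u -> u <= 1 -> normc (F (g u) - F (g t)) <= v u - v t.

(** Carrying the bound [v] in place of the total variation makes reversal and concatenation of paths
    elementary. *)
Definition joined c x z := exists (g : R -> C) (v : R -> R),
  [/\ cpath g, controls v g, g 0 = x, g 1 = z & v 1 - v 0 <= c].

Lemma joined_le c c' x z : c <= c' -> joined c x z -> joined c' x z.
Proof. by move=> cc' [g [v [h1 h2 h3 h4 h5]]]; exists g, v; split => //; apply: le_trans cc'. Qed.

Lemma joined_ge0 c x z : joined c x z -> 0 <= c.
Proof.
move=> [g [v [_ h _ _ h5]]]; apply: le_trans h5.
by apply: le_trans (h 0 1 _ _ _) => //; exact: normc_ge0.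
Qed.

Lemma joined_refl x : S x -> joined 0 x x.
Proof.
move=> Sx; exists (fun=> x), (fun=> 0); split=> //=; rewrite ?subrr //.
  move=> t t0 t1; split => // e e0; exists 1 => // u _ _ _.
  by rewrite subrr Normc.normc0.
by move=> t u _ _ _; rewrite !subrr Normc.normc0.
Qed.

Lemma joined_sym c x z : joined c x z -> joined c z x.
Proof.
move=> [g [v [h1 h2 h3 h4 h5]]]; exists (fun t => g (1 - t)), (fun t => - v (1 - t)).
split; rewrite ?subr0 ?subrr //.
- move=> t t0 t1; have [h6 h7] := h1 (1 - t) ltac:(lra) ltac:(lra).
  split => // e /h7 [r r0 Hr]; exists r => // u u0 u1 ut; apply: Hr; try lra.
  by rewrite (_ : 1 - u - (1 - t) = t - u) 1?distrC //; ring.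
- move=> t u t0 tu u1; rewrite normcB.
  have -> : - v (1 - u) - - v (1 - t) = v (1 - t) - v (1 - u) by ring.
  by apply: h2; lra.
- lra.
Qed.

Lemma joined_trans c c' x y z : joined c x y -> joined c' y z -> joined (c + c') x z.
Proof.
move=> [g [v [g1 g2 g3 g4 g5]]] [h [w [h1 h2 h3 h4 h5]]].
pose gam (t : R) := if t <= 1 / 2 then g (2 * t) else h (2 * t - 1).
pose V (t : R) := if t <= 1 / 2 then v (2 * t) else v 1 - w 0 + w (2 * t - 1).
have half : 2 * (1 / 2) = 1 :> R by field.
exists gam, V; split.
- move=> t t0 t1; rewrite /gam; split.
    have [th|th] := leP t (1 / 2).
      by have [] := g1 (2 * t) ltac:(lra) ltac:(lra).
    by have [] := h1 (2 * t - 1) ltac:(lra) ltac:(lra).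
  move=> e e0.
  have gh : 1 / 2 = t -> g (2 * t) = h 0 by move=> <-; rewrite half h3.
  have [th|th|th] := ltgtP t (1 / 2).
  + have [_ /(_ e e0) [r r0 Hr]] := g1 (2 * t) ltac:(lra) ltac:(lra).
    exists (Num.min (r / 2) (1 / 2 - t)); first by rewrite lt_min subr_gt0 th divr_gt0.
    move=> u u0 u1; rewrite lt_min => /andP[hu1 hu2].
    have := ler_norm (u - t) => hu3.
    rewrite (_ : (u <= 1 / 2) = true); last by lra.
    apply: Hr; try lra.
    by rewrite -mulrBr normrM ger0_norm //; lra.
  + have [_ /(_ e e0) [r r0 Hr]] := h1 (2 * t - 1) ltac:(lra) ltac:(lra).
    exists (Num.min (r / 2) (t - 1 / 2)); first by rewrite lt_min subr_gt0 th divr_gt0.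
    move=> u u0 u1; rewrite lt_min => /andP[hu1 hu2].
    have := ler_norm (t - u); rewrite distrC => hu3.
    rewrite (_ : (u <= 1 / 2) = false); last by apply/negbTE; rewrite -ltNge; lra.
    apply: Hr; try lra.
    by rewrite (_ : 2 * u - 1 - (2 * t - 1) = 2 * (u - t)); [rewrite normrM ger0_norm //; lra|ring].
  + have [_ /(_ e e0) [r r0 Hr]] := g1 (2 * t) ltac:(lra) ltac:(lra).
    have [_ /(_ e e0) [s s0 Hs]] := h1 (2 * t - 1) ltac:(lra) ltac:(lra).
    exists (Num.min (r / 2) (s / 2)); first by rewrite lt_min !divr_gt0.
    move=> u u0 u1; rewrite lt_min => /andP[hu1 hu2].
    have [uh|uh] := leP u (1 / 2).
      apply: Hr; try lra.
      by rewrite -mulrBr normrM ger0_norm //; lra.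
    rewrite gh ?th // -(_ : 2 * t - 1 = 0); last lra.
    apply: Hs; try lra.
    by rewrite (_ : 2 * u - 1 - (2 * t - 1) = 2 * (u - t)); [rewrite normrM ger0_norm //; lra|ring].
- move=> t u t0 tu u1; rewrite /gam /V.
  have [uh|uh] := leP u (1 / 2); have [th|th] := leP t (1 / 2).
  + by apply: g2; lra.
  + by exfalso; move: uh th tu; lra.
  + have A : normc (F (g 1) - F (g (2 * t))) <= v 1 - v (2 * t) by apply: g2; lra.
    have B : normc (F (h (2 * u - 1)) - F (h 0)) <= w (2 * u - 1) - w 0 by apply: h2; lra.
    have := ler_normc_dist (F (h (2 * u - 1))) (F (g 1)) (F (g (2 * t))).
    rewrite -h3 in g4; rewrite -g4 in B; lra.
  + have -> : v 1 - w 0 + w (2 * u - 1) - (v 1 - w 0 + w (2 * t - 1)) = w (2 * u - 1) - w (2 * t - 1) by ring.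
    by apply: h2; lra.
- by rewrite /gam ifT ?mulr0 //; lra.
- rewrite /gam ifF; last by apply/negbTE; rewrite -ltNge; lra.
  by rewrite -h4; congr h; ring.
- rewrite /V ifF; last by apply/negbTE; rewrite -ltNge; lra.
  rewrite ifT; last lra.
  rewrite mulr0 (_ : 2 * 1 - 1 = 1); last by ring.
  lra.
Qed.

Lemma joined_lipschitz (g : R -> C) L : cpath g ->
  (forall t u : R, 0 <= t -> t <= u -> u <= 1 -> normc (F (g u) - F (g t)) <= L * (u - t)) ->
  joined L (g 0) (g 1).
Proof.
move=> g1 g2; exists g, (fun t => L * t); split => //.
- by move=> t u t0 tu u1; rewrite -mulrBr; exact: g2.
- by rewrite mulr1 mulr0 subr0.
Qed.

Lemma joined_dist c x z : joined c x z -> normc (F z - F x) <= c.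
Proof. by move=> [g [v [_ h <- <- h5]]]; apply: le_trans h5; apply: h. Qed.

Hypothesis S_open : forall x, S x -> exists2 r : R, 0 < r & forall z, normc (z - x) < r -> S z.
Hypothesis F_cont : forall x, ccont F x.
Hypothesis F_inj : forall x, S x -> exists2 r : R, 0 < r &
  forall z z', normc (z - x) < r -> normc (z' - x) < r -> F z = F z' -> z = z'.
Hypothesis F_lip : forall B, exists2 L : R, 0 <= L &
  forall z w, normc z <= B -> normc w <= B -> normc (F z - F w) <= L * normc (z - w).

(** Two lifts of the path F o g with the same origin: local injectivity of [F] and continuity make
    the set of times at which they agree open and closed. *)
Lemma unique_lift (g : R -> C) (h : C -> C) : cpath g ->
  (forall t : R, 0 <= t -> t <= 1 -> F (h (F (g t))) = F (g t) /\ ccont h (F (g t))) ->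
  h (F (g 0)) = g 0 -> forall t : R, 0 <= t -> t <= 1 -> h (F (g t)) = g t.
Proof.
move=> gp hh h0; apply: interval_clopen => // t t0 t1.
have [Sg gc] := gp t t0 t1; have [Fh hc] := hh t t0 t1.
have comp e : 0 < e -> exists2 r : R, 0 < r & forall u, 0 <= u -> u <= 1 -> `|u - t| < r ->
    normc (h (F (g u)) - h (F (g t))) < e.
  move=> /hc [r1 r10 H1]; have [r2 r20 H2] := F_cont (g t) r10.
  have [r3 r30 H3] := gc _ r20; exists r3 => // u u0 u1 ut.
  by apply/H1/H2/H3.
have [E|E] := eqVneq (h (F (g t))) (g t).
- have [r r0 Hr] := F_inj Sg.
  have [r1 r10 H1] := comp _ r0; have [r2 r20 H2] := gc _ r0.
  exists (Num.min r1 r2); first by rewrite lt_min r10.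
  move=> u u0 u1; rewrite lt_min => /andP[ut1 ut2]; split => // _.
  apply: Hr; [by rewrite -{1}E; exact: H1|exact: H2|].
  by have [] := hh u u0 u1.
- pose e := normc (h (F (g t)) - g t) / 2.
  have e0 : 0 < e by rewrite divr_gt0 // normc_gt0 subr_eq0.
  have [r1 r10 H1] := comp _ e0; have [r2 r20 H2] := gc _ e0.
  exists (Num.min r1 r2); first by rewrite lt_min r10.
  move=> u u0 u1; rewrite lt_min => /andP[ut1 ut2]; split => [E'|E']; last by move: E; rewrite E' eqxx.
  exfalso; have := H1 u u0 u1 ut1; have := H2 u u0 u1 ut2; rewrite E' => k1 k2.
  have := ler_normc_dist (h (F (g t))) (g u) (g t); rewrite (normcB _ (g u)).
  rewrite /e in k1 k2; lra.
Qed.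

Lemma segment_cpath x z : (forall t : R, 0 <= t -> t <= 1 -> S (x + t%:C * (z - x))) ->
  cpath (fun t => x + t%:C * (z - x)).
Proof.
move=> h t t0 t1; split; first exact: h.
have N1 : 0 < normc (z - x) + 1 by rewrite ltr_wpDl // normc_ge0.
move=> e e0; exists (e / (normc (z - x) + 1)); first by rewrite divr_gt0.
move=> u _ _; rewrite ltr_pdivlMr // => hu.
have -> : x + u%:C * (z - x) - (x + t%:C * (z - x)) = (u - t)%:C * (z - x).
  by rewrite rmorphB; ring.
rewrite Normc.normcM normcZ; apply: le_lt_trans hu.
by rewrite ler_wpM2l // lerDl.
Qed.

Lemma segment_in_ball x z w r (t : R) : 0 <= t -> t <= 1 ->
  normc (z - x) < r -> normc (w - x) < r -> normc (z + t%:C * (w - z) - x) < r.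
Proof.
move=> t0 t1 h0 h1.
have -> : z + t%:C * (w - z) - x = (1 - t)%:C * (z - x) + t%:C * (w - x).
  by rewrite rmorphB rmorph1; ring.
apply: (le_lt_trans (ler_normcD _ _)); rewrite !Normc.normcM !normcZ.
rewrite !ger0_norm ?subr_ge0 //.
have [t10|t10] := eqVneq t 0; first by rewrite t10; lra.
have tp : 0 < t by rewrite lt_neqAle eq_sym t10.
have := normc_ge0 (z - x); nra.
Qed.

Lemma joined_local x : S x -> exists r L : R, [/\ 0 < r, 0 <= L &
  forall z w, normc (z - x) < r -> normc (w - x) < r -> joined (L * normc (w - z)) z w].
Proof.
move=> Sx; have [r r0 Hr] := S_open Sx; have [L L0 HL] := F_lip (normc x + r).
exists r, L; split => // z w hz hw.
have seg (t : R) : 0 <= t -> t <= 1 -> normc (z + t%:C * (w - z) - x) < r.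
  by move=> t0 t1; exact: segment_in_ball.
have sp : cpath (fun t => z + t%:C * (w - z)) by apply: segment_cpath => t t0 t1; apply/Hr/seg.
have bd y : normc (y - x) < r -> normc y <= normc x + r.
  by move=> h; have := ler_normcD (y - x) x; rewrite subrK; lra.
have := @joined_lipschitz _ (L * normc (w - z)) sp.
have -> : z + 0%:C * (w - z) = z by rewrite mul0r addr0.
have -> : z + 1%:C * (w - z) = w by rewrite mul1r addrC subrK.
apply => t u t0 tu u1.
have t1 : t <= 1 by lra.
have u0 : 0 <= u by lra.
apply: (le_trans (HL _ _ (bd _ (seg _ u0 u1)) (bd _ (seg _ t0 t1)))).
have -> : z + u%:C * (w - z) - (z + t%:C * (w - z)) = (u - t)%:C * (w - z).
  by rewrite rmorphB; ring.
by rewrite Normc.normcM normcZ ger0_norm ?subr_ge0 // [X in _ * X]mulrC mulrA.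
Qed.

(* The arcs [t + i k t (1 - t)], [k] real, between two points are disjoint, so *)
(* some arc avoids a given finite set.                                         *)
Lemma joined_cofinite (Z : seq C) : (forall z, z \notin Z -> S z) ->
  (forall z, S z -> z \notin Z) ->
  forall x y, S x -> S y -> exists c, joined c x y.
Proof.
move=> ZS SZ x y Sx Sy.
have [<-|xy] := eqVneq x y; first by exists 0; exact: joined_refl.
have yx0 : y - x != 0 by rewrite subr_eq0 eq_sym.
pose zeta z := (z - x) / (y - x).
(* [zeta] takes x to 0 and y to 1; [kz z] is the parameter of the arc through z, and [k] exceeds the
   parameters of all the points of [Z]. *)
pose kz z := complex.Im (zeta z) / (complex.Re (zeta z) * (1 - complex.Re (zeta z))).
pose k := 1 + \sum_(z <- Z) `|kz z|.
have kZ z : z \in Z -> kz z < k.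
  move=> zZ; rewrite /k (big_rem z) //=; have := ler_norm (kz z).
  have : 0 <= \sum_(y <- rem z Z) `|kz y| by apply: sumr_ge0.
  lra.
pose q (t : R) : C := t +i* (k * (t * (1 - t))).
pose g (t : R) := x + (y - x) * q t.
have k0 : 0 <= k by rewrite addr_ge0 // sumr_ge0.
have q_lip (t u : R) : 0 <= t -> t <= 1 -> 0 <= u -> u <= 1 -> normc (q u - q t) <= (1 + k) * `|u - t|.
  move=> t0 t1 u0 u1; apply: (le_trans (ler_normc_ReIm _)); rewrite /q /=.
  have -> : k * (u * (1 - u)) - k * (t * (1 - t)) = k * ((u - t) * (1 - u - t)) by ring.
  have -> : (1 + k) * `|u - t| = `|u - t| + k * `|u - t| by ring.
  rewrite lerD2l !normrM (ger0_norm k0) ler_wpM2l // ler_piMr //.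
  by rewrite ler_norml; lra.
have g_lip (t u : R) : 0 <= t -> t <= 1 -> 0 <= u -> u <= 1 ->
    normc (g u - g t) <= normc (y - x) * ((1 + k) * `|u - t|).
  move=> *; have -> : g u - g t = (y - x) * (q u - q t) by rewrite /g; ring.
  by rewrite Normc.normcM ler_wpM2l ?normc_ge0 // q_lip.
have g0 : g 0 = x by rewrite /g /q mul0r mulr0 mulr0 addr0.
have g1 : g 1 = y by rewrite /g /q subrr mulr0 mulr0 mulr1 addrC subrK.
have gS (t : R) : 0 <= t -> t <= 1 -> S (g t).
  move=> t0 t1.
  have [->|tn0] := eqVneq t 0; first by rewrite g0.
  have [->|tn1] := eqVneq t 1; first by rewrite g1.
  apply: ZS; apply/negP => /kZ.
  have -> : kz (g t) = k; last by rewrite ltxx.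
  have zg : zeta (g t) = q t by rewrite /zeta /g addrAC subrr add0r mulrC mulKf.
  have t10 : 1 - t != 0 by rewrite subr_eq0 eq_sym.
  by rewrite /kz zg /=; field; rewrite tn0 t10.
have gp : cpath g.
  move=> t t0 t1; split; first exact: gS.
  have N1 : 0 < normc (y - x) * (1 + k) by rewrite mulr_gt0 ?normc_gt0 //; lra.
  move=> e e0; exists (e / (normc (y - x) * (1 + k))); first by rewrite divr_gt0.
  move=> u u0 u1; rewrite ltr_pdivlMr // => hu.
  apply: (le_lt_trans (g_lip _ _ t0 t1 u0 u1)); lra.
pose B := normc x + normc (y - x) * (1 + k).
have gB (t : R) : 0 <= t -> t <= 1 -> normc (g t) <= B.
  move=> t0 t1; have := g_lip 0 t (lexx _) ler01 t0 t1.
  rewrite g0 subr0 ger0_norm // => h.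
  have := ler_normcD (g t - x) x; rewrite subrK /B => h2.
  have : normc (y - x) * ((1 + k) * t) <= normc (y - x) * (1 + k).
    by rewrite mulrA ler_piMr // mulr_ge0 ?normc_ge0 //; lra.
  lra.
have [L L0 HL] := F_lip B.
exists (L * (normc (y - x) * (1 + k))).
suff : joined (L * (normc (y - x) * (1 + k))) (g 0) (g 1) by rewrite g0 g1.
apply: joined_lipschitz => // t u t0 tu u1.
have t1 : t <= 1 by lra.
have u0 : 0 <= u by lra.
apply: (le_trans (HL _ _ (gB _ u0 u1) (gB _ t0 t1))).
rewrite -mulrA ler_wpM2l //; apply: (le_trans (g_lip _ _ t0 t1 u0 u1)).
by rewrite (ger0_norm (_ : 0 <= u - t)) ?subr_ge0 // !mulrA.
Qed.

End Paths.

(** * Cluster points of bounded sequences *)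

Section BoundedCluster.
Variable R : realType.
Local Notation C := R[i].

Lemma ccont_comp (f g : C -> C) z : ccont f z -> ccont g (f z) -> ccont (fun w => g (f w)) z.
Proof.
move=> fc gc e /gc [r r0 Hr]; have [s s0 Hs] := fc _ r0.
by exists s => // w /Hs /Hr.
Qed.

Lemma bounded_cluster (x : nat -> C) (B : R) :
  (forall N, exists2 n, (N <= n)%N & normc (x n) <= B) ->
  exists z, forall e, 0 < e -> forall N, exists2 n, (N <= n)%N & normc (x n - z) < e.
Proof.
move=> H.
pose A (N : nat) : set (R * R) := [set p | exists n, [/\ (N <= n)%N, normc (x n) <= B &
  p = (complex.Re (x n), complex.Im (x n))]].
pose G := filter_from [set: nat] A.
have GF : ProperFilter G.
  apply: filter_from_proper; last first.
    by move=> N _; have [n n1 n2] := H N; exists (complex.Re (x n), complex.Im (x n)), n.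
  apply: filter_from_filter; first by exists 0%N.
  move=> i j _ _; exists (maxn i j) => // p [n [n1 n2 ->]]; move: n1; rewrite geq_max => /andP[? ?].
  by split; exists n.
have K : compact (`[- B, B] `*` `[- B, B] : set (R * R)).
  by apply: compact_setX; exact: segment_compact.
have GK : G (`[- B, B] `*` `[- B, B]).
  exists 0%N => // p [n [_ n2 ->]]; split => /=; rewrite in_itv /= -ler_norml.
    exact: le_trans (ler_Re_normc _) n2.
  exact: le_trans (ler_Im_normc _) n2.
have [[u v] [_ cl]] := K G GF GK.
exists (u +i* v) => e e0 N.
have e2 : 0 < e / 2 by rewrite divr_gt0.
have nb : nbhs (u, v) (ball u (e / 2) `*` ball v (e / 2)).
  by exists (ball u (e / 2), ball v (e / 2)) => //; split; exact: nbhsx_ballx.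
have GA : G (A N) by exists N.
have [p [[n [n1 n2 ->]] [/= h1 h2]]] := cl _ _ GA nb.
exists n => //; apply: (le_lt_trans (ler_normc_ReIm _)); rewrite !raddfB /=.
rewrite /ball /= distrC in h1; rewrite /ball /= distrC in h2; lra.
Qed.

End BoundedCluster.

(* The data of the completion: the complement of the finite set [es_sing]      *)
(* with the metric [|F'| |dz|] is completed by [es_sing] (points [inl p]) and  *)
(* by [es_ends] further points [inr j]; [es_psi y] is a logarithmic chart at   *)
(* [y] (for every [p], singular or not).                                       *)
Record end_system (R : realType) := EndSystem {
  es_F : R[i] -> R[i];
  es_dF : R[i] -> R[i];
  es_sing : seq R[i];
  es_ends : nat;
  es_a : R[i] + 'I_es_ends -> R[i];
  es_m : R[i] + 'I_es_ends -> nat;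
  es_s0 : R[i] + 'I_es_ends -> R;
  es_psi : R[i] + 'I_es_ends -> R[i] -> R[i];
  es_F_der : forall z, cder es_F z (es_dF z);
  es_dF_cont : forall z, ccont es_dF z;
  es_dF_neq0 : forall z, z \notin es_sing -> es_dF z != 0;
  es_F_lip : forall B : R, exists2 L : R, 0 <= L & forall z w,
    normc z <= B -> normc w <= B -> normc (es_F z - es_F w) <= L * normc (z - w);
  es_chart : forall y,
    log_chart es_F (fun z => z \notin es_sing) (es_a y) (es_m y) (es_s0 y) (es_psi y);
  es_a_inl : forall p, es_a (inl p) = es_F p;
  es_m_inl : forall p, (0 < es_m (inl p))%N;
  es_m_inr : forall j, es_m (inr j) = 0%N;
  es_inl_cvg : forall p e, 0 < e -> exists M, forall s,
    complex.Re s < es_s0 (inl p) -> complex.Re s < M -> normc (es_psi (inl p) s - p) < e;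
  es_inl_nbhs : forall p M, exists2 e : R, 0 < e & forall z, z != p -> normc (z - p) < e ->
    exists s, [/\ complex.Re s < es_s0 (inl p), complex.Re s < M & es_psi (inl p) s = z];
  es_inr_cvg : forall j (K : R), exists M, forall s,
    complex.Re s < es_s0 (inr j) -> complex.Re s < M -> K < normc (es_psi (inr j) s);
  es_inr_inj : forall j j' s s', complex.Re s < es_s0 (inr j) ->
    complex.Re s' < es_s0 (inr j') -> es_psi (inr j) s = es_psi (inr j') s' -> j = j';
  es_escape : forall M : R, exists K r : R, 0 < r /\ forall z, K < normc z ->
    (exists j s, [/\ complex.Re s < es_s0 (inr j), complex.Re s < M & es_psi (inr j) s = z]) \/
    (exists g : R[i] -> R[i], g (es_F z) = z /\ forall b, normc (b - es_F z) < r ->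
       [/\ es_F (g b) = b, ccont g b & normc (g b) <= 2 * normc z])
}.

Arguments es_a {R} _ _.
Arguments es_m {R} _ _.
Arguments es_s0 {R} _ _.
Arguments es_psi {R} _ _ _.
Arguments es_F_der {R} _ z.
Arguments es_dF_cont {R} _ z.
Arguments es_dF_neq0 {R} _ {z} _.
Arguments es_F_lip {R} _ B.
Arguments es_chart {R} _ y.
Arguments es_a_inl {R} _ p.
Arguments es_m_inl {R} _ p.
Arguments es_m_inr {R} _ j.
Arguments es_inl_cvg {R} _ p {e} _.
Arguments es_inl_nbhs {R} _ p M.
Arguments es_inr_cvg {R} _ j K.
Arguments es_inr_inj {R} _ {j j' s s'} _ _ _.
Arguments es_escape {R} _ M.

(** * The metric on the plane with the ends added *)

Section CompletionMetric.
Variables (R : realType) (X : end_system R).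
Local Notation C := R[i].
Local Notation cexp := (@cexpi R).
Local Notation F := (es_F X).
Local Notation d := (es_ends X).
Local Notation Y := (C + 'I_d)%type.
Local Notation a := (es_a X).
Local Notation s0 := (es_s0 X).
Local Notation psi := (es_psi X).
Local Notation chartY := (es_chart X).
Local Notation a_inl := (es_a_inl X).
Local Notation psi_inl_cvg := (es_inl_cvg X).
Local Notation psi_inl_nbhs := (es_inl_nbhs X).
Local Notation psi_inr_cvg := (es_inr_cvg X).
Local Notation psi_inr_inj := (es_inr_inj X).
Local Notation escape := (es_escape X).
Local Notation F_lip := (es_F_lip X).

Definition es_dom (z : C) : Prop := z \notin es_sing X.
Local Notation S := es_dom.

Lemma finite_separated (p : C) (Z : seq C) : exists2 r : R, 0 < r &
  forall z, z \in Z -> z != p -> r <= normc (z - p).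
Proof.
elim: Z => [|q Z [r r0 Hr]]; first by exists 1.
have [->|qp] := eqVneq q p.
  by exists r => // z; rewrite in_cons => /orP[/eqP ->|/Hr//]; rewrite eqxx.
exists (Num.min r (normc (q - p))); first by rewrite lt_min r0 normc_gt0 subr_eq0.
move=> z; rewrite in_cons ge_min => /orP[/eqP -> _|/Hr h /h ->//].
by rewrite lexx orbT.
Qed.

Lemma es_dom_open x : S x -> exists2 r : R, 0 < r & forall z, normc (z - x) < r -> S z.
Proof.
move=> Sx; have [r r0 Hr] := finite_separated x (es_sing X).
exists r => // z hz; apply/negP => zZ.
have zx : z != x by apply/eqP => e; move: Sx; rewrite /es_dom -e zZ.
by move: hz; rewrite ltNge Hr.
Qed.

Lemma es_F_cont x : ccont F x.
Proof. exact: cder_cont (es_F_der X x). Qed.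

Lemma es_F_inj x : S x -> exists2 r : R, 0 < r &
  forall z z', normc (z - x) < r -> normc (z' - x) < r -> F z = F z' -> z = z'.
Proof.
move=> Sx.
have [r r0 H] := locally_injective (es_F_der X) (es_dF_cont X x) (es_dF_neq0 X Sx).
by exists r => // z z' hz hz'; exact: H.
Qed.

Lemma es_dom_joined x y : S x -> S y -> exists c, joined F S c x y.
Proof. by apply: (@joined_cofinite R F S F_lip (es_sing X)). Qed.

(** The candidate for the ball of radius rho about y: the image of a half-plane, and the centre if
    it lies in the plane. *)
Definition end_nbhd (y : Y) (rho : R) (x : C) :=
  (exists s, [/\ complex.Re s < s0 y, expR (complex.Re s) < rho & psi y s = x]) \/ y = inl x.
Local Notation nb := end_nbhd.

Lemma es_psiP y s : complex.Re s < s0 y ->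
  [/\ S (psi y s), F (psi y s) = a y + cexp s & ccont (psi y) s].
Proof. by have [h _] := chartY y; exact: h. Qed.

Lemma exists_deep_expR (y : Y) (e : R) : 0 < e -> exists s : C, complex.Re s < s0 y /\ expR (complex.Re s) < e.
Proof.
move=> e0; exists (Num.min (s0 y) (ln e) - 1)%:C; rewrite /=.
have h : Num.min (s0 y) (ln e) - 1 < Num.min (s0 y) (ln e) by lra.
move: h; rewrite lt_min => /andP[h1 h2]; split => //.
by rewrite -[ltRHS]lnK ?posrE // ltr_expR.
Qed.

Lemma exists_deep (y : Y) (M : R) : exists s : C, complex.Re s < s0 y /\ complex.Re s < M.
Proof.
have [s [h1 h2]] := exists_deep_expR y (expR_gt0 M); exists s; split => //.
by rewrite -ltr_expR.
Qed.

Lemma end_nbhd_F y rho x : 0 < rho -> nb y rho x -> normc (F x - a y) < rho.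
Proof.
move=> rho0 [[s [h1 h2 <-]]|->]; last by rewrite a_inl subrr Normc.normc0.
by have [_ -> _] := es_psiP h1; rewrite addrAC subrr add0r normc_cexp.
Qed.

(** Near [F x] a branch of the logarithm of F - a y, followed by [psi y], is a right inverse of [F].
    If the branch is chosen to return x' at [F x'], unique lifting along the segment makes it return
    z at [F z], so z is in the image of the chart too. *)
Lemma end_nbhd_local_regular y rho x : rho <= expR (s0 y) -> S x -> F x != a y ->
  normc (F x - a y) < rho -> exists2 r : R, 0 < r &
  forall x' z, normc (x' - x) < r -> normc (z - x) < r -> nb y rho x' -> nb y rho z.
Proof.
move=> rs Sx Fxa Fx.
pose b := F x; have ba : b - a y != 0 by rewrite subr_eq0.
have Nba : 0 < normc (b - a y) by rewrite normc_gt0.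
pose e := Num.min (normc (b - a y)) (rho - normc (b - a y)).
have e0 : 0 < e by rewrite lt_min Nba subr_gt0.
have [r1 r10 H1] := es_dom_open Sx; have [r2 r20 H2] := es_F_cont x e0.
exists (Num.min r1 r2); first by rewrite lt_min r10.
move=> x' z hx' hz nx'.
have inO w : normc (w - x) < Num.min r1 r2 -> [/\ S w, normc (F w - b) < normc (b - a y) &
    normc (F w - a y) < rho].
  rewrite lt_min => /andP[/H1 h1 /H2]; rewrite lt_min => /andP[h2 h3].
  by split => //; have := ler_normc_dist (F w) b (a y); rewrite -/b in h3; lra.
have sl o : normc (o - b) < normc (b - a y) -> slit ((o - a y) / (b - a y)).
  move=> ho; apply: slit_near1.
  have -> : (o - a y) / (b - a y) - 1 = (o - b) / (b - a y) by field.
  by rewrite Normc.normcM Normc.normcV ltr_pdivrMr // mul1r.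
have [Sx' Fx'b Fx'a] := inO _ hx'.
case: nx' => [[s' [hs1 hs2 hs3]]|yx']; last first.
  by exfalso; move: Fx'b; rewrite yx' a_inl normcB ltxx.
have [_ Fs' _] := es_psiP hs1; rewrite hs3 in Fs'.
pose sg o := s' + Log ((o - a y) / (b - a y)) - Log ((F x' - a y) / (b - a y)).
have sgE o : normc (o - b) < normc (b - a y) -> cexp (sg o) = o - a y.
  move=> ho; have [_ L1] := LogP (sl _ ho); have [_ L2] := LogP (sl _ Fx'b).
  rewrite /sg cexpB cexpD L1 L2 Fs' addrAC subrr add0r.
  by field; rewrite ba cexp_neq0.
have sgR o : normc (o - b) < normc (b - a y) -> normc (o - a y) < rho ->
    expR (complex.Re (sg o)) < rho /\ complex.Re (sg o) < s0 y.
  move=> ho1 ho2; rewrite -normc_cexp sgE //; split => //.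
  by rewrite -ltr_expR -normc_cexp sgE //; exact: lt_le_trans rs.
pose g o := psi y (sg o).
have gp : cpath S (fun t : R => x' + t%:C * (z - x')).
  by apply: segment_cpath => t t0 t1; have [] := inO _ (segment_in_ball t0 t1 hx' hz).
have lift := @unique_lift R F S es_F_cont es_F_inj _ g gp.
have gz : g (F z) = z.
  have lf1 t : 0 <= t -> t <= 1 -> F (g (F (x' + t%:C * (z - x')))) = F (x' + t%:C * (z - x')) /\
      ccont g (F (x' + t%:C * (z - x'))).
    move=> t0 t1.
    have [_ h1 h2] := inO _ (segment_in_ball t0 t1 hx' hz).
    have [k1 k2] := sgR _ h1 h2; have [_ k3 k4] := es_psiP k2.
    split; first by rewrite /g k3 sgE // addrC subrK.
    apply: ccont_comp k4; apply: (@cder_cont R _ _ (((_ - a y) / (b - a y))^-1 * (b - a y)^-1)).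
    have ld := cder_Log (sl _ h1).
    have := cder_comp (cderZ (b - a y)^-1 (cderD (cder_id (F (x' + t%:C * (z - x')))) (cder_cst (- a y) _))).
    rewrite addr0 mulr1 mulrC => /(_ _ _ ld) ld2.
    have := cderD (cderD (cder_cst s' _) ld2) (cder_cst (- Log ((F x' - a y) / (b - a y))) _).
    rewrite add0r addr0; apply: cder_eq; exists 1 => // w _.
    by rewrite /sg [_^-1 * _]mulrC.
  have lf2 : g (F (x' + 0%:C * (z - x'))) = x' + 0%:C * (z - x').
    by rewrite mul0r addr0 /g (_ : sg (F x') = s') ?hs3 // /sg addrK.
  have x1 : x' + 1%:C * (z - x') = z by rewrite mul1r addrC subrK.
  by have := lift lf1 lf2 1 ler01 (lexx _); rewrite x1.
have [_ h1 h2] := inO _ hz; have [k1 k2] := sgR _ h1 h2.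
by left; exists (sg (F z)).
Qed.

(** When F x = a y, x can belong only as the centre. If it is not the centre, a point of the
    neighbourhood close to x would have F close to a y, hence be deep in the chart, hence close to
    another point or far out. *)
Lemma end_nbhd_local y rho x : rho <= expR (s0 y) -> S x -> normc (F x - a y) < rho ->
  exists2 r : R, 0 < r & forall z, normc (z - x) < r -> (nb y rho z <-> nb y rho x).
Proof.
move=> rs Sx Fx.
have rho0 : 0 < rho by apply: le_lt_trans Fx; exact: normc_ge0.
have [E|E] := eqVneq (F x) (a y); last first.
  have [r r0 Hr] := end_nbhd_local_regular rs Sx E Fx.
  by exists r => // z hz; split; apply: Hr => //; rewrite subrr Normc.normc0.
have notpsi : nb y rho x -> y = inl x.
  move=> [[s [h1 _ h2]]|//]; have [_ h _] := es_psiP h1; exfalso.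
  by move: h; rewrite h2 E => /eqP; rewrite -subr_eq0 opprD addrA subrr sub0r oppr_eq0 (negPf (cexp_neq0 _)).
case: y => [p|j] in rs Fx E notpsi *.
- have [px|px] := eqVneq p x.
    subst p; have [e e0 He] := psi_inl_nbhs x (ln rho).
    exists e => // z hz; split => _; first by right.
    have [->|zx] := eqVneq z x; first by right.
    have [s [h1 h2 h3]] := He z zx hz; left; exists s; split => //.
    by rewrite -[ltRHS]lnK ?posrE // ltr_expR.
  pose e := normc (p - x) / 2.
  have e0 : 0 < e by rewrite divr_gt0 // normc_gt0 subr_eq0.
  have [M HM] := psi_inl_cvg p e0.
  have [r1 r10 H1] := es_F_cont x (expR_gt0 M).
  exists (Num.min r1 e); first by rewrite lt_min r10.
  move=> z; rewrite lt_min => /andP[/H1 h1 h2]; split => [|/notpsi [px']]; last by rewrite px' eqxx in px.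
  move=> [[s [k1 k2 k3]]|[pz]]; exfalso.
    have [_ k4 _] := es_psiP k1; rewrite k3 in k4.
    have k5 : complex.Re s < M.
      by rewrite -ltr_expR -normc_cexp; move: h1; rewrite k4 E addrAC subrr add0r.
    have := HM s k1 k5; rewrite k3 => k6.
    have := ler_normc_dist p z x; rewrite (normcB p z); rewrite /e in k6 h2; lra.
  by move: h2; rewrite -pz /e; move: e0; rewrite /e; lra.
- pose K := normc x + 1.
  have [M HM] := psi_inr_cvg j K.
  have [r1 r10 H1] := es_F_cont x (expR_gt0 M).
  exists (Num.min r1 1); first by rewrite lt_min r10 ltr01.
  move=> z; rewrite lt_min => /andP[/H1 h1 h2]; split => [|/notpsi //].
  move=> [[s [k1 k2 k3]]|//]; exfalso.
  have [_ k4 _] := es_psiP k1; rewrite k3 in k4.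
  have k5 : complex.Re s < M.
    by rewrite -ltr_expR -normc_cexp; move: h1; rewrite k4 E addrAC subrr add0r.
  have := HM s k1 k5; rewrite k3 /K; have := ler_normcD (z - x) x; rewrite subrK; lra.
Qed.

(** Along the path [F] stays within rho of a y, where membership is locally constant. *)
Lemma end_nbhd_stay y rho c x z : rho <= expR (s0 y) -> joined F S c x z ->
  nb y rho x -> normc (F x - a y) + c < rho -> nb y rho z.
Proof.
move=> rs [g [v [gp gv <- <- vc]]] n0 hc.
apply: (@interval_clopen R 0 1 (fun t => nb y rho (g t))) => // t t0 t1.
have [Sg gc] := gp t t0 t1.
have Fg : normc (F (g t) - a y) < rho.
  have h1 := gv 0 t (lexx _) t0 t1.
  have h2 : 0 <= v 1 - v t by apply: le_trans (gv t 1 t0 t1 (lexx _)); exact: normc_ge0.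
  have := ler_normc_dist (F (g t)) (F (g 0)) (a y); lra.
have [r r0 Hr] := end_nbhd_local rs Sg Fg.
have [r1 r10 H1] := gc _ r0; exists r1 => // u u0 u1 ut.
by apply/Hr/H1.
Qed.

Lemma exp_lipschitz (s s' : C) (M : R) : complex.Re s <= M -> complex.Re s' <= M ->
  normc (cexp s' - cexp s) <= expR M * normc (s' - s).
Proof.
move=> h h'; have := @mean_value_segment R cexp cexp s s' 0 (expR M) _.
rewrite mul0r subr0; apply => t /andP[t0 t1] /=; split; first exact: cder_cexp.
rewrite subr0 normc_cexp ler_expR raddfD /= Re_mul_real raddfB /=; nra.
Qed.

Lemma psi_cpath y s s' : complex.Re s < s0 y -> complex.Re s' < s0 y ->
  cpath S (fun t : R => psi y (s + t%:C * (s' - s))).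
Proof.
move=> h h' t t0 t1.
have ht : complex.Re (s + t%:C * (s' - s)) < s0 y.
  rewrite raddfD /= Re_mul_real raddfB /=.
  have [->|tn0] := eqVneq t 0; first by rewrite mul0r addr0.
  have tp : 0 < t by rewrite lt_neqAle eq_sym tn0.
  nra.
have [h1 _ h2] := es_psiP ht; split => // e /h2 [r r0 Hr].
have N1 : 0 < normc (s' - s) + 1 by rewrite ltr_wpDl // normc_ge0.
exists (r / (normc (s' - s) + 1)); first by rewrite divr_gt0.
move=> u u0 u1; rewrite ltr_pdivlMr // => hu; apply: Hr.
have -> : s + u%:C * (s' - s) - (s + t%:C * (s' - s)) = (u - t)%:C * (s' - s).
  by rewrite rmorphB; ring.
rewrite Normc.normcM normcZ; apply: le_lt_trans hu.
by rewrite ler_wpM2l // lerDl.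
Qed.

Lemma Re_segment_le s s' (M t : R) : 0 <= t -> t <= 1 -> complex.Re s <= M -> complex.Re s' <= M ->
  complex.Re (s + t%:C * (s' - s)) <= M.
Proof. move=> t0 t1 h h'; rewrite raddfD /= Re_mul_real raddfB /=; nra. Qed.

Lemma psi_joined_segment y s s' (M : R) : M < s0 y -> complex.Re s <= M -> complex.Re s' <= M ->
  joined F S (expR M * normc (s' - s)) (psi y s) (psi y s').
Proof.
move=> Ms h h'.
have := @joined_lipschitz R F S _ (expR M * normc (s' - s))
  (psi_cpath (le_lt_trans h Ms) (le_lt_trans h' Ms)).
have -> : s + 0%:C * (s' - s) = s by rewrite mul0r addr0.
have -> : s + 1%:C * (s' - s) = s' by rewrite mul1r addrC subrK.
apply => t u t0 tu u1.
have t1 : t <= 1 by lra.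
have u0 : 0 <= u by lra.
have ht := Re_segment_le t0 t1 h h'; have hu := Re_segment_le u0 u1 h h'.
have [_ -> _] := es_psiP (le_lt_trans ht Ms); have [_ -> _] := es_psiP (le_lt_trans hu Ms).
rewrite opprD addrACA subrr add0r; apply: (le_trans (exp_lipschitz ht hu)).
have -> : s + u%:C * (s' - s) - (s + t%:C * (s' - s)) = (u - t)%:C * (s' - s).
  by rewrite rmorphB; ring.
by rewrite Normc.normcM normcZ ger0_norm ?subr_ge0 // [X in _ * X]mulrC mulrA.
Qed.

(** [F] maps the horizontal segment from s to the left onto a radial segment pointing to a y, of
    length less than e^(Re s). *)
Lemma psi_joined_ray y s (T : R) : 0 <= T -> complex.Re s < s0 y ->
  joined F S (expR (complex.Re s)) (psi y s) (psi y (s - T%:C)).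
Proof.
move=> T0 hs.
have hsT : complex.Re (s - T%:C) < s0 y by rewrite raddfB /=; lra.
pose v (t : R) : R := - expR (complex.Re s - t * T).
exists (fun t : R => psi y (s + t%:C * (s - T%:C - s))), v; split.
- exact: psi_cpath.
- move=> t u t0 tu u1.
  have pt (r : R) : s + r%:C * (s - T%:C - s) = s - (r * T)%:C by rewrite rmorphM; ring.
  rewrite !pt.
  have hr (r : R) : 0 <= r -> complex.Re (s - (r * T)%:C) < s0 y.
    by move=> r0; rewrite raddfB /=; have := mulr_ge0 r0 T0; lra.
  have u0 : 0 <= u by lra.
  have [_ -> _] := es_psiP (hr _ t0); have [_ -> _] := es_psiP (hr _ u0).
  have real (r : R) : cexp (- r%:C) = (expR (- r))%:C.
    by rewrite cexpE !raddfN /= oppr0 cos0 sin0 mulr1 mulr0.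
  rewrite opprD addrACA subrr add0r !cexpD !real -mulrBr Normc.normcM normc_cexp -rmorphB normcZ.
  have le1 : expR (- (u * T)) <= expR (- (t * T)) by rewrite ler_expR lerN2 ler_wpM2r.
  rewrite ler0_norm ?subr_le0 // /v !expRD; lra.
- by rewrite mul0r addr0.
- by rewrite mul1r addrC subrK.
- rewrite /v mul0r subr0; have := expR_ge0 (complex.Re s - 1 * T); lra.
Qed.

(** Follow the rays from s and s' to depth M and cross there, at a cost of at most e^M |s' - s| <=
    e. *)
Lemma psi_joined y s s' e : 0 < e -> complex.Re s < s0 y -> complex.Re s' < s0 y ->
  joined F S (expR (complex.Re s) + expR (complex.Re s') + e) (psi y s) (psi y s').
Proof.
move=> e0 h h'.
have N1 : 0 < normc (s' - s) + 1 by rewrite ltr_wpDl // normc_ge0.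
pose M := Num.min (s0 y - 1) (ln (e / (normc (s' - s) + 1))).
pose T := `|complex.Re s - M| + `|complex.Re s' - M|.
have T0 : 0 <= T by rewrite addr_ge0.
have hM : M < s0 y.
  by apply: (@le_lt_trans _ _ (s0 y - 1)); [rewrite /M ge_min lexx|lra].
have hsT : complex.Re (s - T%:C) <= M.
  rewrite raddfB /= /T; have := ler_norm (complex.Re s - M); have := normr_ge0 (complex.Re s' - M); lra.
have hsT' : complex.Re (s' - T%:C) <= M.
  rewrite raddfB /= /T; have := ler_norm (complex.Re s' - M); have := normr_ge0 (complex.Re s - M); lra.
have J1 := psi_joined_ray T0 h; have J3 := joined_sym (psi_joined_ray T0 h').
have J2 := psi_joined_segment hM hsT hsT'.
apply: joined_le (joined_trans (joined_trans J1 J2) J3).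
have -> : s' - T%:C - (s - T%:C) = s' - s by ring.
suff : expR M * normc (s' - s) <= e by lra.
have : expR M <= e / (normc (s' - s) + 1).
  rewrite -[leRHS]lnK ?posrE ?divr_gt0 // ler_expR /M ge_min lexx orbT //.
move=> hE; apply: (@le_trans _ _ (expR M * (normc (s' - s) + 1))).
  by rewrite ler_wpM2l ?expR_ge0 // lerDl.
by rewrite -ler_pdivlMr.
Qed.

(** Measured between deep points of charts. As every point of the plane has a chart, regular points,
    zeros and ends are treated alike. *)
Definition end_near (y y' : Y) (c : R) := forall e, 0 < e -> exists s s',
  [/\ complex.Re s < s0 y, complex.Re s' < s0 y', expR (complex.Re s) < e,
      expR (complex.Re s') < e & joined F S (c + e) (psi y s) (psi y' s')].

(** Points of one chart are close to each other by [psi_joined], so one pair of deep points controls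
    all pairs. *)
Lemma end_near_all y y' c s s' e : 0 < e -> end_near y y' c ->
  complex.Re s < s0 y -> complex.Re s' < s0 y' ->
  joined F S (c + expR (complex.Re s) + expR (complex.Re s') + e) (psi y s) (psi y' s').
Proof.
move=> e0 h hs hs'.
have e5 : 0 < e / 5 by rewrite divr_gt0.
have [t [t' [h1 h2 h3 h4 h5]]] := h _ e5.
apply: joined_le (joined_trans (joined_trans (psi_joined e5 hs h1) h5) (psi_joined e5 h2 hs')).
lra.
Qed.

Lemma end_near_refl y : end_near y y 0.
Proof.
move=> e e0; have [s [h1 h2]] := exists_deep_expR y e0; exists s, s; split => //.
apply: (joined_le (c := 0)); first by rewrite add0r ltW.
by apply: joined_refl; have [] := es_psiP h1.
Qed.

Lemma end_near_sym y y' c : end_near y y' c -> end_near y' y c.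
Proof.
move=> h e /h [s [s' [h1 h2 h3 h4 h5]]]; exists s', s; split => //; exact: joined_sym.
Qed.

Lemma end_near_trans y y' y'' c c' : end_near y y' c -> end_near y' y'' c' -> end_near y y'' (c + c').
Proof.
move=> h h' e e0; have e8 : 0 < e / 8 by rewrite divr_gt0.
have [s [hs se]] := exists_deep_expR y e8; have [s' [hs' se']] := exists_deep_expR y' e8.
have [s'' [hs'' se'']] := exists_deep_expR y'' e8.
exists s, s''; split => //; try lra.
apply: joined_le (joined_trans (end_near_all e8 h hs hs') (end_near_all e8 h' hs' hs'')).
lra.
Qed.

Lemma end_near_ge0 y y' c : end_near y y' c -> 0 <= c.
Proof.
move=> h; apply/ler_addgt0Pr => e /h [s [s' [_ _ _ _ /joined_ge0]]] //.
Qed.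

Lemma end_near_exists y y' : exists c, end_near y y' c.
Proof.
have [s [hs _]] := exists_deep_expR y (ltr01); have [s' [hs' _]] := exists_deep_expR y' (ltr01).
have [S1 _ _] := es_psiP hs; have [S2 _ _] := es_psiP hs'.
have [c hc] := es_dom_joined S1 S2.
exists (expR (complex.Re s) + c + expR (complex.Re s')) => e e0.
have e8 : 0 < e / 8 by rewrite divr_gt0.
have [t [ht te]] := exists_deep_expR y e8; have [t' [ht' te']] := exists_deep_expR y' e8.
exists t, t'; split => //; try lra.
apply: joined_le (joined_trans (joined_trans (psi_joined e8 ht hs) hc) (psi_joined e8 hs' ht')).
lra.
Qed.

Lemma end_near_inf y y' c : (forall e, 0 < e -> end_near y y' (c + e)) -> end_near y y' c.
Proof.
move=> h e e0; have e2 : 0 < e / 2 by rewrite divr_gt0.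
have [s [s' [h1 h2 h3 h4 h5]]] := h _ e2 _ e2; exists s, s'; split => //; try lra.
by apply: joined_le h5; lra.
Qed.

Lemma end_near_a y y' c : end_near y y' c -> normc (a y - a y') <= c.
Proof.
move=> h; apply/ler_addgt0Pr => e e0; have e3 : 0 < e / 3 by rewrite divr_gt0.
have [s [s' [h1 h2 h3 h4 /joined_dist]]] := h _ e3.
have [_ -> _] := es_psiP h1; have [_ -> _] := es_psiP h2 => h5.
have -> : a y - a y' = - (a y' + cexp s' - (a y + cexp s)) + (cexp s' - cexp s) by ring.
apply: (le_trans (ler_normcD _ _)); rewrite normcN.
have := ler_normcBD (cexp s') (cexp s); rewrite !normc_cexp; lra.
Qed.

Lemma end_near_nbhd y y' c rho : end_near y y' c -> c < rho -> rho <= expR (s0 y) ->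
  exists M, forall s', complex.Re s' < s0 y' -> complex.Re s' < M -> nb y rho (psi y' s').
Proof.
move=> h crho rs; pose e := (rho - c) / 8.
have e0 : 0 < e by rewrite divr_gt0 // subr_gt0.
exists (ln e) => s' hs' hM.
have [s [hs se]] := exists_deep_expR y e0.
have se' : expR (complex.Re s') < e by rewrite -[ltRHS]lnK ?posrE // ltr_expR.
have c0 := end_near_ge0 h.
apply: (end_nbhd_stay rs (end_near_all e0 h hs hs')).
  by left; exists s; split => //; rewrite /e in se; lra.
have [_ -> _] := es_psiP hs; rewrite addrAC subrr add0r normc_cexp.
rewrite /e in se se' *; lra.
Qed.

Lemma end_nbhd_inl_small p e : 0 < e -> exists2 rho : R, 0 < rho & forall x,
  nb (inl p) rho x -> normc (x - p) < e.
Proof.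
move=> e0; have [M HM] := psi_inl_cvg p e0; exists (expR M); first exact: expR_gt0.
move=> x [[s [h1 h2 <-]]|[->]]; last by rewrite subrr Normc.normc0.
by apply: HM => //; rewrite -ltr_expR.
Qed.

Lemma end_nbhd_inr_large j (K : R) : exists2 rho : R, 0 < rho & forall x,
  nb (inr j) rho x -> K < normc x.
Proof.
have [M HM] := psi_inr_cvg j K; exists (expR M); first exact: expR_gt0.
move=> x [[s [h1 h2 <-]]|//].
by apply: HM => //; rewrite -ltr_expR.
Qed.

Lemma end_nbhd_le y rho rho' x : rho <= rho' -> nb y rho x -> nb y rho' x.
Proof.
move=> h [[s [h1 h2 h3]]|]; last by right.
by left; exists s; split => //; exact: lt_le_trans h.
Qed.

(** Deep points of y' lie in every neighbourhood of y. Position separates points of the plane,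
    modulus separates them from ends, and two ends have disjoint charts. *)
Lemma end_near0_eq y y' : end_near y y' 0 -> y = y'.
Proof.
move=> h.
have H rho : 0 < rho -> exists M, forall s', complex.Re s' < s0 y' -> complex.Re s' < M ->
    nb y rho (psi y' s').
  move=> r0; have r1 : 0 < Num.min rho (expR (s0 y)) by rewrite lt_min r0 expR_gt0.
  have r2 : Num.min rho (expR (s0 y)) <= expR (s0 y) by rewrite ge_min lexx orbT.
  have [M HM] := end_near_nbhd h r1 r2; exists M => s' h1 h2.
  by apply: end_nbhd_le (HM _ h1 h2); rewrite ge_min lexx.
case: y y' h H => [p|j] [p'|j'] h H.
- congr inl; apply/eqP; rewrite -subr_eq0 -normc_eq0 eq_le normc_ge0 andbT.
  apply/ler_addgt0Pr => e e0; rewrite add0r.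
  have e2 : 0 < e / 2 by rewrite divr_gt0.
  have [rho r0 Hr] := end_nbhd_inl_small p e2.
  have [M HM] := H _ r0; have [M' HM'] := psi_inl_cvg p' e2.
  have [s [s1 s2]] := exists_deep (inl p') (Num.min M M').
  move: s2; rewrite lt_min => /andP[/(HM _ s1)/Hr h1 /(HM' _ s1) h2].
  have := ler_normc_dist p (psi (inl p') s) p'; rewrite (normcB p (psi _ _)); lra.
- exfalso; have [rho r0 Hr] := end_nbhd_inl_small p ltr01.
  have [M HM] := H _ r0; have [M' HM'] := psi_inr_cvg j' (normc p + 1).
  have [s [s1 s2]] := exists_deep (inr j') (Num.min M M').
  move: s2; rewrite lt_min => /andP[/(HM _ s1)/Hr h1 /(HM' _ s1) h2].
  move: h1 h2; have := ler_normcD (psi (inr j') s - p) p; rewrite subrK; lra.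
- exfalso; have [rho r0 Hr] := end_nbhd_inr_large j (normc p' + 1).
  have [M HM] := H _ r0; have [M' HM'] := psi_inl_cvg p' ltr01.
  have [s [s1 s2]] := exists_deep (inl p') (Num.min M M').
  move: s2; rewrite lt_min => /andP[/(HM _ s1)/Hr h1 /(HM' _ s1) h2].
  move: h1 h2; have := ler_normcD (psi (inl p') s - p') p'; rewrite subrK; lra.
- have [M HM] := H _ ltr01.
  have [s [s1 s2]] := exists_deep (inr j') M.
  have [[t [t1 _ t3]]|//] := HM _ s1 s2.
  by rewrite (psi_inr_inj t1 s1 t3).
Qed.

Definition end_dist (y y' : Y) : R := inf [set c | end_near y y' c].
Local Notation D := end_dist.

Lemma end_near_has_inf y y' : has_inf [set c | end_near y y' c].
Proof.
split; first by have [c] := end_near_exists y y'; exists c.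
by exists 0 => c; exact: end_near_ge0.
Qed.

Lemma end_dist_le y y' c : end_near y y' c -> D y y' <= c.
Proof. by move=> h; apply: ge_inf => //; have [_] := end_near_has_inf y y'. Qed.

Lemma end_near_le y y' c c' : c <= c' -> end_near y y' c -> end_near y y' c'.
Proof.
move=> cc h e /h [s [s' [h1 h2 h3 h4 h5]]]; exists s, s'; split => //.
by apply: joined_le h5; rewrite lerD2r.
Qed.

Lemma end_near_dist y y' : end_near y y' (D y y').
Proof.
apply: end_near_inf => e e0; have [c hc] := inf_adherent e0 (end_near_has_inf y y').
by move=> h; apply: end_near_le hc; exact: ltW.
Qed.

Lemma end_distxx y : D y y = 0.
Proof.
apply/le_anti; rewrite end_dist_le ?(end_near_ge0 (end_near_dist y y)) //; exact: end_near_refl.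
Qed.

Lemma end_dist_eq0 y y' : D y y' = 0 -> y = y'.
Proof. by move=> h; apply: end_near0_eq; rewrite -h; exact: end_near_dist. Qed.

Lemma end_dist_sym y y' : D y y' = D y' y.
Proof.
by apply/le_anti; rewrite !end_dist_le //; apply: end_near_sym; exact: end_near_dist.
Qed.

Lemma end_dist_triangle y' y y'' : D y y'' <= D y y' + D y' y''.
Proof. by apply: end_dist_le; apply: end_near_trans; exact: end_near_dist. Qed.

Lemma end_dist_a y y' : normc (a y - a y') <= D y y'.
Proof. by apply: end_near_a; exact: end_near_dist. Qed.

Lemma joined_psi x e : S x -> 0 < e -> exists M, forall s, complex.Re s < s0 (inl x) ->
  complex.Re s < M -> joined F S e x (psi (inl x) s).
Proof.
move=> Sx e0; have [r [L [r0 L0 HL]]] := joined_local es_dom_open F_lip Sx.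
have L1 : 0 < L + 1 by rewrite ltr_wpDl.
have e1 : 0 < Num.min r (e / (L + 1)) by rewrite lt_min r0 divr_gt0.
have [M HM] := psi_inl_cvg x e1.
exists M => s h1 h2; have := HM _ h1 h2; rewrite lt_min => /andP[h3].
rewrite ltr_pdivlMr // => h4.
apply: joined_le (HL x (psi (inl x) s) _ h3); last by rewrite subrr Normc.normc0.
have := normc_ge0 (psi (inl x) s - x); lra.
Qed.

(** A regular point is joined to the deep points of its own chart by arbitrarily short paths, so on
    regular points this is the path metric. *)
Lemma end_near_inl x z c : S x -> S z ->
  end_near (inl x) (inl z) c <-> forall e, 0 < e -> joined F S (c + e) x z.
Proof.
move=> Sx Sz; split=> [h e e0|h e e0].
  have e5 : 0 < e / 5 by rewrite divr_gt0.
  have [M HM] := joined_psi Sx e5; have [M' HM'] := joined_psi Sz e5.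
  have [s [s1 s2]] := exists_deep (inl x) (Num.min M (ln (e / 5))).
  have [s' [s1' s2']] := exists_deep (inl z) (Num.min M' (ln (e / 5))).
  move: s2 s2'; rewrite !lt_min => /andP[k1 k2] /andP[k1' k2'].
  have E (u : C) : complex.Re u < ln (e / 5) -> expR (complex.Re u) < e / 5.
    by move=> ?; rewrite -[ltRHS]lnK ?posrE // ltr_expR.
  have k3 := E _ k2; have k3' := E _ k2'.
  apply: joined_le (joined_trans (joined_trans (HM _ s1 k1) (end_near_all e5 h s1 s1')) (joined_sym (HM' _ s1' k1'))).
  lra.
have e3 : 0 < e / 3 by rewrite divr_gt0.
have [M HM] := joined_psi Sx e3; have [M' HM'] := joined_psi Sz e3.
have [s [s1 s2]] := exists_deep (inl x) (Num.min M (ln e)).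
have [s' [s1' s2']] := exists_deep (inl z) (Num.min M' (ln e)).
move: s2 s2'; rewrite !lt_min => /andP[k1 k2] /andP[k1' k2'].
have E (u : C) : complex.Re u < ln e -> expR (complex.Re u) < e.
  by move=> ?; rewrite -[ltRHS]lnK ?posrE // ltr_expR.
exists s, s'; split => //; try exact: E.
apply: joined_le (joined_trans (joined_trans (joined_sym (HM _ s1 k1)) (h _ e3)) (HM' _ s1' k1')).
lra.
Qed.

Lemma end_nbhd_near y rho x : 0 < rho -> S x -> nb y rho x -> end_near y (inl x) rho.
Proof.
move=> r0 Sx [[t [t1 t2 t3]]|->]; last by apply: end_near_le (end_near_refl _); exact: ltW.
move=> e e0; have e4 : 0 < e / 4 by rewrite divr_gt0.
have [s [hs se]] := exists_deep_expR y e4.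
have [M HM] := joined_psi Sx e4.
have [s' [s1' s2']] := exists_deep (inl x) (Num.min M (ln e)).
move: s2'; rewrite !lt_min => /andP[k1 k2].
exists s, s'; split => //; try lra.
  by rewrite -[ltRHS]lnK ?posrE // ltr_expR.
have J := psi_joined e4 hs t1; rewrite t3 in J.
apply: joined_le (joined_trans J (HM _ s1' k1)).
lra.
Qed.

(** The converse for chart points is [end_ball_psi]; together they identify small metric balls with
    images of half-planes. *)
Lemma end_ball y rho x : rho <= expR (s0 y) -> S x -> D y (inl x) < rho -> nb y rho x.
Proof.
move=> rs Sx h.
have Fx : normc (F x - a y) < rho.
  by apply: le_lt_trans h; rewrite end_dist_sym -a_inl; exact: end_dist_a.
have [r r0 Hr] := end_nbhd_local rs Sx Fx.
have [M HM] := end_near_nbhd (end_near_dist _ _) h rs.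
have [M' HM'] := psi_inl_cvg x r0.
have [s' [s1 s2]] := exists_deep (inl x) (Num.min M M').
move: s2; rewrite lt_min => /andP[k1 k2].
by apply/(Hr (psi (inl x) s')); [exact: HM'|exact: HM].
Qed.

Lemma end_ball_psi y rho s : complex.Re s < s0 y -> expR (complex.Re s) < rho ->
  D y (inl (psi y s)) < rho.
Proof.
move=> h1 h2; have [Ss _ _] := es_psiP h1.
pose r := (expR (complex.Re s) + rho) / 2.
apply: (@le_lt_trans _ _ r); last by rewrite /r; lra.
apply: end_dist_le; apply: end_nbhd_near => //.
  by rewrite /r; have := expR_gt0 (complex.Re s); lra.
by left; exists s; split => //; rewrite /r; lra.
Qed.

Lemma end_dist_inl_small p e : 0 < e -> exists2 r : R, 0 < r & forall z, normc (z - p) < r ->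
  D (inl p) (inl z) < e.
Proof.
move=> e0; have [r r0 Hr] := psi_inl_nbhs p (ln e); exists r => // z hz.
have [->|zp] := eqVneq z p; first by rewrite end_distxx.
have [s [s1 s2 <-]] := Hr z zp hz.
by apply: end_ball_psi => //; rewrite -[ltRHS]lnK ?posrE // ltr_expR.
Qed.

(** The image under [F] of a path of length r / 2 from x n stays in the disk where [g] is defined;
    by unique lifting the path is [g] of its image, and is bounded as [g] is. *)
Lemma unbounded_branch (x : nat -> C) (r : R) n (g : C -> C) : 0 < r ->
  (forall k, (n <= k)%N -> joined F S (r / 2) (x n) (x k)) ->
  g (F (x n)) = x n ->
  (forall b, normc (b - F (x n)) < r ->
     [/\ F (g b) = b, ccont g b & normc (g b) <= 2 * normc (x n)]) ->
  forall k, (n <= k)%N -> normc (x k) <= 2 * normc (x n).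
Proof.
move=> r0 hj gx hg k /hj [ga [v [gp gv g0 g1 vc]]].
have Fg t : 0 <= t -> t <= 1 -> normc (F (ga t) - F (x n)) < r.
  move=> t0 t1; have h1 := gv 0 t (lexx _) t0 t1.
  have h2 : 0 <= v 1 - v t by apply: le_trans (gv t 1 t0 t1 (lexx _)); exact: normc_ge0.
  rewrite g0 in h1; lra.
have lf t : 0 <= t -> t <= 1 -> F (g (F (ga t))) = F (ga t) /\ ccont g (F (ga t)).
  by move=> t0 t1; have [] := hg _ (Fg t t0 t1).
have l0 : g (F (ga 0)) = ga 0 by rewrite g0.
have := unique_lift es_F_cont es_F_inj gp lf l0 ler01 (lexx _); rewrite g1 => <-.
by have [_ _] := hg _ (Fg 1 ler01 (lexx _)); rewrite g1.
Qed.

(** Otherwise every y has a neighbourhood that the sequence eventually avoids. It then leaves all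
    bounded sets and avoids fixed neighbourhoods of the finitely many ends, so [es_escape] gives an
    inverse branch at a late x n, and by [unbounded_branch] the sequence is bounded after all. *)
Theorem end_complete (x : nat -> C) : (forall n, S (x n)) ->
  (forall e, 0 < e -> exists N, forall n k, (N <= n)%N -> (N <= k)%N -> joined F S e (x n) (x k)) ->
  exists y, forall rho, 0 < rho -> forall N, exists2 n, (N <= n)%N & nb y rho (x n).
Proof.
move=> Sx Cx; apply: contrapT => H.
have H' y : exists rN : R * nat, 0 < rN.1 /\ forall n, (rN.2 <= n)%N -> ~ nb y rN.1 (x n).
  apply: contrapT => H1; apply: H; exists y => rho r0 N.
  apply: contrapT => H2; apply: H1; exists (rho, N); split => // n Nn nbx.
  by apply: H2; exists n.
have [rN HrN] := choice H'.
have toinf B : exists N, forall n, (N <= n)%N -> B < normc (x n).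
  apply: contrapT => H1.
  have [z Hz] : exists z, forall e, 0 < e -> forall N, exists2 n, (N <= n)%N & normc (x n - z) < e.
    apply: (@bounded_cluster R x B) => N; apply: contrapT => H2; apply: H1; exists N => n Nn.
    by rewrite ltNge; apply/negP => H3; apply: H2; exists n.
  have [r0 Hr] := HrN (inl z).
  have [e e0 He] := psi_inl_nbhs z (ln (rN (inl z)).1).
  have [n n1 n2] := Hz e e0 (rN (inl z)).2.
  apply: (Hr n n1); have [->|xz] := eqVneq (x n) z; first by right.
  have [s [s1 s2 s3]] := He _ xz n2; left; exists s; split => //.
  by rewrite -[ltRHS]lnK ?posrE // ltr_expR.
have [B HB] := finite_upper_bound (fun j => (rN (inr j)).1^-1).
have [N0 HN0] : exists N : nat, forall j : 'I_d, ((rN (inr j)).2 <= N)%N.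
  by exists (\max_j (rN (inr j)).2) => j; exact: leq_bigmax.
pose rho := (`|B| + 1)^-1.
have B1 : 0 < `|B| + 1 by rewrite ltr_wpDl.
have rl j : rho <= (rN (inr j)).1.
  have [x0 _] := HrN (inr j).
  rewrite /rho -[X in _ <= X]invrK lef_pV2 ?posrE ?invr_gt0 //.
  by apply: (le_trans (HB j)); have := ler_norm B; lra.
have rho0 : 0 < rho by rewrite invr_gt0.
have [K [r [r0 HK]]] := escape (ln rho).
have [N1 HN1] := toinf K.
have [N2 HN2] := Cx (r / 2) (divr_gt0 r0 (ltr0Sn _ 1)).
pose n := maxn N0 (maxn N1 N2).
have n0 : (N0 <= n)%N by rewrite leq_max leqnn.
have n1 : (N1 <= n)%N by rewrite !leq_max leqnn orbT.
have n2 : (N2 <= n)%N by rewrite !leq_max leqnn !orbT.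
have [[j [s [s1 s2 s3]]]|[g [g1 g2]]] := HK _ (HN1 _ n1).
  have [_ Hj] := HrN (inr j); apply: (Hj n); first exact: leq_trans (HN0 j) n0.
  left; exists s; split => //; apply: lt_le_trans (rl j).
  by rewrite -[ltRHS]lnK ?posrE // ltr_expR.
have bd := @unbounded_branch x r n g r0 _ g1 g2.
have {}bd : forall k, (n <= k)%N -> normc (x k) <= 2 * normc (x n).
  by apply: bd => k nk; apply: HN2 => //; exact: leq_trans n2 nk.
have [N3 HN3] := toinf (2 * normc (x n)).
by have := HN3 (maxn n N3) (leq_maxr _ _); rewrite ltNge bd // leq_maxl.
Qed.

End CompletionMetric.

(** * Real error bounds and the topology of the complex numbers *)

Section Bridge.
Variable R : realType.
Local Notation C := (Cplx R).

Lemma nbhs_CplxP (z : C) (A : set C) :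
  nbhs z A <-> exists2 e : R, 0 < e & forall w, normc (w - z) < e -> A w.
Proof.
split=> [/nbhs_ballP[e /= e0 H]|[e e0 H]].
  (* A positive element of [R[i]] is real. *)
  have eE : (complex.Re e)%:C = e by move: e e0 {H} => [a b]; rewrite ltcE /= => /andP[/eqP -> _].
  exists (complex.Re e); first by rewrite -ltcR eE.
  move=> w hw; apply: H; rewrite /ball /= -eE normrE ltcR -normcN opprB //.
apply/nbhs_ballP; exists e%:C; first by rewrite /= ltcR.
move=> w; rewrite /ball /= normrE ltcR -normcN opprB; exact: H.
Qed.

Lemma continuous_CplxP (f : C -> C) (z : C) : {for z, continuous f} <-> ccont f z.
Proof.
split=> [h e e0|h].
  have : nbhs (f z) [set w : C | normc (w - f z) < e] by apply/nbhs_CplxP; exists e.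
  by move=> /h /= /nbhs_CplxP[r r0 Hr]; exists r.
move=> A /nbhs_CplxP[e e0 He]; have [r r0 Hr] := h _ e0.
by apply/nbhs_CplxP; exists r => // w /Hr /He.
Qed.

Lemma is_derive_CplxP (f : C -> C) (z c : C) : is_derive z (1 : C) f c <-> cder f z c.
Proof.
split=> [/is_deriveP h e e0|h].
  have [r r0 Hr] := h e%:C ltac:(by rewrite ltcR).
  have rE : (complex.Re r)%:C = r by move: r r0 {Hr} => [a b]; rewrite ltcE /= => /andP[/eqP -> _].
  exists (complex.Re r); first by rewrite -ltcR rE.
  move=> w hw; have := Hr (w - z); rewrite subrK !normrE -rmorphM -rE !ltcR lecR; exact.
apply/is_deriveP => e e0.
have eE : (complex.Re e)%:C = e by move: e e0 => [a b]; rewrite ltcE /= => /andP[/eqP -> _].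
have [r r0 Hr] := h (complex.Re e) ltac:(by rewrite -ltcR eE).
exists r%:C; first by rewrite ltcR.
move=> k; rewrite !normrE -eE -rmorphM lecR ltcR => hk.
by have := Hr (k + z); rewrite addrK; apply.
Qed.

Lemma derivable_Cplx (f : C -> C) (z c : C) : cder f z c -> derivable f z (1 : C).
Proof. by move=> /is_derive_CplxP []. Qed.

End Bridge.

(** * Metric spaces from distance functions *)

Section MetricOf.
Variables (R : realType) (T : choiceType) (D : T -> T -> R).
Hypothesis Dxx : forall x, D x x = 0.
Hypothesis D_eq0 : forall x y, D x y = 0 -> x = y.
Hypothesis D_sym : forall x y, D x y = D y x.
Hypothesis D_triangle : forall y x z, D x z <= D x y + D y z.

(** Indexed by the metric axioms, so that the metric structure can be inferred from the type. *)
Definition metric_carrier of (forall x, D x x = 0) &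
  (forall x y, D x y = 0 -> x = y) & (forall x y, D x y = D y x) &
  (forall y x z, D x z <= D x y + D y z) : Type := T.
Local Notation M := (metric_carrier Dxx D_eq0 D_sym D_triangle).
HB.instance Definition _ := Choice.copy M T.
HB.instance Definition _ := isMetric.Build R M Dxx D_eq0 D_sym D_triangle.
Definition metric_of : metricType R := M.

Lemma metric_ofE (x y : metric_of) : mdist x y = D x y.
Proof. by []. Qed.

Lemma nbhs_metric_of (x : metric_of) (A : set metric_of) :
  nbhs x A <-> exists2 e : R, 0 < e & forall y, D x y < e -> A y.
Proof.
split=> [/nbhs_ballP[e /= e0 H]|[e e0 H]].
  by exists e => // y h; apply: H; rewrite ballEmdist.
by apply/nbhs_ballP; exists e => // y; rewrite ballEmdist; exact: H.
Qed.

End MetricOf.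

(** * Lengths of inscribed polygons *)

Section PathLength.
Variable R : realType.
Local Notation C := R[i].
Implicit Types (h : R -> C) (v : R -> R) (s : seq R).

Definition polygon_length h (a : R) s : R :=
  \sum_(0 <= n < size s) normc (h (nth 1 (a :: s) n.+1) - h (nth 1 (a :: s) n)).

Lemma polygon_length_cons h a b s :
  polygon_length h a (b :: s) = normc (h b - h a) + polygon_length h b s.
Proof. by rewrite /polygon_length /= big_nat_recl. Qed.

Lemma polygon_length_rcons h a s b :
  polygon_length h a (rcons s b) = polygon_length h a s + normc (h b - h (last a s)).
Proof.
elim: s a => [|c s IH] a /=.
  by rewrite polygon_length_cons /polygon_length !big_nil addr0 add0r.
by rewrite !polygon_length_cons IH addrA.
Qed.

Lemma polygon_length_le h v a s : path <%R a s -> 0 <= a -> last a s <= 1 ->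
  (forall t u, 0 <= t -> t <= u -> u <= 1 -> normc (h u - h t) <= v u - v t) ->
  polygon_length h a s <= v (last a s) - v a.
Proof.
move=> + + + hv; elim: s a => [|b s IH] a /=.
  by move=> _ _ _; rewrite /polygon_length big_nil subrr.
move=> /andP[ab bs] a0 l1; rewrite polygon_length_cons.
have b0 : 0 <= b by apply: le_trans a0 (ltW ab).
have bl : b <= last b s.
  by apply: (@itv_partition_le _ _ b (last b s) s); split.
have := IH b bs b0 l1; have := hv a b a0 (ltW ab) (le_trans bl l1); lra.
Qed.

(** [v t] is the total variation on [0, t]; appending u to a partition of [0, t] gives the bound on
    the increment. *)
Lemma polygon_control h (c : R) :
  (forall s, itv_partition 0 1 s -> polygon_length h 0 s <= c) ->
  exists v, (forall t u, 0 <= t -> t <= u -> u <= 1 -> normc (h u - h t) <= v u - v t) /\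
    v 1 - v 0 <= c.
Proof.
move=> hc.
pose A t := [set polygon_length h 0 s | s in [set s | itv_partition 0 t s]].
pose v t := sup (A t).
have part_rcons t u s : t < u -> itv_partition 0 t s -> itv_partition 0 u (rcons s u).
  move=> tu [ps /eqP ls]; split; last by rewrite last_rcons.
  by rewrite rcons_path ps ls.
have A0 t : 0 <= t -> A t !=set0.
  rewrite le_eqVlt => /orP[/eqP <-|t0].
    by exists (polygon_length h 0 [::]); exists [::] => //; split.
  by exists (polygon_length h 0 [:: t]); exists [:: t] => //; exact: itv_partition1.
have Aub t : 0 <= t -> t <= 1 -> ubound (A t) c.
  move=> t0; rewrite le_eqVlt => /orP[/eqP -> _ [s hs <-]|t1 _ [s hs <-]]; first exact: hc.
  apply: le_trans (hc _ (part_rcons _ _ _ t1 hs)).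
  by rewrite polygon_length_rcons lerDl normc_ge0.
have As t : 0 <= t -> t <= 1 -> has_sup (A t).
  by move=> t0 t1; split; [exact: A0|exists c; exact: Aub].
exists v; split.
  move=> t u t0; rewrite le_eqVlt => /orP[/eqP ->|tu u1].
    by move=> _; rewrite !subrr Normc.normc0.
  have u0 : 0 <= u by apply: le_trans t0 (ltW tu).
  have t1 : t <= 1 by apply: le_trans (ltW tu) u1.
  suff : v t <= v u - normc (h u - h t) by lra.
  apply: ge_sup; first exact: A0.
  move=> _ [s hs <-].
  have /(sup_upper_bound (As _ u0 u1)) : A u (polygon_length h 0 (rcons s u)).
    by exists (rcons s u) => //; exact: part_rcons hs.
  rewrite -/(v u) polygon_length_rcons.
  case: hs => _ /eqP ->; lra.
have v0 : 0 <= v 0.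
  apply: sup_upper_bound; first exact: As.
  by exists [::]; [split|rewrite /polygon_length big_nil].
have v1 : v 1 <= c by apply: ge_sup; [exact: A0|exact: Aub].
lra.
Qed.

End PathLength.

(** * The log-Riemann surface *)

Section PlaneDomain.
Variable R : realType.
Local Notation C := (Cplx R).
Variables (A : set C) (F dF : C -> C).
Hypothesis A_open : forall x, A x -> exists2 r : R, 0 < r & forall z, normc (z - x) < r -> A z.
Variable x0 : set_type A.

Definition to_domain (z : C) : set_type A :=
  if pselect (A z) is left h then exist _ z (mem_set h) else x0.

Lemma to_domainK z : A z -> set_val (to_domain z) = z.
Proof. by rewrite /to_domain; case: pselect. Qed.

Lemma set_valP (x : set_type A) : A (set_val x).
Proof. by case: x => z h; exact: set_mem. Qed.

Lemma set_val_inj (x y : set_type A) : set_val x = set_val y -> x = y.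
Proof. exact: val_inj. Qed.

Lemma val_to_domain (x : set_type A) : to_domain (set_val x) = x.
Proof. by apply: set_val_inj; rewrite to_domainK //; exact: set_valP. Qed.

Lemma nbhs_domainP (x : set_type A) (U : set (set_type A)) :
  nbhs x U <-> exists2 e : R, 0 < e &
    forall y : set_type A, normc (set_val y - set_val x) < e -> U y.
Proof.
split=> [|[e e0 H]].
  rewrite nbhsE => -[B [[W oW WB] Bx] BU].
  have : nbhs (set_val x : C) W.
    by apply: open_nbhs_nbhs; split => //; have : (set_val @^-1` W) x by rewrite WB.
  move=> /nbhs_CplxP[e e0 He]; exists e => // y hy.
  by apply: BU; rewrite -WB; exact: He.
have h : nbhs (set_val x : C) [set w : C | normc (w - set_val x) < e].
  by apply/nbhs_CplxP; exists e.
have k : nbhs x ((set_val : set_type A -> C) @^-1` [set w : C | normc (w - set_val x) < e]).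
  exact: (@initial_continuous _ _ (set_val : set_type A -> C) x _ h).
by apply: filterS k => y; exact: H.
Qed.

Lemma open_domain : open A.
Proof.
rewrite openE => x Ax; have [r r0 Hr] := A_open Ax.
by apply/nbhs_CplxP; exists r.
Qed.

Lemma range_set_val : range (set_val : set_type A -> C) = A.
Proof.
apply/seteqP; split=> [_ [x _ <-]|z Az]; first exact: set_valP.
by exists (to_domain z) => //; exact: to_domainK.
Qed.

Lemma continuous_set_val : continuous (set_val : set_type A -> C).
Proof. exact: initial_continuous. Qed.

Lemma continuous_to_domain z : A z -> {for z, continuous to_domain}.
Proof.
move=> Az U /nbhs_domainP[e e0 He]; have [r r0 Hr] := A_open Az.
apply/nbhs_CplxP; exists (Num.min r e); first by rewrite lt_min r0.
move=> w; rewrite lt_min => /andP[/Hr Aw hw]; apply: He.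
by rewrite !to_domainK.
Qed.

Lemma open_range_domain : open ((set_val : set_type A -> C) @` setT).
Proof. by rewrite range_set_val; exact: open_domain. Qed.

Lemma domain_homeo : homeo_on setT ((set_val : set_type A -> C) @` setT) set_val to_domain.
Proof.
split => //.
- by apply: continuous_subspaceT; exact: continuous_set_val.
- rewrite range_set_val; apply: continuous_in_subspaceT => z /set_mem.
  exact: continuous_to_domain.
- by move=> x _; exact: val_to_domain.
Qed.

Definition domain_chart : chart R (set_type A) :=
  Chart openT open_range_domain domain_homeo.

Lemma domain_compat (c c' : chart R (set_type A)) :
  [set domain_chart] c -> [set domain_chart] c' ->
  forall x, chart_dom c x -> chart_dom c' x ->
    derivable (chart_map c' \o chart_inv c : C -> C) (chart_map c x) 1.
Proof.
move=> -> -> x _ _ /=; have [r r0 Hr] := A_open (set_valP x).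
apply: (derivable_Cplx (c := 1)); apply: cder_eq (cder_id _).
by exists r => // w /Hr Aw; rewrite /= to_domainK.
Qed.

Lemma domain_hausdorff : hausdorff_space (set_type A).
Proof.
move=> x y xy; apply: set_val_inj; apply: (@norm_hausdorff _ C) => U V Ux Vy.
have [z [zU zV]] := xy _ _ (continuous_set_val Ux) (continuous_set_val Vy).
by exists (set_val z).
Qed.

Hypothesis A_connected : connected [set: set_type A].

Definition domain_surface : riemann_surface R :=
  @RiemannSurface R (set_type A) (ex_intro _ x0 I) A_connected domain_hausdorff
    [set domain_chart] (fun x => ex_intro2 _ _ domain_chart erefl I) domain_compat.

Hypothesis F_der : forall z, cder F z (dF z).
Hypothesis dF_cont : forall z, ccont dF z.
Hypothesis dF_neq0 : forall z, A z -> dF z != 0.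

Lemma domain_near_linear z : A z -> exists r : R, [/\ 0 < r,
  forall w, normc (w - z) < r -> A w &
  forall w, normc (w - z) < r -> cder F w (dF w) /\ normc (dF w - dF z) <= normc (dF z) / 2].
Proof.
move=> Az; have [r r0 Hr] := A_open Az.
have [s s0 Hs] := locally_near_linear F_der (dF_cont z) (dF_neq0 Az).
exists (Num.min r s); split; first by rewrite lt_min r0.
- by move=> w; rewrite lt_min => /andP[/Hr].
- by move=> w; rewrite lt_min => /andP[_ /Hs].
Qed.

Definition domain_map (x : domain_surface) : complex_plane R := F (set_val x).

Lemma domain_map_holomorphic : holomorphic domain_map.
Proof.
move=> p; split.
  apply: continuous_comp; first exact: continuous_set_val.
  by apply/continuous_CplxP; exact: cder_cont (F_der _).
move=> c c' -> -> _ _ /=; have [r r0 Hr] := A_open (set_valP p).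
apply: derivable_Cplx; apply: cder_eq (F_der _).
by exists r => // w /Hr Aw; rewrite /= /domain_map /= to_domainK.
Qed.

Lemma domain_map_local_diffeo : holomorphic_local_diffeo domain_map.
Proof.
split; first exact: domain_map_holomorphic.
move=> p; have [r [r0 rA nl]] := domain_near_linear (set_valP p).
set z := set_val p in rA nl; have dz := dF_neq0 (set_valP p); rewrite -/z in dz.
have [g [g1 g2 g3]] := near_linear_inverse dz nl r0.
set e := normc (dF z) / 2 * r in g1 g2 g3.
have e0 : 0 < e by rewrite mulr_gt0 // divr_gt0 // normc_gt0.
(* The second condition makes the image of [U] exactly the disk on which the inverse [g] is
   defined. *)
pose U := [set q : domain_surface | normc (set_val q - z) < r /\ normc (F (set_val q) - F z) < e].
have imU : domain_map @` U = [set b : C | normc (b - F z) < e].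
  apply/seteqP; split=> [_ [q [_ h] <-] //|b /= hb].
  have [h1 h2] := g1 _ hb; exists (to_domain (g b)).
    by rewrite /U /= to_domainK ?h2 //; exact: rA.
  by rewrite /domain_map to_domainK //; exact: rA.
have gA b : normc (b - F z) < e -> A (g b) by move=> /g1 [/rA].
pose G : complex_plane R -> domain_surface := to_domain \o g.
have cg (b : C) : normc (b - F z) < e -> {for b, continuous (G : C -> set_type A)}.
  move=> hb; apply: continuous_comp; first by apply/continuous_CplxP; exact: cder_cont (g3 _ hb).
  exact: continuous_to_domain (gA _ hb).
have oball : open [set b : C | normc (b - F z) < e].
  rewrite openE => b /= hb; apply/nbhs_CplxP; exists (e - normc (b - F z)); first by rewrite subr_gt0.
  by move=> w hw; have := ler_normc_dist w b (F z); rewrite /=; lra.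
exists U, G; split.
- split.
    rewrite openE => q [/= h1 h2]; apply/nbhs_domainP.
    have e2 : 0 < e - normc (F (set_val q) - F z) by rewrite subr_gt0.
    have [s s0 Hs] := cder_cont (F_der (set_val q)) e2.
    exists (Num.min s (r - normc (set_val q - z))); first by rewrite lt_min s0 subr_gt0.
    move=> y; rewrite lt_min => /andP[/Hs k1 k2]; split.
      by have := ler_normc_dist (set_val y) (set_val q) z; lra.
    by have := ler_normc_dist (F (set_val y)) (F (set_val q)) (F z); lra.
  by split; rewrite subrr Normc.normc0.
- by rewrite imU.
- split => //.
  + apply: continuous_subspaceT => q.
    by have [] := domain_map_holomorphic q.
  + by rewrite imU; apply: continuous_in_subspaceT => b /set_mem; exact: cg.
  + by move=> q [h1 h2]; rewrite /G /= /domain_map g2 // val_to_domain.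
- rewrite imU => b hb; split; first exact: cg.
  move=> c c' -> -> _ _ /=.
  apply: derivable_Cplx; apply: cder_eq (g3 _ hb).
  have e2 : 0 < e - normc (b - F z) by rewrite subr_gt0.
  exists (e - normc (b - F z)) => // w hw.
  rewrite /= to_domainK //; apply: gA.
  by have := ler_normc_dist w b (F z); lra.
Qed.

Lemma domain_inclusion_holomorphic : holomorphic (set_val : domain_surface -> complex_plane R).
Proof.
move=> p; split; first exact: continuous_set_val.
move=> c c' -> -> _ _ /=; have [r r0 Hr] := A_open (set_valP p).
apply: (derivable_Cplx (c := 1)); apply: cder_eq (cder_id _).
by exists r => // w /Hr Aw; rewrite /= to_domainK.
Qed.

End PlaneDomain.

(** * The path distance on a plane domain *)

Section DomainPaths.
Variable R : realType.
Local Notation C := (Cplx R).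
Variables (A : set C) (F : C -> C).
Hypothesis A_open : forall x, A x -> exists2 r : R, 0 < r & forall z, normc (z - x) < r -> A z.
Variable x0 : set_type A.
Local Notation joined := (joined F A).

Lemma within_unitP (g : R -> set_type A) : {within `[0, 1], continuous g} <->
  forall t : R, 0 <= t -> t <= 1 -> forall e, 0 < e -> exists2 r : R, 0 < r &
    forall u, 0 <= u -> u <= 1 -> `|u - t| < r -> normc (set_val (g u) - set_val (g t)) < e.
Proof.
rewrite subspace_continuousP; split=> [H t t0 t1 e e0|H t].
  have tI : `[0, 1]%classic t by rewrite /= in_itv /= t0 t1.
  have : nbhs (g t) [set y : set_type A | normc (set_val y - set_val (g t)) < e].
    by apply/nbhs_domainP => //; exists e.
  move=> /(H t tI); rewrite /= => /nbhs_ballP[r /= r0 Hr]; exists r => // u u0 u1 ut.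
  apply: (Hr u); first by rewrite /ball /= distrC.
  by rewrite /= in_itv /= u0 u1.
rewrite /= in_itv /= => /andP[t0 t1] U /nbhs_domainP[e e0 He].
have [r r0 Hr] := H t t0 t1 e e0.
apply/nbhs_ballP; exists r => // u; rewrite /ball /= distrC => ut.
by rewrite in_itv /= => /andP[u0 u1]; apply/He/Hr.
Qed.

Lemma cpath_within (g : R -> C) : cpath A g ->
  {within `[0, 1], continuous (to_domain x0 \o g : R -> set_type A)}.
Proof.
move=> gp; apply/within_unitP => t t0 t1 e e0.
have [Ag /(_ e e0) [r r0 Hr]] := gp t t0 t1; exists r => // u u0 u1 ut.
rewrite /= !to_domainK //; first exact: Hr.
by have [] := gp u u0 u1.
Qed.

Lemma domain_connected : (forall x y, A x -> A y -> exists c, joined c x y) ->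
  connected [set: set_type A].
Proof.
move=> Aj.
have path_ex (y : set_type A) : exists g : R -> C,
    [/\ cpath A g, g 0 = set_val x0 & g 1 = set_val y].
  have [c [g [v [h1 _ h3 h4 _]]]] := Aj _ _ (set_valP x0) (set_valP y).
  by exists g.
have [g Hg] := choice path_ex.
have -> : [set: set_type A] =
    \bigcup_(y in [set: set_type A]) ((to_domain x0 \o g y) @` `[0, 1]).
  apply/seteqP; split => // y _; exists y => //; exists 1 => /=.
    by rewrite in_itv /= ler01 lexx.
  by have [_ _ ->] := Hg y; exact: val_to_domain.
apply: bigcup_connected.
  exists x0 => y _; exists 0; first by rewrite /= in_itv /= lexx ler01.
  by have [_ h _] := Hg y; rewrite /= h val_to_domain.
move=> y _; apply: connected_continuous_connected; first exact: segment_connected.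
by have [h _ _] := Hg y; exact: cpath_within.
Qed.

Local Notation pi := (fun x : set_type A => F (set_val x)).

Lemma path_length_polygon (gamma : R -> set_type A) :
  path_length pi gamma = ereal_sup [set (polygon_length (pi \o gamma) 0 s)%:E |
    s in [set s : seq R | itv_partition 0 1 s]].
Proof. by rewrite /path_length; congr ereal_sup; apply: eq_imagel => s _; rewrite sumEFin. Qed.

Lemma joined_path_dist c (x y : set_type A) : joined c (set_val x) (set_val y) ->
  (path_dist pi x y <= c%:E)%E.
Proof.
move=> [g [v [gp gv g0 g1 vc]]].
have Ag t : 0 <= t -> t <= 1 -> set_val (to_domain x0 (g t)) = g t.
  by move=> t0 t1; rewrite to_domainK //; have [] := gp t t0 t1.
apply: (@le_trans _ _ (path_length pi (to_domain x0 \o g))).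
  apply: ereal_inf_lbound; exists (to_domain x0 \o g) => //; split; first exact: cpath_within.
  - by rewrite /= g0 val_to_domain.
  - by rewrite /= g1 val_to_domain.
rewrite path_length_polygon; apply: ge_ereal_sup => _ [s [hs /eqP ls] <-].
rewrite lee_fin; apply: le_trans vc.
have := @polygon_length_le R (pi \o (to_domain x0 \o g)) v 0 s hs (lexx _).
rewrite ls; apply => // t u t0 tu u1 /=.
have u0 : 0 <= u := le_trans t0 tu; have t1 : t <= 1 := le_trans tu u1.
by rewrite !Ag //; exact: gv.
Qed.

Lemma path_length_joined c (x y : set_type A) (gamma : R -> set_type A) :
  {within `[0, 1], continuous gamma} -> gamma 0 = x -> gamma 1 = y ->
  (path_length pi gamma <= c%:E)%E -> joined c (set_val x) (set_val y).
Proof.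
move=> gc <- <- hl.
have [v [v1 v2]] : exists v, (forall t u, 0 <= t -> t <= u -> u <= 1 ->
    normc ((pi \o gamma) u - (pi \o gamma) t) <= v u - v t) /\ v 1 - v 0 <= c.
  apply: polygon_control => s hs; rewrite -lee_fin; apply: le_trans hl.
  by rewrite path_length_polygon; apply: ereal_sup_ubound; exists s.
exists (set_val \o gamma), v; split => //.
move=> t t0 t1; split; first exact: set_valP.
exact: (iffLR (within_unitP gamma) gc t t0 t1).
Qed.

Lemma path_length_ge0 (gamma : R -> set_type A) : (0 <= path_length pi gamma)%E.
Proof.
rewrite path_length_polygon; apply: (@le_trans _ _ (polygon_length (pi \o gamma) 0 [:: 1])%:E).
  by rewrite lee_fin /polygon_length /= big_nat1 normc_ge0.
by apply: ereal_sup_ubound; exists [:: 1] => //; exact: itv_partition1.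
Qed.

End DomainPaths.

(** * The surface and its metric completion *)

Section LogSurface.
Variables (R : realType) (X : end_system R).
Local Notation C := (Cplx R).
Local Notation F := (es_F X).
Local Notation d := (es_ends X).
Local Notation Y := (R[i] + 'I_d)%type.
Local Notation a := (es_a X).
Local Notation psi := (es_psi X).
Local Notation dist := (@end_dist R X).

Definition regular_set : set C := es_dom X.
Local Notation A := regular_set.
Variable x0 : set_type A.

Lemma regular_connected : connected [set: set_type A].
Proof. exact: domain_connected x0 (@es_dom_joined R X). Qed.

Definition log_surface : riemann_surface R :=
  domain_surface (@es_dom_open R X) x0 regular_connected.

Definition log_pi : log_surface -> complex_plane R := fun x => F (set_val x).

Lemma log_pi_local_diffeo : holomorphic_local_diffeo log_pi.
Proof.
exact: (@domain_map_local_diffeo R A F (es_dF X) (@es_dom_open R X) x0 regular_connected (es_F_der X)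
  (es_dF_cont X) (@es_dF_neq0 R X)).
Qed.

Definition end_space : metricType R := metric_of (@end_distxx R X)
  (@end_dist_eq0 R X) (@end_dist_sym R X) (@end_dist_triangle R X).

Definition log_embed (x : log_surface) : end_space := inl (set_val x).

Lemma log_isometry (x y : log_surface) :
  (mdist (log_embed x) (log_embed y))%:E = path_dist log_pi x y.
Proof.
rewrite metric_ofE; apply/le_anti/andP; split.
- apply: le_ereal_inf_tmp => _ [gamma [g1 g2 g3] <-].
  have := path_length_ge0 F gamma.
  rewrite -/(path_length log_pi gamma).
  case E : (path_length log_pi gamma) => [c| |] // _; last by rewrite leey.
  rewrite lee_fin; apply: end_dist_le.
  apply/(end_near_inl c (set_valP x) (set_valP y)) => e e0.
  apply: (joined_le (c := c)); first by rewrite lerDl ltW.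
  by apply: (path_length_joined g1 g2 g3); rewrite -E.
- apply/lee_addgt0Pr => e e0; rewrite -EFinD.
  apply: (joined_path_dist x0).
  exact: (iffLR (end_near_inl _ (set_valP x) (set_valP y)) (end_near_dist _ _) _ e0).
Qed.

Lemma log_dense : dense (range log_embed).
Proof.
move=> O [y Oy] oO.
have /nbhs_metric_of[e e0 He] : nbhs (y : end_space) O by exact: open_nbhs_nbhs.
have [s [s1 s2]] := exists_deep_expR y e0.
have [Ss _ _] := es_psiP s1.
exists (inl (psi y s)); split; first by apply: He; exact: end_ball_psi.
by exists (to_domain x0 (psi y s)) => //; rewrite /log_embed to_domainK.
Qed.

(** The filter is replaced by regular points x n close to the centres y n of balls of [G] of radius
    q n. A point near which x n returns infinitely often, as given by [end_complete], is the limit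
    of [G]. *)
Lemma log_complete (G : set_system end_space) : ProperFilter G -> cauchy G ->
  exists p : end_space, G --> p.
Proof.
move=> PG /cauchyP cG.
have [q [q0 small]] : exists q : nat -> R, (forall n, 0 < q n) /\
    forall e, 0 < e -> exists N, forall n, (N <= n)%N -> q n < e.
  exists (fun n => n.+1%:R^-1); split=> [n|e e0]; first by rewrite invr_gt0 ltr0n.
  have [N HN] := exists_nat_gt e^-1; exists N => n Nn.
  rewrite -[ltRHS]invrK ltf_pV2 ?posrE ?ltr0n ?invr_gt0 //.
  by apply: (lt_le_trans HN); rewrite ler_nat leqW.
have yex n : exists y : end_space, G (ball y (q n)) by apply: cG.
have [y Hy] := choice yex.
have xex n : exists x : C, A x /\ dist (y n) (inl x) < q n.
  have [s [s1 s2]] := exists_deep_expR (y n) (q0 n); have [Ss _ _] := es_psiP s1.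
  by exists (psi (y n) s); split => //; exact: end_ball_psi.
have [x Hx] := choice xex.
have yy n k : dist (y n) (y k) < q n + q k.
  have [z [/= h1 h2]] := filter_ex (filterI (Hy n) (Hy k)).
  move: h1 h2; rewrite !ballEmdist /= !metric_ofE => h1 h2.
  by apply: le_lt_trans (end_dist_triangle z _ _) _; rewrite (end_dist_sym z) ltrD.
have xx n k : dist (inl (x n)) (inl (x k)) < 2 * q n + 2 * q k.
  have [_ h1] := Hx n; have [_ h2] := Hx k; have h3 := yy n k.
  have := end_dist_triangle (y n) (inl (x n)) (inl (x k)).
  have := end_dist_triangle (y k) (y n) (inl (x k)).
  rewrite (end_dist_sym (inl (x n)) (y n)); lra.
have Sx n : es_dom X (x n) by have [] := Hx n.
have Cx e : 0 < e -> exists N, forall n k, (N <= n)%N -> (N <= k)%N ->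
    joined F (es_dom X) e (x n) (x k).
  move=> e0; have e8 : 0 < e / 8 by rewrite divr_gt0.
  have [N HN] := small _ e8; exists N => n k Nn Nk.
  have h : dist (inl (x n)) (inl (x k)) + e / 2 <= e.
    have := xx n k; have := HN n Nn; have := HN k Nk; lra.
  apply: joined_le h _.
  apply: (iffLR (end_near_inl _ (Sx n) (Sx k)) (end_near_dist (inl (x n)) (inl (x k)))).
  by rewrite divr_gt0.
have [z Hz] := end_complete Sx Cx.
exists (z : end_space) => U /nbhs_metric_of[e e0 He].
have e8 : 0 < e / 8 by rewrite divr_gt0.
have [N HN] := small _ e8.
have [n Nn zn] := Hz _ e8 N.
apply: filterS (Hy n) => u; rewrite ballEmdist /= metric_ofE => yu; apply: He.
have [An h1] := Hx n.
have h2 : dist z (inl (x n)) <= e / 8 by apply: end_dist_le; exact: end_nbhd_near.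
have h3 := HN n Nn.
have := end_dist_triangle (inl (x n)) z u.
have := end_dist_triangle (y n) (inl (x n)) u.
rewrite (end_dist_sym (inl (x n)) (y n)); lra.
Qed.

Definition log_completion : metric_completion (path_dist log_pi) :=
  MetricCompletion log_isometry log_dense log_complete.

Definition singular_points : seq Y := map inl (es_sing X) ++ map inr (enum 'I_d).

Lemma range_embedC (y : end_space) : (~` range log_embed) y <-> (y : Y) \in singular_points.
Proof.
rewrite /singular_points mem_cat; split=> [h|].
  case: y h => [p|j] h; apply/orP; last by right; rewrite map_f // mem_enum.
  left; apply: map_f; apply: contrapT => /negP pS; apply: h.
  by exists (to_domain x0 p) => //; rewrite /log_embed to_domainK.
move=> + [x _ xy]; rewrite -xy /log_embed => /orP[/mapP[p pS [xp]]|/mapP[j _] //].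
by have := set_valP x; rewrite /regular_set /es_dom xp pS.
Qed.

Lemma isolated_ball (y : Y) : exists2 r : R, 0 < r & forall y', y' \in singular_points ->
  dist y y' < r -> y' = y.
Proof.
elim: singular_points => [|q Z [r r0 Hr]]; first by exists 1.
have [->|qp] := eqVneq q y.
  by exists r => // z; rewrite in_cons => /orP[/eqP ->|/Hr].
have Dq : 0 < dist y q.
  rewrite lt_neqAle (end_near_ge0 (end_near_dist y q)) andbT eq_sym.
  by apply: contra_neq qp => /end_dist_eq0.
exists (Num.min r (dist y q)); first by rewrite lt_min r0.
move=> z; rewrite in_cons lt_min => /orP[/eqP ->|/Hr h] /andP[h1 h2]; last exact: h.
by rewrite ltxx in h2.
Qed.

Lemma log_discrete : ~` range log_embed `<=` isolated (~` range log_embed).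
Proof.
move=> y hy; split; first exact: mem_set.
have [r r0 Hr] := isolated_ball y.
exists [set y' : end_space | dist y y' < r]; first by apply/nbhs_metric_of; exists r.
apply/seteqP; split=> [y' [h /range_embedC h']|_ ->]; first exact: Hr.
by split => //=; rewrite end_distxx.
Qed.

Lemma log_pi_star_continuous : continuous (a : end_space -> C).
Proof.
move=> y U /nbhs_CplxP[e e0 He]; apply/nbhs_metric_of; exists e => // y' h.
by apply: He; apply: le_lt_trans h; rewrite end_dist_sym; exact: end_dist_a.
Qed.

Lemma log_pi_starE (x : log_surface) : a (log_embed x) = log_pi x.
Proof. exact: es_a_inl. Qed.

Definition log_lrs : log_riemann_surface R :=
  @LogRiemannSurface R log_surface log_pi log_pi_local_diffeo log_completion
    log_discrete a log_pi_star_continuous log_pi_starE.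

End LogSurface.

(** * Ramification orders *)

Section RamificationChart.
Variables (R : realType) (X : end_system R).
Local Notation C := (Cplx R).
Local Notation cexp := (@cexpi R).
Local Notation tpi := (@ctwopi_i R).
Local Notation F := (es_F X).
Local Notation d := (es_ends X).
Local Notation Y := (R[i] + 'I_d)%type.
Local Notation a := (es_a X).
Local Notation m := (es_m X).
Local Notation psi := (es_psi X).
Local Notation s0 := (es_s0 X).
Local Notation A := (regular_set X).
Variable x0 : set_type A.
Local Notation pi := (@log_pi R X x0).

Variables (y : Y) (rho : R).
Hypothesis rho_gt0 : 0 < rho.
Hypothesis rho_le : rho <= expR (s0 y).

Definition in_half_plane (s : R[i]) := expR (complex.Re s) < rho.
Local Notation H := in_half_plane.

Definition psi_dom (s : R[i]) : set_type A := to_domain x0 (psi y s).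

Lemma half_plane_lt s : H s -> complex.Re s < s0 y.
Proof. by move=> h; rewrite -ltr_expR; exact: lt_le_trans rho_le. Qed.

Lemma psi_domE s : H s -> set_val (psi_dom s) = psi y s.
Proof. by move=> /half_plane_lt/es_psiP [h _ _]; exact: to_domainK. Qed.

Lemma pi_psi_dom s : H s -> F (set_val (psi_dom s)) = a y + cexp s.
Proof. by move=> h; rewrite psi_domE //; have [] := es_psiP (half_plane_lt h). Qed.

Lemma psi_dom_eq s s' : H s -> H s' ->
  psi_dom s = psi_dom s' <-> exists n : int, s' = s + (n *+ m y)%:~R * tpi.
Proof.
move=> h h'; have [_ P] := es_chart X y.
rewrite -(P s s' (half_plane_lt h) (half_plane_lt h')).
by split=> [e|e]; [rewrite -!psi_domE // e|rewrite /psi_dom e].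
Qed.

Lemma continuous_psi_dom s : H s -> {for (s : C), continuous (psi_dom : C -> set_type A)}.
Proof.
move=> h; have [hA _ hc] := es_psiP (half_plane_lt h).
apply: (@continuous_comp C C (set_type A) (psi y) (to_domain x0)).
  exact/continuous_CplxP.
exact: (@continuous_to_domain R A (@es_dom_open R X) x0 _ hA).
Qed.

Definition chart_image : set (set_type A) := [set x | exists2 s, H s & psi_dom s = x].
Local Notation V := chart_image.
Local Notation W := (punctured_disk (a y) rho).

Lemma half_plane_log (w : C) : W w -> exists2 s, H s & cexp s = w - a y.
Proof.
move=> /andP[w1 w2]; have [s hs] : exists s, cexp s = w - a y.
  by apply: cexp_surj; rewrite -normc_gt0.
by exists s => //; rewrite /in_half_plane -normc_cexp hs.
Qed.

Lemma half_plane_shift s (z : R[i]) : complex.Re z = 0 -> H s -> H (s + z).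
Proof. by move=> z0; rewrite /in_half_plane raddfD /= z0 addr0. Qed.

Lemma psi_dom_W s : H s -> W (F (set_val (psi_dom s))).
Proof.
move=> h; rewrite pi_psi_dom // /punctured_disk /= addrAC subrr add0r normc_cexp.
by rewrite expR_gt0.
Qed.

Lemma chart_image_connected : connected V.
Proof.
pose sb : R[i] := (ln rho - 1)%:C.
have hb : H sb by rewrite /in_half_plane -[ltRHS]lnK ?posrE // ltr_expR /=; lra.
pose g s (t : R) := psi y (sb + t%:C * (s - sb)).
have seg s t : H s -> 0 <= t -> t <= 1 -> H (sb + t%:C * (s - sb)).
  move=> hs t0 t1; rewrite /in_half_plane -[ltRHS]lnK ?posrE // ltr_expR.
  have hs' : complex.Re s < ln rho by rewrite -ltr_expR lnK ?posrE.
  rewrite raddfD /= Re_mul_real raddfB /=.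
  have [->|tn0] := eqVneq t 0; first by lra.
  have tp : 0 < t by rewrite lt_neqAle eq_sym tn0.
  nra.
have -> : V = \bigcup_(s in [set s | H s]) ((to_domain x0 \o g s) @` `[0, 1]).
  apply/seteqP; split=> [x [s hs <-]|x [s /= hs [t]]].
    exists s => //; exists 1; first by rewrite /= in_itv /= ler01 lexx.
    by rewrite /psi_dom /g /=; congr (to_domain _ (psi y _)); rewrite mul1r addrC subrK.
  by rewrite /= in_itv /= => /andP[t0 t1] <-; exists (sb + t%:C * (s - sb)) => //; exact: seg.
apply: bigcup_connected.
  exists (psi_dom sb) => s hs; exists 0; first by rewrite /= in_itv /= lexx ler01.
  by rewrite /psi_dom /g /=; congr (to_domain _ (psi y _)); rewrite mul0r addr0.
move=> s hs; apply: connected_continuous_connected; first exact: segment_connected.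
by apply: cpath_within; apply: psi_cpath; exact: half_plane_lt.
Qed.

Lemma chart_image_fiber (w : C) s : H s -> cexp s = w - a y ->
  V `&` pi @^-1` [set w] = [set x | exists n : int, psi_dom (s + n%:~R * tpi) = x].
Proof.
move=> hs es; apply/seteqP; split=> [x [[t ht <-] /= xw]|x [n <-]].
  have : cexp t = cexp s by rewrite es -xw /log_pi pi_psi_dom // addrAC subrr add0r.
  by move=> /cexp_eq [n ->]; exists n.
have hn := half_plane_shift (Re_tpi R n) hs.
split; first by exists (s + n%:~R * tpi).
by rewrite /= /log_pi pi_psi_dom // cexp_periodic es addrC subrK.
Qed.

(** The fibre is the orbit of one logarithm under translation by 2 pi i, modulo the periods 2 pi i
    m: the integers modulo m, infinite for m = 0. *)
Lemma chart_image_degree : covering_degree V W pi (if m y == 0%N then None else Some (m y)).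
Proof.
move=> w Ww; have [s hs es] := half_plane_log Ww.
rewrite (chart_image_fiber hs es).
have inj n k : psi_dom (s + n%:~R * tpi) = psi_dom (s + k%:~R * tpi) <->
    exists l : int, k = n + l *+ m y.
  rewrite psi_dom_eq; try exact: half_plane_shift (Re_tpi R _) hs.
  split=> [[l hl]|[l ->]]; exists l; last by rewrite rmorphD; ring.
  have : k%:~R * tpi = (n + l *+ m y)%:~R * tpi.
    by apply: (addrI s); rewrite hl rmorphD; ring.
  by move=> /(mulIf (tpi_neq0 R))/intr_inj.
have [m0|m0] := eqVneq (m y) 0%N; rewrite ?m0 ?eqxx ?(negPf m0).
  move=> fin; have : finite_set [set: nat].
    pose f (n : nat) := psi_dom (s + (n%:Z)%:~R * tpi).
    have finj : {in [set: nat] &, injective f}.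
      move=> n k _ _ /inj [l]; rewrite m0 mulr0n addr0 => -[] //.
    rewrite -(eq_finite_set (inj_card_eq finj)).
    by apply: sub_finite_set fin => x [n _ <-]; exists n%:Z.
  exact: infinite_nat.
pose f (n : nat) := psi_dom (s + (n%:Z)%:~R * tpi).
have mz : (m y)%:Z != 0 by rewrite eqz_nat.
have finj : {in `I_(m y) &, injective f}.
  move=> n k /set_mem /= hn /set_mem /= hk /inj [l hl].
  have : ((k%:Z %% (m y)%:Z)%Z = (n%:Z %% (m y)%:Z)%Z).
    by rewrite hl -mulr_natr natz addrC modzMDl.
  by rewrite !modz_small ?ltz_nat ?lez_nat // => -[].
suff -> : [set x | exists n : int, psi_dom (s + n%:~R * tpi) = x] = f @` `I_(m y).
  exact: inj_card_eq.
apply/seteqP; split=> [x [n <-]|x [n _ <-]]; last by exists n%:Z.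
exists `|(n %% (m y)%:Z)%Z|%N.
  by rewrite /= -ltz_nat gez0_abs ?modz_ge0 // ltz_pmod // ltz_nat lt0n.
rewrite /f gez0_abs ?modz_ge0 //; apply/inj; exists (n %/ (m y)%:Z)%Z.
by rewrite {1}(divz_eq n (m y)%:Z) addrC -mulr_natr natz.
Qed.

(** Over a disk that avoids a y there is a branch of log(o - a y). The sheets are the images under
    the chart of its translates by 2 pi i k; they coincide if the k agree modulo m and are disjoint
    otherwise. *)
Lemma chart_image_covering : covering V W pi.
Proof.
have pi_cont : continuous (pi : set_type A -> C).
  move=> x; apply: continuous_comp; first exact: continuous_set_val.
  by apply/continuous_CplxP; exact: es_F_cont.
split.
- apply/seteqP; split=> [_ [x [s hs <-] <-]|w Ww]; first exact: psi_dom_W.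
  have [s hs es] := half_plane_log Ww.
  exists (psi_dom s); first by exists s.
  by rewrite /log_pi pi_psi_dom // es addrC subrK.
- by apply: continuous_subspaceT; exact: pi_cont.
move=> b Wb; have [sb hsb esb] := half_plane_log Wb.
have /andP[b1 b2] := Wb.
have ba : b - a y != 0 by rewrite -normc_gt0.
pose e := Num.min (normc (b - a y)) (rho - normc (b - a y)).
have e0 : 0 < e by rewrite lt_min b1 subr_gt0.
pose O := [set o : C | normc (o - b) < e].
have OW o : O o -> [/\ W o, normc (o - b) < normc (b - a y) & slit ((o - a y) / (b - a y))].
  rewrite /O /= lt_min => /andP[q1 q2]; split => //.
    have := ler_normc_dist o b (a y); have := ler_normc_dist b o (a y); rewrite (normcB b o).
    by rewrite /punctured_disk /=; move=> *; apply/andP; split; lra.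
  apply: slit_near1.
  have -> : (o - a y) / (b - a y) - 1 = (o - b) / (b - a y) by field.
  by rewrite Normc.normcM Normc.normcV ltr_pdivrMr // mul1r.
pose lg o := sb + Log ((o - a y) / (b - a y)).
have lgE o : O o -> cexp (lg o) = o - a y.
  move=> /OW [_ _ sl]; have [_ Le] := LogP sl.
  by rewrite /lg cexpD Le esb mulrC divfK.
have lgH o : O o -> H (lg o).
  by move=> Oo; have [/andP[_ h] _ _] := OW _ Oo; rewrite /in_half_plane -normc_cexp lgE.
have lg_cont o : O o -> ccont lg o.
  move=> /OW [_ _ sl].
  have ld := cder_Log sl; rewrite [_ / _]mulrC in ld.
  have := cder_comp (cderZ (b - a y)^-1 (cderD (cder_id o) (cder_cst (- a y) o))) ld.
  move=> /(cderD (cder_cst sb o)) /cder_cont h; apply: (ccont_eq h).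
  by move=> w; rewrite /lg [_^-1 * _]mulrC.
have oO : open O.
  rewrite openE => o /= ho; apply/nbhs_CplxP; exists (e - normc (o - b)); first by rewrite subr_gt0.
  by move=> w hw; have := ler_normc_dist w o b; rewrite /O /=; lra.
exists O; split.
- by split => //; rewrite /O /= subrr Normc.normc0.
- by move=> o /OW [].
pose sec (k : int) (o : C) : set_type A := psi_dom (lg o + k%:~R * tpi).
have secH k o : O o -> H (lg o + k%:~R * tpi).
  by move=> /lgH; exact: half_plane_shift (Re_tpi R k).
have secE k o : O o -> pi (sec k o) = o.
  by move=> Oo; rewrite /log_pi pi_psi_dom ?secH // cexp_periodic lgE // addrC subrK.
pose sheet (k : int) := sec k @` O.
exists (range sheet); split.
- move=> _ _ [k _ <-] [l _ <-] [x [[ o Oo <-] [ o' Oo' e']]].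
  have oo : o' = o by rewrite -(secE l o' Oo') e' secE.
  move: e'; rewrite oo => /psi_dom_eq -/(_ (secH _ _ Oo) (secH _ _ Oo)) [n hn].
  have kl : k = l + n *+ m y.
    have : k%:~R * tpi = (l + n *+ m y)%:~R * tpi.
      by apply: (addrI (lg o)); rewrite hn rmorphD; ring.
    by move=> /(mulIf (tpi_neq0 R))/intr_inj.
  have sk u : O u -> sec l u = sec k u.
    move=> Ou; apply/psi_dom_eq; try exact: secH.
    by exists n; rewrite kl rmorphD; ring.
  by apply/seteqP; split=> [_ [u Ou <-]|_ [u Ou <-]]; exists u; rewrite ?sk.
- apply/seteqP; split=> [x [_ [k _ <-] [ o Oo <-]]|x [[s hs xs] /= Ox]].
    by split; [exists (lg o + k%:~R * tpi) => //; exact: secH|rewrite /= secE].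
  have : cexp s = cexp (lg (pi x)) by rewrite lgE // -xs /log_pi pi_psi_dom // addrAC subrr add0r.
  move=> /cexp_eq [k hk]; exists (sheet k); first by exists k.
  by exists (pi x) => //; rewrite /sec -hk xs.
- move=> _ [k _ <-].
  have sec_cont o : O o -> {for (o : C), continuous (sec k : C -> set_type A)}.
    move=> Oo; have h := secH k _ Oo.
    apply: (@continuous_comp C C (set_type A) (fun o => lg o + k%:~R * tpi) psi_dom).
      apply/continuous_CplxP => r /(lg_cont _ Oo) [r' r'0 H']; exists r' => // w /H'.
      by move: (lg w) (lg o) (k%:~R * tpi) => u v t; rewrite (_ : u + t - (v + t) = u - v) //; ring.
    exact: continuous_psi_dom.
  split.
    (* For x near [sec k o], both x and [sec k (pi x)] lie where [F] is injective and have the same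
       image, so x is on the sheet. *)
    rewrite openE => _ [ o Oo <-].
    have [r r0 Hr] := es_F_inj (set_valP (sec k o)).
    have nb1 : nbhs (sec k o) [set x : set_type A | normc (set_val x - set_val (sec k o)) < r].
      by apply/nbhs_domainP; exists r.
    have nbO : nbhs (pi (sec k o)) O by rewrite secE //; exact: open_nbhs_nbhs.
    have nb2 : nbhs (sec k o) (pi @^-1` (O `&` (sec k) @^-1` [set x : set_type A |
        normc (set_val x - set_val (sec k o)) < r])).
      apply: pi_cont; apply: filterI => //.
      by rewrite secE //; apply: sec_cont.
    apply: filterS (filterI nb1 nb2) => x [/= x1 [x2 x3]].
    exists (pi x) => //; apply: set_val_inj; apply: Hr => //.
    exact: (secE k _ x2).
  exists (sec k); split.
  + apply/seteqP; split=> [_ [_ [ o Oo <-] <-]|o Oo]; first by rewrite secE.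
    by exists (sec k o); [exists o|rewrite secE].
  + by apply: continuous_subspaceT; exact: pi_cont.
  + by apply: continuous_in_subspaceT => o /set_mem; exact: sec_cont.
  + by move=> _ [ o Oo <-]; rewrite secE.
Qed.

End RamificationChart.

Section PathContinuity.
Variables (R : realType) (T : Type) (v : T -> R[i]).

Definition continuous_on_segment (b c : R) (g : R -> T) := forall t, b <= t -> t <= c ->
  forall e, 0 < e -> exists2 r : R, 0 < r & forall u, b <= u -> u <= c -> `|u - t| < r ->
    normc (v (g u) - v (g t)) < e.

Lemma continuous_on_segment_paste b c d (g h : R -> T) : b <= c ->
  continuous_on_segment b c g -> continuous_on_segment c d h -> g c = h c ->
  continuous_on_segment b d (fun t => if t <= c then g t else h t).
Proof.
move=> bc gc hc gh t bt td e e0.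
have [tc|ct|tc] := ltgtP t c.
- have [r r0 Hr] := gc t bt (ltW tc) e e0.
  exists (Num.min r (c - t)); first by rewrite lt_min r0 subr_gt0.
  move=> u bu ud; rewrite lt_min => /andP[u1 u2].
  have uc : u <= c by move: u2; rewrite ltr_norml; lra.
  by rewrite uc; exact: Hr.
- have [r r0 Hr] := hc t (ltW ct) td e e0.
  exists (Num.min r (t - c)); first by rewrite lt_min r0 subr_gt0.
  move=> u bu ud; rewrite lt_min => /andP[u1 u2].
  have uc : c < u by move: u2; rewrite ltr_norml; lra.
  by rewrite leNgt uc; apply: Hr => //; exact: ltW.
- subst t; have [r r0 Hr] := gc c bt (lexx _) e e0; have [r' r'0 Hr'] := hc c (lexx _) td e e0.
  exists (Num.min r r'); first by rewrite lt_min r0.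
  move=> u bu ud; rewrite lt_min => /andP[u1 u2].
  have [uc|cu] := lerP u c; first exact: Hr.
  by rewrite gh; apply: Hr' => //; exact: ltW.
Qed.

End PathContinuity.

(** * Lifting the radial contraction of a punctured disk *)

Section RadialLifting.
Variables (R : realType) (X : end_system R).
Local Notation C := (Cplx R).
Local Notation F := (es_F X).
Local Notation A := (regular_set X).
Local Notation pt := (set_type A).
Variable x0 : pt.
Local Notation pi := (@log_pi R X x0).
Local Notation v := (set_val : pt -> C).
Local Notation path_cont := (continuous_on_segment v).

Variables (V : set pt) (b0 : C) (r0 tau : R).
Hypothesis r0_gt0 : 0 < r0.
Hypothesis V_cov : covering V (punctured_disk b0 r0) pi.
Hypothesis tau_gt0 : 0 < tau.
Hypothesis tau_lt1 : tau < 1.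
Local Notation W := (punctured_disk b0 r0).

(** The radius e depends on w alone and serves every z of [V] over the disk; this is what allows
    lifts to be continued to all times. *)
Lemma covering_section (w : C) : W w -> exists2 e : R, 0 < e & forall z : pt, V z ->
  normc (F (v z) - w) < e -> exists g : C -> pt,
  (forall u, normc (u - w) < e -> [/\ V (g u), F (v (g u)) = u & ccont (fun u => v (g u)) u]) /\
  exists2 r : R, 0 < r & forall z', normc (v z' - v z) < r -> g (F (v z')) = z'.
Proof.
move=> Ww; have [_ _ /(_ _ Ww) [U [[oU Uw] UW [sheets [_ cov sh]]]]] := V_cov.
have /nbhs_CplxP[e e0 He] : nbhs w U by exact: open_nbhs_nbhs.
exists e => // z Vz /He Uz.
have : (V `&` pi @^-1` U) z by [].
rewrite -cov => -[B sB Bz]; have [oB [g [gB1 _ gB2 gB3]]] := sh _ sB.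
exists g; split=> [u /He Uu|].
  have [x Bx xu] : (pi @` B) u by rewrite gB1.
  have gu : g u = x by rewrite -xu gB3.
  have [Vx _] : (V `&` pi @^-1` U) x by rewrite -cov; exists B.
  split; [by rewrite gu|by rewrite gu -xu|].
  apply/continuous_CplxP; apply: (@continuous_comp C pt C g v); last exact: continuous_set_val.
  move: gB2; rewrite continuous_open_subspace // => /(_ u); apply; exact: mem_set.
have /nbhs_domainP[r rr Hr] : nbhs z B by exact: open_nbhs_nbhs.
by exists r => // z' /Hr; exact: gB3.
Qed.

(** A homotopy from the identity at t = 0 to the contraction by [tau] at t = 1. *)
Definition radial_scale (t : R) (u : C) : C := b0 + (1 - t * (1 - tau))%:C * (u - b0).
Local Notation sc := radial_scale.

Lemma radial_scale0 u : sc 0 u = u.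
Proof. by rewrite /radial_scale mul0r subr0 mul1r addrC subrK. Qed.

Lemma normc_real_mul (t : R) (z : C) : normc (t%:C * z) = `|t| * normc z.
Proof. by rewrite Normc.normcM normcZ. Qed.

Lemma radial_factor t : 0 <= t -> t <= 1 -> 0 < 1 - t * (1 - tau) <= 1.
Proof.
move=> h0 h1; have h2 : 0 <= t * (1 - tau) by rewrite mulr_ge0 // subr_ge0 ltW.
have h3 : t * (1 - tau) <= 1 - tau by rewrite ler_piMl // subr_ge0 ltW.
by apply/andP; split; move: h2 h3 tau_gt0; lra.
Qed.

Lemma radial_scale_norm t u : 0 <= t -> t <= 1 ->
  normc (sc t u - b0) = (1 - t * (1 - tau)) * normc (u - b0).
Proof.
move=> h0 h1; rewrite /radial_scale addrAC subrr add0r normc_real_mul ger0_norm //.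
by have /andP[/ltW] := radial_factor h0 h1.
Qed.

Lemma radial_scale_W t u : W u -> 0 <= t -> t <= 1 -> W (sc t u).
Proof.
move=> /andP[u0 u1] h0 h1; rewrite /punctured_disk /= radial_scale_norm //.
have /andP[k0 k1] := radial_factor h0 h1.
by apply/andP; split; [rewrite mulr_gt0|apply: le_lt_trans u1; rewrite ler_piMl // ltW].
Qed.

Lemma radial_scale_dist t s u w : 0 <= t -> t <= 1 ->
  normc (sc t u - sc s w) <= `|t - s| * normc (w - b0) + normc (u - w).
Proof.
move=> h0 h1.
have -> : sc t u - sc s w = ((s - t) * (1 - tau))%:C * (w - b0) + (1 - t * (1 - tau))%:C * (u - w).
  by rewrite /radial_scale !rmorphB !rmorphM !rmorphB rmorph1; ring.
apply: le_trans (ler_normcD _ _) _; rewrite !normc_real_mul normrM distrC.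
have -> : `|1 - tau| = 1 - tau by rewrite ger0_norm // subr_ge0 ltW.
have /andP[k0 k1] := radial_factor h0 h1.
have -> : `|1 - t * (1 - tau)| = 1 - t * (1 - tau) by rewrite gtr0_norm.
have := normc_ge0 (w - b0); have := normc_ge0 (u - w); have := normr_ge0 (t - s).
move: (normc (w - b0)) (normc (u - w)) `|t - s| => p q l l0 q0 p0.
have pl : 0 <= p * l by rewrite mulr_ge0.
apply: lerD; last by rewrite ler_piMl.
rewrite mulrAC ler_piMr //; first by rewrite mulrC.
by rewrite gerBl ltW.
Qed.

(** Lifts, up to time s, of the radial paths from all u near [F (v x)]; by the last clause the lift
    over [F (v x')] starts at x' itself. *)
Definition radial_family (x : pt) (s : R) := exists (G : R -> C -> pt) (d : R),
  [/\ 0 < d,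
      forall u, normc (u - F (v x)) < d -> path_cont 0 s (G^~ u),
      forall u t, normc (u - F (v x)) < d -> 0 <= t -> t <= s ->
        V (G t u) /\ F (v (G t u)) = sc t u,
      forall t, 0 <= t -> t <= s -> ccont (fun u => v (G t u)) (F (v x)) &
      exists2 eta : R, 0 < eta & forall x', normc (v x' - v x) < eta -> G 0 (F (v x')) = x'].

Lemma covering_W x : V x -> W (F (v x)).
Proof. by move=> Vx; have [<- _ _] := V_cov; exists x. Qed.

Lemma radial_family0 x : V x -> radial_family x 0.
Proof.
move=> Vx; have [e e0 /(_ x Vx)] := covering_section (covering_W Vx).
rewrite subrr Normc.normc0 => /(_ e0) [g [g1 g2]].
exists (fun _ => g), e; split => //.
- by move=> u _ t _ _ e' e'0; exists 1 => // *; rewrite subrr Normc.normc0.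
- move=> u t hu h0 h1; have -> : t = 0 by apply/le_anti/andP.
  by rewrite radial_scale0; have [] := g1 u hu.
- move=> t _ _; have [] := g1 (F (v x)) => //.
  by rewrite subrr Normc.normc0.
Qed.

(** Past time t the lifts are continued by a section over a disk about the point reached at time s.
    The size of that disk does not depend on t, so one [eta] serves on both sides of s, as induction
    along the interval requires. *)
Lemma radial_family_step x s : V x -> 0 <= s -> s <= 1 -> exists2 eta : R, 0 < eta &
  forall t t', 0 <= t -> t <= t' -> t' <= 1 -> `|t - s| < eta -> `|t' - s| < eta ->
    radial_family x t -> radial_family x t'.
Proof.
move=> Vx s0 s1; set b := F (v x).
have Wb : W b := covering_W Vx; have /andP[_ b1] := Wb.
have [e e0 He] := covering_section (radial_scale_W Wb s0 s1).
have er : 0 < e / (2 * r0) by rewrite divr_gt0 // mulr_gt0.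
exists (e / (2 * r0)) => // t t' t0 tt' t'1 ts t's [G [d [d0 G1 G2 G3 [eta eta0 G4]]]].
have inE t1 u : 0 <= t1 -> t1 <= 1 -> `|t1 - s| < e / (2 * r0) -> normc (u - b) < e / 2 ->
    normc (sc t1 u - sc s b) < e.
  move=> h0 h1 h2 h3; apply: le_lt_trans (radial_scale_dist s u b h0 h1) _.
  have : `|t1 - s| * normc (b - b0) <= e / (2 * r0) * r0.
    by apply: ler_pM => //; [exact: normc_ge0|exact: ltW|exact: ltW].
  have -> : e / (2 * r0) * r0 = e / 2 by field; rewrite gt_eqF.
  lra.
have bb : normc (b - b) < e / 2 by rewrite subrr Normc.normc0 divr_gt0.
have bd : normc (b - b) < d by rewrite subrr Normc.normc0.
have t1 : t <= 1 := le_trans tt' t'1.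
have [Vz Fz] := G2 b t bd t0 (lexx _).
have [g [g1 [r rr g2]]] := He _ Vz (eq_ind_r (fun w => normc (w - _) < e) (inE _ _ t0 t1 ts bb) Fz).
have [d' d'0 Hd'] := G3 t t0 (lexx _) r rr.
have between t1' : t < t1' -> t1' <= t' -> `|t1' - s| < e / (2 * r0).
  by move=> h1 h2; move: ts t's; rewrite !ltr_norml => /andP[? ?] /andP[? ?]; apply/andP; lra.
have sc_cont u : forall t2, ccont (sc t2) u.
  move=> t2 e' e'0; exists (e' / (1 + `|1 - t2 * (1 - tau)|)); first by rewrite divr_gt0 // ltr_pwDl.
  move=> w; rewrite ltr_pdivlMr ?ltr_pwDl // => h.
  have -> : sc t2 w - sc t2 u = (1 - t2 * (1 - tau))%:C * (w - u) by rewrite /radial_scale; ring.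
  rewrite normc_real_mul mulrC; apply: le_lt_trans h; apply: ler_wpM2l; first exact: normc_ge0.
  by rewrite lerDr.
have join u : normc (u - b) < d -> normc (u - b) < d' -> G t u = g (sc t u).
  by move=> h1 h2; have [_ <-] := G2 u t h1 t0 (lexx _); rewrite g2 //; exact: Hd'.
exists (fun t1 u => if t1 <= t then G t1 u else g (sc t1 u)), (Num.min (e / 2) (Num.min d d')).
split.
- by rewrite !lt_min divr_gt0 // d0.
- move=> u; rewrite !lt_min => /and3P[u1 u2 u3].
  apply: continuous_on_segment_paste => //; [exact: G1| |exact: join].
  move=> t2 ht2 t2' e' e'0.
  have t20 : 0 <= t2 := le_trans t0 ht2; have t21 : t2 <= 1 := le_trans t2' t'1.
  have t2s : `|t2 - s| < e / (2 * r0).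
    by move: ht2; rewrite le_eqVlt => /orP[/eqP <- //|h]; exact: between.
  have [_ _ /(_ _ e'0) [q q0 Hq]] := g1 _ (inE t2 u t20 t21 t2s u1).
  exists (q / (1 + normc (u - b0))); first by rewrite divr_gt0 // ltr_pwDl // normc_ge0.
  move=> t3 h1 h2; rewrite ltr_pdivlMr ?ltr_pwDl ?normc_ge0 // => h3; apply: Hq.
  apply: le_lt_trans (radial_scale_dist _ _ _ _ _) _.
  + exact: le_trans h1.
  + exact: le_trans h2 _.
  rewrite subrr Normc.normc0 addr0; apply: le_lt_trans h3.
  by rewrite ler_wpM2l // lerDr.
- move=> u t2; rewrite !lt_min => /and3P[u1 u2 u3] h0 h1.
  have [h|h] := lerP t2 t; first exact: G2.
  by have [] := g1 _ (inE t2 u h0 (le_trans h1 t'1) (between _ h h1) u1).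
- move=> t2 h0 h1; have [h|h] := lerP t2 t; first exact: G3.
  have [_ _ h2] := g1 _ (inE t2 b h0 (le_trans h1 t'1) (between _ h h1) bb).
  exact: (ccont_comp (f := sc t2) (sc_cont b t2) h2).
- by exists eta => // x' /G4; rewrite t0.
Qed.

Lemma radial_family_all x t : V x -> 0 <= t -> t <= 1 -> radial_family x t.
Proof.
move=> Vx; apply: real_induction; first exact: radial_family0.
- move=> s s0 s1 fs; have [eta eta0 H] := radial_family_step Vx s0 (ltW s1).
  exists eta => // u su us u1; apply: (H s) => //; first exact: ltW.
    by rewrite subrr normr0.
  by rewrite gtr0_norm; lra.
- move=> s s0 s1 fs; have [eta eta0 H] := radial_family_step Vx (ltW s0) s1.
  pose u := Num.max 0 (s - eta / 2).
  have u0 : 0 <= u by rewrite /u le_max lexx.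
  have us : u < s by rewrite /u gt_max s0 /=; lra.
  have ud : s - eta / 2 <= u by rewrite /u le_max lexx orbT.
  apply: (H u) => //; [exact: ltW| |by rewrite subrr normr0|exact: fs].
  by rewrite ltr0_norm; lra.
Qed.

Definition radial_lift (x : pt) (g : R -> pt) := [/\ path_cont 0 1 g, g 0 = x &
  forall t, 0 <= t -> t <= 1 -> F (v (g t)) = sc t (F (v x))].

Lemma radial_lift_unique x g g' : radial_lift x g -> radial_lift x g' -> g 1 = g' 1.
Proof.
move=> [g1 g2 g3] [h1 h2 h3].
apply: (@interval_clopen R 0 1 (fun t => g t = g' t)); rewrite ?g2 ?h2 //.
move=> t t0 t1; have [E|E] := eqVneq (g t) (g' t).
- have [r rr Hr] := es_F_inj (set_valP (g t)).
  have [q1 q10 H1] := g1 t t0 t1 r rr; have [q2 q20 H2] := h1 t t0 t1 r rr.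
  exists (Num.min q1 q2); first by rewrite lt_min q10.
  move=> u u0 u1; rewrite lt_min => /andP[ut1 ut2]; split => // _.
  apply: set_val_inj; apply: Hr; [exact: H1|by rewrite E; exact: H2|].
  by rewrite g3 // h3.
- pose e := normc (v (g t) - v (g' t)) / 2.
  have e0 : 0 < e.
    rewrite divr_gt0 // normc_gt0 subr_eq0; apply/eqP => /set_val_inj h.
    by rewrite h eqxx in E.
  have [q1 q10 H1] := g1 t t0 t1 e e0; have [q2 q20 H2] := h1 t t0 t1 e e0.
  exists (Num.min q1 q2); first by rewrite lt_min q10.
  move=> u u0 u1; rewrite lt_min => /andP[ut1 ut2]; split => [h|h]; last by rewrite h eqxx in E.
  exfalso; have k1 := H1 u u0 u1 ut1; have k2 := H2 u u0 u1 ut2; rewrite h in k1.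
  have := ler_normc_dist (v (g t)) (v (g' u)) (v (g' t)); rewrite (normcB (v (g t)) (v (g' u))).
  by move: k1 k2; rewrite /e; lra.
Qed.

Variable rho : R.
Hypothesis tau_rho : tau * r0 <= rho.
Variable N : pt -> Prop.
Hypothesis N_local : forall x, normc (F (v x) - b0) < rho -> exists2 r : R, 0 < r &
  forall z, normc (v z - v x) < r -> (N z <-> N x).

(** The contraction brings all of [V] over the disk of radius [rho], where [N] is locally
    constant. *)
Definition radial_end (x : pt) := exists2 g, radial_lift x g & N (g 1).

Lemma radial_scale1 u : W u -> normc (sc 1 u - b0) < rho.
Proof.
move=> /andP[_ u1]; rewrite radial_scale_norm // mul1r opprB addrCA subrr addr0.
by apply: lt_le_trans tau_rho; rewrite ltr_pM2l.
Qed.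

Lemma radial_end_local x : V x -> exists2 eta : R, 0 < eta &
  forall x', normc (v x' - v x) < eta -> (radial_end x' <-> radial_end x).
Proof.
move=> Vx.
have [G [d [d0 G1 G2 G3 [eta eta0 G4]]]] := radial_family_all Vx ler01 (lexx _).
have bd : normc (F (v x) - F (v x)) < d by rewrite subrr Normc.normc0.
have [_ FG] := G2 _ 1 bd ler01 (lexx _).
have zr : normc (F (v (G 1 (F (v x)))) - b0) < rho.
  by rewrite FG; exact: radial_scale1 (covering_W Vx).
have [r rr Hr] := N_local zr.
have [d1 d10 H1] := G3 1 ler01 (lexx _) r rr.
have dd : 0 < Num.min d d1 by rewrite lt_min d0.
have [r' r'0 Hr'] := es_F_cont X (v x) dd.
have E x' : normc (v x' - v x) < Num.min eta r' -> (radial_end x' <-> N (G 1 (F (v x)))).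
  rewrite lt_min => /andP[/G4 h1 /Hr']; rewrite lt_min => /andP[h2 h3].
  have L : radial_lift x' (G^~ (F (v x'))).
    split; [exact: G1|exact: h1|].
    by move=> t t0 t1; have [] := G2 (F (v x')) t h2 t0 t1.
  rewrite -(Hr _ (H1 _ h3)); split=> [[g Lg Ng]|h]; last by exists (G^~ (F (v x'))).
  by rewrite -(radial_lift_unique Lg L).
exists (Num.min eta r') => [|x' hx']; first by rewrite lt_min eta0.
by rewrite E // E // subrr Normc.normc0 lt_min eta0.
Qed.

Lemma radial_lift_N x g : radial_lift x g -> normc (F (v x) - b0) < rho -> N (g 1) <-> N x.
Proof.
move=> [g1 g2 g3] xr.
suff : (N (g 1) <-> N (g 0)) by rewrite g2.
apply: (@interval_clopen R 0 1 (fun t => N (g t) <-> N (g 0))) => //.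
move=> t t0 t1.
have [r rr Hr] : exists2 r : R, 0 < r & forall z, normc (v z - v (g t)) < r -> (N z <-> N (g t)).
  apply: N_local; rewrite g3 // radial_scale_norm //; apply: le_lt_trans xr.
  by have /andP[_ k1] := radial_factor t0 t1; rewrite ler_piMl ?normc_ge0.
have [q q0 Hq] := g1 t t0 t1 r rr; exists q => // u u0 u1 ut.
by rewrite (Hr _ (Hq u u0 u1 ut)).
Qed.

Hypothesis V_open : open V.
Hypothesis V_connected : connected V.

(* The points of [V] whose radial lift ends in [N] form a clopen subset of [V]. *)
Lemma covering_near_center x z : V x -> normc (F (v x) - b0) < rho -> N x ->
  V z -> normc (F (v z) - b0) < rho -> N z.
Proof.
move=> Vx xr Nx Vz zr.
have lift y : V y -> exists g, radial_lift y g.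
  move=> Vy; have [G [d [d0 G1 G2 G3 [eta eta0 G4]]]] := radial_family_all Vy ler01 (lexx _).
  have bd : normc (F (v y) - F (v y)) < d by rewrite subrr Normc.normc0.
  exists (G^~ (F (v y))); split; first exact: G1.
    by apply: G4; rewrite subrr Normc.normc0.
  by move=> t t0 t1; have [] := G2 _ t bd t0 t1.
pose T := V `&` [set y | radial_end y].
(* Instantiated with the identity and with negation, this gives openness of the set and of its
   complement in [V]. *)
have oP (P : Prop -> Prop) : (forall p q : Prop, (p <-> q) -> P q -> P p) ->
    open (V `&` [set y | P (radial_end y)]).
  move=> Pe; rewrite openE => y [Vy Py].
  have [eta eta0 H] := radial_end_local Vy.
  have nV : nbhs y V by exact: open_nbhs_nbhs.
  have nE : nbhs y [set y' | normc (v y' - v y) < eta] by apply/nbhs_domainP; exists eta.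
  by apply: filterS (filterI nV nE) => y' [Vy' /H h]; split => //; apply: Pe h Py.
have oT : open T by exact: (oP id (fun p q h => iffRL h)).
have oT' : open (V `&` [set y | ~ radial_end y]).
  by apply: (oP not) => p q h nq hp; apply/nq/h.
have TV : T = V.
  apply: V_connected.
  - have [g Lg] := lift x Vx; exists x; split => //; exists g => //.
    exact/(radial_lift_N Lg xr).
  - by exists T => //; rewrite setIA setIid.
  - exists (~` (V `&` [set y | ~ radial_end y])); first exact: open_closedC.
    apply/seteqP; split=> [y [Vy Ey]|y [Vy Ey]]; first by split => // -[].
    by split => //; apply: contrapT => h; apply: Ey.
have [_ [g Lg Ng]] : T z by rewrite TV.
exact/(radial_lift_N Lg zr).
Qed.

End RadialLifting.

(** * The orders of the added points *)

Section RamificationOrder.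
Variables (R : realType) (X : end_system R).
Local Notation C := (Cplx R).
Local Notation F := (es_F X).
Local Notation d := (es_ends X).
Local Notation Y := (R[i] + 'I_d)%type.
Local Notation a := (es_a X).
Local Notation m := (es_m X).
Local Notation psi := (es_psi X).
Local Notation s0 := (es_s0 X).
Local Notation dist := (@end_dist R X).
Local Notation A := (regular_set X).
Local Notation pt := (set_type A).
Variable x0 : pt.
Local Notation L := (log_lrs x0).
Local Notation pi := (@log_pi R X x0).
Local Notation v := (set_val : pt -> C).

Definition end_order (y : Y) : option nat := if m y == 0%N then None else Some (m y).

Lemma open_end_ball (y : Y) (r : R) : open [set y' : end_space X | dist y y' < r].
Proof.
rewrite openE => y' /= h; apply/nbhs_metric_of; exists (r - dist y y'); first by rewrite subr_gt0.
by move=> y'' h'; have := end_dist_triangle y' y y''; rewrite /=; lra.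
Qed.

Lemma log_embed_continuous : continuous (@log_embed R X x0 : pt -> end_space X).
Proof.
move=> x U /nbhs_metric_of[e e0 He]; have [r r0 Hr] := end_dist_inl_small X (v x) e0.
by apply/nbhs_domainP; exists r => // z /Hr; exact: He.
Qed.

Lemma singular_nbhd (y : Y) rho (x : pt) : y \in singular_points X ->
  end_nbhd y rho (v x) ->
  exists s, [/\ complex.Re s < s0 y, expR (complex.Re s) < rho & psi y s = v x].
Proof.
move=> yS [//|yx]; exfalso; move: yS; rewrite yx mem_cat => /orP[/mapP[p pS [xp]]|/mapP[j _] //].
by have := set_valP x; rewrite /regular_set /es_dom xp pS.
Qed.

Lemma chart_image_end_nbhd (y : Y) rho (x : pt) : rho <= expR (s0 y) ->
  y \in singular_points X -> chart_image x0 y rho x <-> end_nbhd y rho (v x).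
Proof.
move=> rs yS; split=> [[s hs <-]|/(singular_nbhd yS) [s [h1 h2 h3]]].
  left; exists s; split => //; first by exact: half_plane_lt hs.
  by rewrite (psi_domE x0 rs hs).
by exists s => //; rewrite /psi_dom h3 val_to_domain.
Qed.

Lemma end_ball_chart_image (y : Y) rho (x : pt) : 0 < rho -> rho <= expR (s0 y) ->
  y \in singular_points X -> chart_image x0 y rho x <-> dist y (inl (v x)) < rho.
Proof.
move=> r0 rs yS; rewrite (chart_image_end_nbhd _ rs yS); split.
  by move=> /(singular_nbhd yS) [s [h1 h2 <-]]; exact: end_ball_psi.
by apply: end_ball => //; exact: set_valP.
Qed.

Lemma end_orderP (y : lrs_star L) : (y : Y) \in singular_points X ->
  ramification_order y (end_order y).
Proof.
move=> yS; split; first exact/range_embedC.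
have [r r0 Hr] := isolated_ball y.
pose rho := Num.min (expR (s0 y)) r.
have rho0 : 0 < rho by rewrite lt_min expR_gt0.
have rs : rho <= expR (s0 y) by rewrite /rho ge_min lexx.
exists [set y' : end_space X | dist y y' < rho], rho.
have -> : @lrs_embed R L @^-1` [set y' : end_space X | dist y y' < rho] = chart_image x0 y rho.
  by apply/seteqP; split=> x /(end_ball_chart_image x rho0 rs yS).
split => //.
- split; first by split; [exact: open_end_ball|rewrite /= end_distxx].
  apply/seteqP; split=> [y' [h /range_embedC h']|_ ->].
    by apply: Hr => //; apply: lt_le_trans h _; rewrite /rho ge_min lexx orbT.
  by split; [rewrite /= end_distxx|exact/range_embedC].
- split; last exact: chart_image_connected.
  have -> : chart_image x0 y rho = @log_embed R X x0 @^-1` [set y' : end_space X | dist y y' < rho].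
    by apply/seteqP; split=> x /(end_ball_chart_image x rho0 rs yS).
  by apply: open_comp; [move=> x _; exact: log_embed_continuous|exact: open_end_ball].
- exact: chart_image_covering.
- exact: chart_image_degree.
Qed.

(** The neighbourhood [U] is arbitrary, but contains a small chart image. Over a point w close to
    the centre, [covering_near_center] shows that the two coverings have the same fibre, so their
    degrees agree; for infinite order the inclusion of fibres suffices. *)
Lemma ramification_order_end (y : lrs_star L) n : ramification_order y n ->
  (y : Y) \in singular_points X /\ n = end_order y.
Proof.
move=> [/range_embedC yS [U [r [[[oU Uy] _] r0 [oV cV] cov deg]]]]; split => //.
set V := @lrs_embed R L @^-1` U in oV cV cov deg.
have /nbhs_metric_of[e e0 He] : nbhs (y : end_space X) U by exact: open_nbhs_nbhs.
pose rho := Num.min (expR (s0 y)) (Num.min e r).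
have rho0 : 0 < rho by rewrite !lt_min expR_gt0 e0.
have rs : rho <= expR (s0 y) by rewrite /rho ge_min lexx.
have re : rho <= e by rewrite /rho !ge_min lexx orbT.
have rr : rho <= r by rewrite /rho !ge_min lexx !orbT.
pose w : C := a y + (rho / 2)%:C.
have wn : normc (w - a y) = rho / 2.
  by rewrite /w addrAC subrr add0r normcZ ger0_norm // divr_ge0 // ltW.
have Ww : punctured_disk (a y) rho w by rewrite /punctured_disk /= wn; apply/andP; split; lra.
have Ww' : punctured_disk (a y) r w by move: Ww => /andP[h1 h2]; apply/andP; split => //; exact: lt_le_trans rr.
have VV x : chart_image x0 y rho x -> V x.
  by move=> /(end_ball_chart_image x rho0 rs yS) h; apply: He; exact: lt_le_trans re.
have degw := chart_image_degree x0 rs Ww.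
have {}deg := deg w Ww'.
rewrite /end_order; case: eqP degw deg => [m0|/eqP m0] degw deg.
  case: n deg => // k deg; exfalso; apply: degw.
  have : finite_set (V `&` pi @^-1` [set w]) by exists k.
  by apply: sub_finite_set => x [/VV Vx xw].
have tau0 : 0 < rho / (2 * r) by rewrite divr_gt0 // mulr_gt0.
have tau1 : rho / (2 * r) < 1 by rewrite ltr_pdivrMr ?mulr_gt0 // mul1r; lra.
have taur : rho / (2 * r) * r <= rho.
  have -> : rho / (2 * r) * r = rho / 2 by field; rewrite gt_eqF.
  lra.
have Nl (x : pt) : normc (F (v x) - a y) < rho -> exists2 q : R, 0 < q & forall z : pt,
    normc (v z - v x) < q -> (end_nbhd y rho (v z) <-> end_nbhd y rho (v x)).
  by move=> h; have [q q0 Hq] := end_nbhd_local rs (set_valP x) h; exists q => // z /Hq.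
have [xb Vxb xbW] : exists2 x, chart_image x0 y rho x & normc (F (v x) - a y) < rho.
  have [x [Vx _]] : (chart_image x0 y rho `&` pi @^-1` [set w]) !=set0.
    have [s hs es] := half_plane_log Ww; exists (psi_dom x0 y s).
    split; first by exists s.
    by rewrite /= /log_pi (pi_psi_dom x0 rs hs) es addrC subrK.
  by exists x => //; apply: end_nbhd_F => //; exact/chart_image_end_nbhd.
have fibE : V `&` pi @^-1` [set w] = chart_image x0 y rho `&` pi @^-1` [set w].
  apply/seteqP; split=> x [Vx xw]; split => //; last exact: VV.
  apply/chart_image_end_nbhd => //.
  apply: (covering_near_center r0 cov tau0 tau1 taur Nl oV cV (VV _ Vxb) xbW _ Vx).
    exact/chart_image_end_nbhd.
  by move: xw; rewrite /= /log_pi => ->; rewrite wn; lra.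
rewrite fibE in deg; case: n deg => [k deg|inf].
  by congr Some; apply/card_eq_II; move: deg; rewrite card_eq_sym => h; exact: card_eq_trans h degw.
by exfalso; apply: inf; exists (m y).
Qed.

Lemma ramification_orderP (y : lrs_star L) n :
  ramification_order y n <-> (y : Y) \in singular_points X /\ n = end_order y.
Proof.
by split=> [/ramification_order_end//|[yS ->]]; exact: end_orderP.
Qed.

End RamificationOrder.

Lemma card_seq_uniq (T : eqType) (s : seq T) : uniq s -> [set x | x \in s] #= `I_(size s).
Proof.
move=> us; case: s us => [|x s] us.
  have -> : [set x : T | x \in [::]] = set0 by apply/seteqP; split.
  by rewrite /= II0 card_eq0.
have -> : [set y | y \in x :: s] = nth x (x :: s) @` `I_(size (x :: s)).
  apply/seteqP; split=> [y ys|_ [i /= hi <-]]; last exact: mem_nth.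
  by exists (index y (x :: s)); [by have := ys : y \in x :: s; rewrite -index_mem|exact: nth_index].
by apply: inj_card_eq => i j /set_mem hi /set_mem hj /eqP; rewrite nth_uniq // => /eqP.
Qed.

Lemma card_pairs (T : eqType) (s : seq T) (f : T -> nat) : uniq s ->
  [set xk : T * nat | xk.1 \in s /\ (xk.2 < f xk.1)%N] #= `I_(\sum_(x <- s) f x).
Proof.
move=> us; pose l := [seq (x, k) | x <- s, k <- iota 0 (f x)].
have -> : [set xk : T * nat | xk.1 \in s /\ (xk.2 < f xk.1)%N] = [set xk | xk \in l].
  apply/seteqP; split=> [[x k] /= [xs kf]|_ /= /allpairsPdep[x [k [xs kf ->]]]].
    by apply/allpairsPdep; exists x, k; rewrite mem_iota.
  by rewrite mem_iota in kf.
have <- : size l = (\sum_(x <- s) f x)%N.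
  rewrite size_allpairs_dep sumnE big_map; apply: eq_bigr => x _; exact: size_iota.
apply: card_seq_uniq; apply: allpairs_uniq_dep => //.
  by move=> x _; exact: iota_uniq.
by move=> [x k] [y l'] _ _ /= [-> ->].
Qed.

Lemma sum_count_undup (T : eqType) (s : seq T) : (\sum_(x <- undup s) count_mem x s)%N = size s.
Proof.
rewrite -[RHS](perm_size (perm_count_undup s)) size_flatten sumnE /shape -map_comp big_map.
by apply: eq_bigr => x _; rewrite /= size_nseq.
Qed.

(** * The plane as finite completion *)

Section EndSystemSurface.
Variables (R : realType) (X : end_system R).
Local Notation C := (Cplx R).
Local Notation F := (es_F X).
Local Notation d := (es_ends X).
Local Notation Y := (R[i] + 'I_d)%type.
Local Notation m := (es_m X).
Local Notation s0 := (es_s0 X).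
Local Notation A := (regular_set X).
Local Notation pt := (set_type A).
Variable x0 : pt.
Local Notation L := (log_lrs x0).

Definition plane_incl (z : complex_plane R) : lrs_star L := inl z : Y.
Definition plane_proj (y : lrs_star L) : complex_plane R := if (y : Y) is inl z then z else 0.

Lemma infinite_ramificationE :
  @infinite_ramification R L = (fun j => inr j : Y) @` [set: 'I_d].
Proof.
apply/seteqP; split=> [y /ramification_orderP [yS]|_ [j _ <-]].
  case: y yS => [p|j] _; last by exists j.
  by rewrite /end_order; case: eqP => // h; have := es_m_inl X p; rewrite h.
apply/ramification_orderP; split; last by rewrite /end_order es_m_inr.
by rewrite /singular_points mem_cat orbC map_f // mem_enum.
Qed.

Lemma mem_singular_inl p : (inl p \in singular_points X) = (p \in es_sing X).
Proof.
rewrite /singular_points mem_cat mem_map; last by move=> ? ? [].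
by rewrite orbC; case: mapP => // -[].
Qed.

Lemma finite_ramificationP (y : lrs_star L) k : ramification_order y (Some k) <->
  exists p, [/\ p \in es_sing X, y = plane_incl p & k = m (inl p)].
Proof.
split=> [/ramification_orderP [yS]|[p [pS -> ->]]].
  rewrite /end_order; case: eqP => // h [->].
  case: y yS h => [p|j]; last by rewrite es_m_inr.
  by rewrite mem_singular_inl => pS _; exists p.
apply/ramification_orderP; rewrite /end_order [X in X \in _]/plane_incl mem_singular_inl; split => //.
by case: eqP => // h; have := es_m_inl X p; rewrite h.
Qed.

Lemma plane_incl_range :
  range plane_incl = range (@lrs_embed R L) `|` @finite_ramification R L.
Proof.
apply/seteqP; split=> [_ [p _ <-]|y [[x _ <-]|[k /finite_ramificationP [p [_ -> _]]]]].
- have [pS|pS] := boolP (p \in es_sing X).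
    by right; exists (m (inl p)); apply/finite_ramificationP; exists p.
  by left; exists (to_domain x0 p) => //; rewrite /lrs_embed /= /log_embed to_domainK.
- by exists (set_val x).
- by exists p.
Qed.

Lemma plane_incl_continuous : continuous (plane_incl : C -> end_space X).
Proof.
move=> p U /nbhs_metric_of[e e0 He]; have [r r0 Hr] := end_dist_inl_small X p e0.
by apply/nbhs_CplxP; exists r => // z /Hr; exact: He.
Qed.

(** For the inverse: a point z close to p in the metric is either singular, hence p itself by
    isolation, or regular, hence in a small chart neighbourhood of p. *)
Lemma plane_incl_homeo : homeo_on setT (range plane_incl) plane_incl plane_proj.
Proof.
split => //; first by apply: continuous_subspaceT; exact: plane_incl_continuous.
apply/subspace_continuousP => _ [p _ <-] U /nbhs_CplxP[e e0 He].
have [rho rho0 Hrho] := end_nbhd_inl_small X p e0.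
have [r r0 Hr] := isolated_ball (inl p : Y).
apply/nbhs_metric_of; exists (Num.min (Num.min rho (expR (s0 (inl p)))) r).
  by rewrite !lt_min rho0 expR_gt0.
move=> y; rewrite lt_min => /andP[h1 h2] [z _ zy]; move: h1 h2; rewrite -zy => h1 h2.
apply: He => /=; have [zS|zS] := boolP (z \in es_sing X).
  have [->] : (inl z : Y) = inl p by apply: Hr h2; rewrite mem_singular_inl.
  by rewrite subrr Normc.normc0.
apply: Hrho; have : end_nbhd (inl p : Y) (Num.min rho (expR (s0 (inl p)))) z.
  by apply: end_ball => //; rewrite ge_min lexx orbT.
move=> [[s [k1 k2 k3]]|]; last by right.
by left; exists s; split => //; move: k2; rewrite lt_min => /andP[].
Qed.

Lemma plane_map_holomorphic : holomorphic (F : complex_plane R -> complex_plane R).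
Proof.
move=> p; split; first by apply/continuous_CplxP; exact: es_F_cont.
by move=> c c' -> -> _ _ /=; exact: derivable_Cplx (es_F_der X p).
Qed.

Definition plane_completion : finite_completion L :=
  @FiniteCompletion R L (complex_plane R) plane_incl plane_incl_range
    (ex_intro _ plane_proj plane_incl_homeo)
    (set_val : pt -> C) (fun x => erefl)
    (@domain_inclusion_holomorphic R A (@es_dom_open R X) x0 (@regular_connected R X x0))
    F (fun x => esym (es_a_inl X x)) plane_map_holomorphic.

Lemma plane_identity_biholomorphism :
  biholomorphism (id : complex_plane R -> complex_plane R).
Proof.
have h : holomorphic (id : complex_plane R -> complex_plane R).
  by move=> p; split=> [|c c' -> -> _ _ /=]; [exact: cvg_id|exact: derivable_id].
by split => //; exists id.
Qed.

Theorem end_system_surface : exists (L' : log_riemann_surface R) (fc : finite_completion L'),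
  [/\ @infinite_ramification R L' #= `I_d,
      @finite_ramification_mult R L' #= `I_(\sum_(p <- undup (es_sing X)) (m (inl p)).-1) &
      exists Ftilde : complex_plane R -> fc,
        biholomorphism Ftilde /\ forall z : complex_plane R, fc_pi (Ftilde z) = F z].
Proof.
exists L, plane_completion; split.
- rewrite infinite_ramificationE; apply: card_eq_trans (inj_card_eq _) _.
    by move=> i j _ _ [].
  by rewrite card_eq_sym; exact: card_II.
- pose f (xk : R[i] * nat) : Y * nat := (inl xk.1, xk.2).
  have -> : @finite_ramification_mult R L =
      f @` [set xk : R[i] * nat | xk.1 \in undup (es_sing X) /\ (xk.2 < (m (inl xk.1)).-1)%N].
    apply/seteqP; split=> [[y k] [n /= /finite_ramificationP [p [pS -> ->]] kn]|].
      by exists (p, k) => //=; rewrite mem_undup.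
    move=> _ [[p k] /= [pS kn] <-]; exists (m (inl p)) => //.
    by apply/finite_ramificationP; exists p; split => //; rewrite -mem_undup.
  apply: card_eq_trans (inj_card_eq _) _; first by move=> [p k] [q l] _ _ [-> ->].
  by apply: (card_pairs (fun p => (m (inl p)).-1)); exact: undup_uniq.
- by exists id; split => //; exact: plane_identity_biholomorphism.
Qed.

End EndSystemSurface.

(** * The end system of Q e^P *)

Section PolyExpEndSystem.
Variable R : realType.
Local Notation C := R[i].
Local Notation cexp := (@cexpi R).

Lemma poly_bounded (p : {poly C}) (B : R) : exists2 K : R, 0 <= K &
  forall z, normc z <= B -> normc p.[z] <= K.
Proof.
elim/poly_ind: p => [|p c [K K0 HK]].
  by exists 0 => // z _; rewrite horner0 Normc.normc0.
exists (K * `|B| + normc c) => [|z hz]; first by rewrite addr_ge0 ?mulr_ge0 ?normc_ge0.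
rewrite hornerMXaddC; apply: (le_trans (ler_normcD _ _)); rewrite lerD2r Normc.normcM.
by apply: ler_pM; rewrite ?normc_ge0 ?HK //; exact: le_trans hz (ler_norm B).
Qed.

Lemma log_chart_domain (F : C -> C) (S S' : C -> Prop) a m s0 psi :
  (forall z, S z -> S' z) -> log_chart F S a m s0 psi -> log_chart F S' a m s0 psi.
Proof. by move=> SS [h1 h2]; split => // s /h1 [/SS]. Qed.

Variables (P Q : {poly C}) (d1 d2 : nat).
Hypothesis degP : size P = d1.+1.
Hypothesis degQ : size Q = d2.+1.
Variable F : C -> C.
Hypothesis F_der : forall z, cder F z (Q.[z] * cexp P.[z]).
Local Notation dF z := (Q.[z] * cexp P.[z]).

Lemma cder_cexp_poly z : cder (fun w => cexp P.[w]) z (cexp P.[z] * P^`().[z]).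
Proof. exact: cder_comp (cder_poly P z) (cder_cexp _). Qed.

Lemma poly_exp_cont (q : {poly C}) z : ccont (fun w => q.[w] * cexp P.[w]) z.
Proof. exact: cder_cont (cderM (cder_poly q z) (cder_cexp_poly z)). Qed.

Lemma poly_exp_lipschitz (B : R) : exists2 K : R, 0 <= K & forall z w,
  normc z <= B -> normc w <= B -> normc (F z - F w) <= K * normc (z - w).
Proof.
have [KP KP0 HP] := poly_bounded P B; have [KQ KQ0 HQ] := poly_bounded Q B.
exists (KQ * expR KP) => [|z w hz hw]; first by rewrite mulr_ge0 ?expR_ge0.
have := @mean_value_segment R F (fun u => dF u) w z 0 (KQ * expR KP) _.
rewrite mul0r subr0; apply => t /andP[t0 t1] u; split; first exact: F_der.
have uB : normc u <= B.
  have -> : u = (1 - t)%:C * w + t%:C * z by rewrite /u rmorphB rmorph1; ring.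
  apply: (le_trans (ler_normcD _ _)).
  rewrite !Normc.normcM !normcZ !ger0_norm ?subr_ge0 //.
  have h1 := ler_wpM2l t0 hz; have h2 : (1 - t) * normc w <= (1 - t) * B.
    by apply: ler_wpM2l hw; rewrite subr_ge0.
  by apply: (le_trans (lerD h2 h1)); rewrite -mulrDl subrK mul1r.
rewrite subr0 Normc.normcM normc_cexp; apply: ler_pM; rewrite ?normc_ge0 ?expR_ge0 ?HQ //.
by rewrite ler_expR; apply: le_trans (HP u uB); exact: le_trans (ler_norm _) (ler_Re_normc _).
Qed.

Variable rs : seq C.
Hypothesis Q_factor : Q = lead_coef Q *: \prod_(z <- rs) ('X - z%:P).

Lemma lead_coef_neq0 : lead_coef Q != 0.
Proof. by rewrite lead_coef_eq0 -size_poly_eq0 degQ. Qed.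

Lemma size_roots : size rs = d2.
Proof.
by have := degQ; rewrite Q_factor size_scale ?lead_coef_neq0 // size_prod_XsubC => -[].
Qed.

Lemma horner_neq0 z : (Q.[z] != 0) = (z \notin rs).
Proof.
rewrite -[_ == 0]/(root Q z) Q_factor rootZ ?lead_coef_neq0 //.
by rewrite root_prod_XsubC.
Qed.

Lemma root_multiplicity p : exists2 q : {poly C}, q.[p] != 0 &
  Q = ('X - p%:P) ^+ count_mem p rs * q.
Proof.
exists (lead_coef Q *: \prod_(z <- rs | z != p) ('X - z%:P)).
  rewrite hornerZ mulf_neq0 ?lead_coef_neq0 // horner_prod prodf_seq_neq0.
  by apply/allP => z _; apply/implyP => zp; rewrite hornerXsubC subr_eq0 eq_sym.
rewrite {1}Q_factor -scalerAr (bigID (pred1 p)) /=; congr (_ *: (_ * _)).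
rewrite (eq_bigr (fun=> 'X - p%:P)) => [|z /eqP -> //].
by rewrite big_const_seq iter_mulr_1.
Qed.

(** A regular point has multiplicity 0 in [rs] and gets a chart of period 2 pi i. *)
Lemma poly_exp_finite_chart p : exists t : R * (C -> C),
  [/\ log_chart F (fun z => z \notin rs) (F p) (count_mem p rs).+1 t.1 t.2,
      forall e, 0 < e -> exists M, forall s, complex.Re s < t.1 -> complex.Re s < M ->
        normc (t.2 s - p) < e &
      forall M, exists2 e, 0 < e & forall z, z != p -> normc (z - p) < e ->
        exists s, [/\ complex.Re s < t.1, complex.Re s < M & t.2 s = z]].
Proof.
have [q qp Qq] := root_multiplicity p.
have F_der' z : cder F z ((z - p) ^+ (count_mem p rs).+1.-1 * (q.[z] * cexp P.[z])).
  by have := F_der z; rewrite Qq hornerM horner_exp hornerXsubC mulrA.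
have near : exists2 r : R, 0 < r & forall z, z != p -> normc (z - p) < r -> z \notin rs.
  have [r r0 Hr] := finite_separated p rs; exists r => // z zp hz.
  by apply/negP => /Hr /(_ zp); rewrite leNgt hz.
have Gp0 : q.[p] * cexp P.[p] != 0 by rewrite mulf_neq0 ?cexp_neq0.
have [s0 [psi H]] := finite_log_chart (ltn0Sn _) F_der' (poly_exp_cont q p) Gp0 near.
by exists (s0, psi).
Qed.

Lemma poly_exp_end_system : exists X : end_system R,
  [/\ es_F X = F, es_sing X = rs, es_ends X = d1 &
      forall p, es_m X (inl p) = (count_mem p rs).+1].
Proof.
have [t Ht] := choice poly_exp_finite_chart.
have [a [s0 [psi [E1 E2 E3 E4]]]] := poly_exp_ends degP degQ F_der.
pose a' (y : C + 'I_d1) := match y with inl p => F p | inr j => a j end.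
pose m' (y : C + 'I_d1) := match y with inl p => (count_mem p rs).+1 | inr j => 0%N end.
pose s0' (y : C + 'I_d1) := match y with inl p => (t p).1 | inr j => s0 j end.
pose psi' (y : C + 'I_d1) := match y with inl p => (t p).2 | inr j => psi j end.
have chartP y : log_chart F (fun z => z \notin rs) (a' y) (m' y) (s0' y) (psi' y).
  case: y => [p|j]; first by have [] := Ht p.
  by apply: log_chart_domain (E1 j) => z; rewrite horner_neq0.
have dF_neq0 z : z \notin rs -> dF z != 0.
  by rewrite -horner_neq0 => h; rewrite mulf_neq0 ?cexp_neq0.
have escape (M : R) : exists K r : R, 0 < r /\ forall z, K < normc z ->
    (exists j s, [/\ complex.Re s < s0 j, complex.Re s < M & psi j s = z]) \/
    (exists g : C -> C, g (F z) = z /\ forall b, normc (b - F z) < r ->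
       [/\ F (g b) = b, ccont g b & normc (g b) <= 2 * normc z]).
  have [delta [K [d0 HK]]] := E4 M.
  have [K' [r [_ r0 HK']]] := uniform_branch degP degQ F_der d0.
  exists (Num.max K K'), r; split => // z; rewrite gt_max => /andP[/HK h1 /ltW/HK' h2].
  (* Where F' is large [uniform_branch] gives an inverse branch; where it is small z is deep in an
     end. *)
  have [h|h] := lerP (delta * normc z ^+ d1) (normc (dF z) * normc z); last by left; exact: h1.
  right; have [g [g1 g2]] := h2 h; exists g; split => // b /g2 [k1 k2 k3 k4].
  by split => //; exact: cder_cont k3.
exists (@EndSystem R F (fun z => dF z) rs d1 a' m' s0' psi' F_der (poly_exp_cont Q) dF_neq0
  poly_exp_lipschitz chartP (fun=> erefl) (fun=> isT) (fun=> erefl)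
  (fun p => let: And3 _ h _ := Ht p in h) (fun p => let: And3 _ _ h := Ht p in h)
  E2 E3 escape).
by [].
Qed.

End PolyExpEndSystem.

Theorem theorem1p2 (R : realType) (P Q : {poly R[i]}) (d1 d2 : nat)
    (degP : size P = d1.+1) (degQ : size Q = d2.+1)
    (F : Cplx R -> Cplx R)
    (F_deriv : forall z : Cplx R, is_derive z 1 F (Q.[z] * cexp P.[z])) :
  exists (L : log_riemann_surface R) (X : finite_completion L),
    [/\ @infinite_ramification R L #= `I_d1,
        @finite_ramification_mult R L #= `I_d2 &
        exists Ftilde : complex_plane R -> X,
          biholomorphism Ftilde /\
          forall z : complex_plane R, fc_pi (Ftilde z) = F z].
Proof.
have F_der z : cder F z (Q.[z] * cexpi P.[z]).
  by rewrite cexpi.unlock; apply/is_derive_CplxP; exact: F_deriv.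
have [rs Q_factor] := closed_field_poly_normal Q.
have [X [XF Xs Xe Xm]] := poly_exp_end_system degP degQ F_der Q_factor.
have [x0 Ax0] : exists z : Cplx R, regular_set X z.
  have [s [h _]] := exists_deep (X := X) (inl 0) 0.
  by have [Ss _ _] := es_psiP h; exists (es_psi X (inl 0) s).
have [L [fc [h1 h2 [Ft [h3 h4]]]]] := end_system_surface
  (exist _ x0 (mem_set Ax0) : set_type (regular_set X)).
exists L, fc; split.
- by rewrite -Xe.
(* The order at p is its multiplicity plus one, so the sum counts the roots of [Q] with
   multiplicity. *)
- have <- : (\sum_(p <- undup (es_sing X)) (es_m X (inl p)).-1)%N = d2.
    rewrite Xs (eq_bigr (fun p => count_mem p rs)) ?sum_count_undup ?(size_roots degQ Q_factor) // => p _.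
    by rewrite Xm.
  exact: h2.
- by exists Ft; split => // z; rewrite h4 XF.
Qed.
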